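(* Let $\underline d\in\mathbb N^{N+1}$ and $0\le r<\min\underline d$. Let $C$ be the codimension of $\overline\Sigma^r_{\underline d}$ in $\mathrm{Rep}_{\underline d}$ (over $\mathbb C$) and $\theta$ the number of its irreducible components of codimension $C$. Then the smallest degree $c$ for which the homogeneous component $(\mathcal A^r_{\underline d})_c$ is nonzero equals $C$, and $(\mathcal A^r_{\underline d})_C$ is a free $\mathbb Z$-module of rank $\theta$.
   Context: $\mathrm{Rep}_{\underline d}=\prod_{i=1}^N\mathrm{Mat}_{d_i,d_{i-1}}(\mathbb C)$; $\overline\Sigma^r_{\underline d}=\{A_*:\operatorname{rank}(A_N\cdots A_1)\le r\}$. Let $R_{\underline d}=\mathbb Z[x_{ij}:0\le i\le N,\ 1\le j\le d_i]$, graded with all $x_{ij}$ of degree 1, and $H_{\underline d}=R_{\underline d}^{S_{\underline d}}$ the invariants of $S_{\underline d}=S_{d_0}\times\dots\times S_{d_N}$, where $S_{d_i}$ permutes $x_{i1},\dots,x_{id_i}$. Let $\psi_r:R_{\underline d}\to\mathbb Z[y_1,\dots,y_{r+1},x_{ij}:0\le i\le N,\ r+1<j\le d_i]$ be the ring homomorphism with $x_{ij}\mapsto y_j$ if $j\le r+1$ (for every $i$) and $x_{ij}\mapsto x_{ij}$ if $j>r+1$; $\phi_r$ is its restriction to $H_{\underline d}$, and $\mathcal A^r_{\underline d}=\ker\phi_r$, a homogeneous ideal of $H_{\underline d}$. *)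

(* Defs.v *)
From mathcomp Require Import all_boot all_algebra.
From mathcomp Require Import fingroup perm.
From mathcomp Require Import complex reals.
From mathcomp Require Import mpoly.
Set Implicit Arguments. Unset Strict Implicit. Unset Printing Implicit Defensive.
Import GRing.Theory.
Local Open Scope ring_scope.

Definition dn (N : nat) (d : 'I_N.+1 -> nat) (k : nat) : nat := d (inord k).

(* Rep_d = prod_{i=1}^N Mat_{d_i, d_{i-1}}(K); the matrix of index        *)
(* i : 'I_N stands for A_{i+1} : K^{d_i} -> K^{d_{i+1}}.                 *)
Definition Rep (K : fieldType) (N : nat) (d : 'I_N.+1 -> nat) : Type :=
  forall i : 'I_N, 'M[K]_(dn d i.+1, dn d i).

Fixpoint prodRep (K : fieldType) (N : nat) (d : 'I_N.+1 -> nat)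
    (A : Rep K d) (k : nat) : (k <= N)%N -> 'M[K]_(dn d k, dn d 0) :=
  match k return (k <= N)%N -> 'M[K]_(dn d k, dn d 0) with
  | 0 => fun _ => 1%:M
  | k'.+1 => fun h => A (Ordinal h) *m prodRep A (ltnW h)
  end.

Definition Sigma (K : fieldType) (N : nat) (d : 'I_N.+1 -> nat) (r : nat)
    (A : Rep K d) : Prop :=
  (\rank (prodRep A (leqnn N)) <= r)%N.

Section Zariski.
Variables (K : fieldType) (T : Type) (I : Type) (coord : I -> T -> K).

Inductive polyfun : (T -> K) -> Prop :=
  | pf_const (c : K) : polyfun (fun _ => c)
  | pf_coord (i : I) : polyfun (coord i)
  | pf_add f g : polyfun f -> polyfun g -> polyfun (fun x => f x + g x)
  | pf_mul f g : polyfun f -> polyfun g -> polyfun (fun x => f x * g x).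

Definition subsetP (X Y : T -> Prop) : Prop := forall x, X x -> Y x.
Definition eqsetP (X Y : T -> Prop) : Prop := forall x, X x <-> Y x.

Definition zclosed (Z : T -> Prop) : Prop :=
  exists F : (T -> K) -> Prop, (forall f, F f -> polyfun f) /\
    forall x, Z x <-> (forall f, F f -> f x = 0).

Definition zirreducible (Z : T -> Prop) : Prop :=
  [/\ zclosed Z, exists x, Z x &
      forall Z1 Z2, zclosed Z1 -> zclosed Z2 ->
        subsetP Z (fun x => Z1 x \/ Z2 x) -> subsetP Z Z1 \/ subsetP Z Z2].

Definition zchain (X : T -> Prop) (n : nat) : Prop :=
  exists Z : nat -> T -> Prop,
    (forall k, (k <= n)%N -> zirreducible (Z k) /\ subsetP (Z k) X) /\
    (forall k, (k < n)%N -> subsetP (Z k) (Z k.+1) /\ ~ subsetP (Z k.+1) (Z k)).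

Definition has_dim (X : T -> Prop) (n : nat) : Prop :=
  zchain X n /\ ~ zchain X n.+1.

Definition zcomponent (X Z : T -> Prop) : Prop :=
  [/\ zirreducible Z, subsetP Z X &
      forall Z', zirreducible Z' -> subsetP Z' X -> subsetP Z Z' -> subsetP Z' Z].
End Zariski.

Definition RepCoord (K : fieldType) (N : nat) (d : 'I_N.+1 -> nat) :=
  {i : 'I_N & ('I_(dn d i.+1) * 'I_(dn d i))%type}.
Definition repcoord (K : fieldType) (N : nat) (d : 'I_N.+1 -> nat)
    (c : RepCoord K d) (A : Rep K d) : K :=
  A (tag c) (tagged c).1 (tagged c).2.

(* variables x_{ij}, 0 <= i <= N, j : 'I_(d_i) (paper's j = our j + 1)   *)
Definition Var (N : nat) (d : 'I_N.+1 -> nat) : finType :=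
  {i : 'I_N.+1 & 'I_(d i)}.
Definition nvar (N : nat) (d : 'I_N.+1 -> nat) : nat := #|Var d|.

Definition Rd (N : nat) (d : 'I_N.+1 -> nat) := {mpoly int[(nvar d)]}.
Definition xvar (N : nat) (d : 'I_N.+1 -> nat) (v : Var d) : Rd d :=
  'X_(enum_rank v).

Definition Sd_act (N : nat) (d : 'I_N.+1 -> nat)
    (s : forall i : 'I_N.+1, {perm 'I_(d i)}) (p : Rd d) : Rd d :=
  comp_mpoly [tuple xvar (Tagged (fun i => 'I_(d i))
                  (s (tag (enum_val k)) (tagged (enum_val k)))) | k < nvar d] p.

Definition inH (N : nat) (d : 'I_N.+1 -> nat) (p : Rd d) : Prop :=
  forall s : forall i : 'I_N.+1, {perm 'I_(d i)}, Sd_act s p = p.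

(* target ring Z[y_1..y_{r+1}, x_ij : j > r+1]; the y's are 'I_r.+1 and *)
(* the remaining x's are the variables x_ij with (0-based) j >= r+1.      *)
Definition TVar (N : nat) (d : 'I_N.+1 -> nat) (r : nat) : finType :=
  ('I_r.+1 + {v : Var d | (r.+1 <= tagged v)%N})%type.
Definition ntvar (N : nat) (d : 'I_N.+1 -> nat) (r : nat) : nat := #|TVar d r|.
Definition Td (N : nat) (d : 'I_N.+1 -> nat) (r : nat) := {mpoly int[(ntvar d r)]}.

Definition psi_img (N : nat) (d : 'I_N.+1 -> nat) (r : nat) (v : Var d) : Td d r :=
  match @insub _ (fun v : Var d => (r.+1 <= tagged v)%N) _ v with
  | Some w => 'X_(enum_rank (inr w : TVar d r))
  | None => 'X_(enum_rank (inl (inord (tagged v)) : TVar d r))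
  end.

Definition psi (N : nat) (d : 'I_N.+1 -> nat) (r : nat) (p : Rd d) : Td d r :=
  comp_mpoly [tuple psi_img r (enum_val k) | k < nvar d] p.

Definition inA (N : nat) (d : 'I_N.+1 -> nat) (r : nat) (p : Rd d) : Prop :=
  inH p /\ psi r p = 0.

Definition inAc (N : nat) (d : 'I_N.+1 -> nat) (r c : nat) (p : Rd d) : Prop :=
  inA r p /\ p \is c.-homog.

(* M (a subset of a Z-module V, closed under Z-linear combinations) is a *)
(* free Z-module of rank t: it has a Z-basis indexed by 'I_t.            *)
Definition free_Zmod_rank (V : lmodType int) (M : V -> Prop) (t : nat) : Prop :=
  exists b : 'I_t -> V,
    [/\ forall k, M (b k),
        (forall c : 'I_t -> int, \sum_k c k *: b k = 0 -> forall k, c k = 0) &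
        forall p, M p -> exists c : 'I_t -> int, p = \sum_k c k *: b k].

(* Main.v *)
Require Import Defs.
From HB Require Import structures.
From mathcomp Require Import all_boot all_order all_algebra.
From mathcomp Require Import fingroup perm.
From mathcomp Require Import complex boolp reals.
From mathcomp Require Import mpoly.
From mathcomp Require Import ring zify.

(* Let [p] minimise [d], [n = d_p], and consider weights [w : {0..N} -> nat] with [w_p = r]
   and [sum_i w_i = n]. Both sides are governed by the cost
     [F(w) = binom(n-r,2) + sum_(i <> p) (w_i (d_i - n) + binom(w_i + 1, 2))]:
   [C] is its minimum and [theta] the number of minimising weights.

   Geometry: [Sigma] is the union of the irreducible closed sets of the [A] preserving some
   flag of subspaces [V_k] of dimension [v_k], namely the kernel of [A_N .. A_(k+1)] for
   [k <= p] and the image of [V_p] for [k > p]. Such a set is the closure of the image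
   of an affine space of matrices; the differential of the parametrisation at a matrix of
   block identities is injective, so the dimension is the number of parameters, which is
   [dim Rep - F(w)], where [w] records the jumps of [v]. Ranks of composites through [p]
   separate the sets.

   Algebra: a relation of [A^r] vanishes at every point where [r + 1] of the variables of the
   group [p] are matched in each of the other groups. From a pattern of partial matchings,
   keep specialising: the relation restricted to a pattern is divisible by the differences
   of all pairs of variables whose identification leads to a pattern where it vanishes, and
   there are at least [C] of them. This kills the degrees below [C], and in degree [C] leaves
   one value per minimiser [w]. Conversely the quotient of the determinant of
   [(x_(p,j)^l prod_b (x_(i,b) - x_(p,j)))], with [w_i] values of [l] for each [i], by the
   Vandermonde determinant in the [x_(p,j)] has degree [F(w)], lies in [A^r], and is nonzero
   at the test point of [w] only. *)

Set Implicit Arguments. Unset Strict Implicit. Unset Printing Implicit Defensive.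
Import Order.TTheory GRing.Theory Num.Theory.
Local Open Scope ring_scope.

(** The same F comes out of both counts. Assign each of the n - r positions not fully matched to one
    group, w_i of them to group i. The differences available are x_(p,b) - x_(i,c) with b and c free
    for i, w_i (w_i + d_i - n) of them, and x_(p,b) - x_(p,c) for positions of different groups,
    binom(n-r,2) - sum_i binom(w_i,2) of them; the total is F(w). In the geometry, with u_k = d_k -
    v_k, preserving the V_k costs u_(k+1) v_k entries per arrow and choosing V_k gives back u_k v_k
    parameters; telescoping on each side of p yields F again. The change of description at p
    matters: as d_p is minimal, at the block identities no nonzero morphism goes from the
    subrepresentation to the quotient, so no parameter is lost. Dimension is defined by chains. It
    is bounded above by extracting an algebraically independent function from each strict inclusion,
    and below by images of coordinate subspaces. The value of a determinantal class at its test
    point need not be a unit, so these classes need not form a basis; freeness comes from a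
    triangular basis built by Euclidean division. *)

Local Notation zsubset := Defs.subsetP.

(** * Zariski closures and dimension *)

Section Polyfun.
Variables (K : fieldType) (T I : Type) (coord : I -> T -> K).

Lemma polyfun_ext (f g : T -> K) : polyfun coord f -> f =1 g -> polyfun coord g.
Proof. by move=> pf /funext <-. Qed.

Lemma polyfun_opp f : polyfun coord f -> polyfun coord (fun x => - f x).
Proof.
move=> pf; apply: polyfun_ext (pf_mul (pf_const coord (-1)) pf) _ => x.
by rewrite mulN1r.
Qed.

Lemma polyfun_sub f g :
  polyfun coord f -> polyfun coord g -> polyfun coord (fun x => f x - g x).
Proof. by move=> pf pg; exact: pf_add pf (polyfun_opp pg). Qed.

Lemma polyfun_sum (J : Type) (s : seq J) (P : pred J) (F : J -> T -> K) :
  (forall j, P j -> polyfun coord (F j)) ->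
  polyfun coord (fun x => \sum_(j <- s | P j) F j x).
Proof.
move=> pF; elim: s => [|j s IH].
  by apply: polyfun_ext (pf_const coord 0) _ => x; rewrite big_nil.
case Pj: (P j); last by apply: polyfun_ext IH _ => x; rewrite big_cons Pj.
by apply: polyfun_ext (pf_add (pF j Pj) IH) _ => x; rewrite big_cons Pj.
Qed.

Lemma polyfun_prod (J : Type) (s : seq J) (P : pred J) (F : J -> T -> K) :
  (forall j, P j -> polyfun coord (F j)) ->
  polyfun coord (fun x => \prod_(j <- s | P j) F j x).
Proof.
move=> pF; elim: s => [|j s IH].
  by apply: polyfun_ext (pf_const coord 1) _ => x; rewrite big_nil.
case Pj: (P j); last by apply: polyfun_ext IH _ => x; rewrite big_cons Pj.
by apply: polyfun_ext (pf_mul (pF j Pj) IH) _ => x; rewrite big_cons Pj.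
Qed.

Lemma polyfun_exp f n : polyfun coord f -> polyfun coord (fun x => f x ^+ n).
Proof.
move=> pf; elim: n => [|n IH]; first exact: pf_const.
by apply: polyfun_ext (pf_mul pf IH) _ => x; rewrite exprS.
Qed.

Lemma polyfun_meval n (P : {mpoly K[n]}) (f : 'I_n -> T -> K) :
  (forall i, polyfun coord (f i)) ->
  polyfun coord (fun x => P.@[fun i => f i x]).
Proof.
move=> pf; have H : polyfun coord
    (fun x => \sum_(m <- msupp P) P@_m * \prod_i f i x ^+ m i).
  apply: polyfun_sum => m _; apply: pf_mul; first exact: pf_const.
  by apply: polyfun_prod => i _; apply: polyfun_exp.
by apply: polyfun_ext H _ => x; rewrite mevalE.
Qed.

Lemma polyfun_det n (F : T -> 'M[K]_n) :
  (forall i j, polyfun coord (fun x => F x i j)) ->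
  polyfun coord (fun x => \det (F x)).
Proof.
move=> pF; apply: polyfun_sum => s _; apply: pf_mul; first exact: pf_const.
by apply: polyfun_prod => i _.
Qed.

Lemma polyfun_mulmx m n q (F : T -> 'M[K]_(m, n)) (G : T -> 'M[K]_(n, q)) :
  (forall i j, polyfun coord (fun x => F x i j)) ->
  (forall i j, polyfun coord (fun x => G x i j)) ->
  forall i j, polyfun coord (fun x => (F x *m G x) i j).
Proof.
move=> pF pG i j.
apply: polyfun_ext (_ : polyfun coord (fun x => \sum_k F x i k * G x k j)) _.
  by apply: polyfun_sum => k _; apply: pf_mul.
by move=> x; rewrite mxE.
Qed.

Definition zclosure (S : T -> Prop) : T -> Prop :=
  fun x => forall f, polyfun coord f -> (forall y, S y -> f y = 0) -> f x = 0.

Lemma zclosure_closed S : zclosed coord (zclosure S).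
Proof.
exists (fun f => polyfun coord f /\ forall y, S y -> f y = 0).
split=> [f [] //|x]; split=> [cx f [pf fS]|cx f pf fS]; first exact: cx.
exact: cx.
Qed.

Lemma zclosure_sub S x : S x -> zclosure S x.
Proof. by move=> Sx f _; exact. Qed.

Lemma zclosure_min S Z : zclosed coord Z -> zsubset S Z -> zsubset (zclosure S) Z.
Proof.
move=> [F [pF defZ]] SZ x cx; apply/defZ => f Ff.
by apply: cx => [|y /SZ/defZ]; [exact: pF | exact].
Qed.

Lemma zclosedU Z1 Z2 : zclosed coord Z1 -> zclosed coord Z2 ->
  zclosed coord (fun x => Z1 x \/ Z2 x).
Proof.
move=> [F1 [pF1 d1]] [F2 [pF2 d2]].
exists (fun f => exists f1 f2, [/\ F1 f1, F2 f2 & f = fun x => f1 x * f2 x]).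
split=> [f [f1 [f2 [/pF1 pf1 /pF2 pf2 ->]]]|x]; first exact: pf_mul.
split=> [Zx f [f1 [f2 [Ff1 Ff2 ->]]]|H].
  by case: Zx => [/d1/(_ _ Ff1)->|/d2/(_ _ Ff2)->]; rewrite ?mul0r ?mulr0.
have [/d1|] := EM (forall f, F1 f -> f x = 0); first by left.
move=> /existsNP[f1 /not_implyP[Ff1 f1x]]; right; apply/d2 => f2 Ff2.
have := H _ (ex_intro _ f1 (ex_intro _ f2 (And3 Ff1 Ff2 erefl))).
by move/eqP; rewrite mulf_eq0 => /orP[/eqP|/eqP].
Qed.

Lemma zclosed0 : zclosed coord (fun _ => False).
Proof.
exists (fun f => f = fun _ => 1); split=> [f ->|x]; first exact: pf_const.
by split=> // /(_ _ erefl)/eqP; rewrite oner_eq0.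
Qed.

(** Finite-union form of irreducibility, by induction on the list of pieces; the point of [Z]
    excludes the empty union. *)
Lemma zirreducible_subU (Z : T -> Prop) (J : finType) (X : J -> T -> Prop) :
  zirreducible coord Z -> (forall j, zclosed coord (X j)) ->
  zsubset Z (fun x => exists j, X j x) -> exists j, zsubset Z (X j).
Proof.
move=> [cZ [z0 Zz0] irrZ] cX ZX.
have cl (s : seq J) : zclosed coord (fun x => exists2 j, j \in s & X j x).
  elim: s => [|j s IH].
    have -> : (fun x => exists2 j : J, j \in [::] & X j x) = (fun=> False).
      by apply/funext => x; apply/propext; split=> // -[].
    exact: zclosed0.
  have -> : (fun x => exists2 i, i \in j :: s & X i x) =
            (fun x => X j x \/ exists2 i, i \in s & X i x).
    apply/funext => x; apply/propext; split; [case=> i|].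
      by rewrite inE => /predU1P[->|si] Xx; [left | right; exists i].
    case=> [Xx|[i si Xx]]; first by exists j; rewrite ?mem_head.
    by exists i; rewrite // inE si orbT.
  exact: zclosedU.
have {}ZX : zsubset Z (fun x => exists2 j, j \in enum J & X j x).
  by move=> x /ZX[j Xx]; exists j; rewrite ?mem_enum.
elim: (enum J) ZX => [|j s IH] ZX; first by have [j] := ZX z0 Zz0.
have {}ZX : zsubset Z (fun x => X j x \/ exists2 i, i \in s & X i x).
  move=> x Zx; have [i si Xx] := ZX x Zx.
  by move: si; rewrite inE => /predU1P[<-|si]; [left | right; exists i].
by have [] := irrZ _ _ (cX j) (cl s) ZX; [exists j | exact: IH].
Qed.

End Polyfun.

Lemma polyfun_comp (K : fieldType) (T1 I1 T2 I2 : Type)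
    (c1 : I1 -> T1 -> K) (c2 : I2 -> T2 -> K) (phi : T1 -> T2) :
  (forall i, polyfun c1 (fun t => c2 i (phi t))) ->
  forall f, polyfun c2 f -> polyfun c1 (fun t => f (phi t)).
Proof.
move=> pphi f; elim=> [c|i|g h _ pg _ ph|g h _ pg _ ph]; first exact: pf_const.
- exact: pphi.
- exact: pf_add.
- exact: pf_mul.
Qed.

Definition acoord (K : fieldType) (n : nat) : 'I_n -> ('I_n -> K) -> K :=
  fun i t => t i.

Lemma polyfun_acoordP (K : fieldType) n F : polyfun (@acoord K n) F ->
  exists P : {mpoly K[n]}, forall t, F t = P.@[t].
Proof.
elim=> [c|i|g h _ [P hP] _ [Q hQ]|g h _ [P hP] _ [Q hQ]].
- by exists c%:MP => t; rewrite mevalC.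
- by exists 'X_i => t; rewrite mevalXU.
- by exists (P + Q) => t; rewrite mevalD hP hQ.
- by exists (P * Q) => t; rewrite mevalM hP hQ.
Qed.

Section Muni.
Variables (K : fieldType) (n : nat).
Implicit Type P : {mpoly K[n.+1]}.
Local Notation widen := (widen_ord (leqnSn n)).

Lemma muni_meval P t : P.@[t] =
  (map_poly (meval (fun i => t (widen i))) (muni P)).[t ord_max].
Proof.
rewrite muniE raddf_sum /= horner_sum mevalE; apply: eq_bigr => m _.
rewrite map_polyZ map_polyXn hornerZ hornerXn /= mevalZ mevalX.
rewrite big_ord_recr /= mulrA; congr (_ * _ * _).
by apply: eq_bigr => i _; rewrite mnmE.
Qed.

(** The coefficient of [m] in [P] is read off from [muni P] by splitting the last exponent from the
    others. *)
Lemma muni_inj P : muni P = 0 -> P = 0.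
Proof.
move=> P0; apply/mpolyP => m; rewrite mcoeff0.
pose tr (m : 'X_{1..n.+1}) := [multinom (m (widen i)) | i < n].
have trE m' : (tr m' == tr m) && (m' ord_max == m ord_max) = (m' == m).
  apply/andP/eqP => [[/eqP tm /eqP mx]|->]; last by rewrite !eqxx.
  apply/mnmP => i; have [j ->|->] := unliftP ord_max i; last by [].
  have /mnmP/(_ j) := tm; rewrite !mnmE.
  by have -> : widen j = lift ord_max j by apply/val_inj; rewrite /= /bump leqNgt ltn_ord.
have := congr1 (fun q : {poly {mpoly K[n]}} => (q`_(m ord_max))@_(tr m)) P0.
rewrite muniE coef0 mcoeff0 coef_sum raddf_sum /=.
rewrite (eq_bigr (fun m' => if m' == m then P@_m' else 0)); last first.
  move=> m' _; rewrite coefZ coefXn -trE [m ord_max == _]eq_sym.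
  case: (m' ord_max == m ord_max); last by rewrite andbF mulr0 mcoeff0.
  rewrite mulr1 andbT mcoeffZ mcoeffX.
  by rewrite -/(tr m'); case: eqP => _; rewrite ?mulr1 ?mulr0.
have [mP|mP _] := boolP (m \in msupp P); last exact: memN_msupp_eq0.
by rewrite (bigD1_seq m) ?msupp_uniq //= eqxx big1 ?addr0 // => m' /negbTE->.
Qed.

End Muni.

Section InfiniteField.
Variable K : fieldType.
Hypothesis Kinf : forall s : seq K, exists x, x \notin s.

(** Density of a nonempty open subset of the line: [s * q] vanishes everywhere on an infinite field,
    hence is zero. *)
Lemma poly_cofinite_eq0 (q s : {poly K}) :
  s != 0 -> (forall x, s.[x] != 0 -> q.[x] = 0) -> q = 0.
Proof.
move=> s0 qs; have H x : (s * q).[x] = 0.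
  by rewrite hornerM; have [->|/qs->] := eqVneq s.[x] 0; rewrite ?mul0r ?mulr0.
have sq0 : s * q = 0.
  apply/eqP; apply: contraT => sq0.
  have [l [ul rl]] : exists l : seq K, uniq l /\ size l = size (s * q).
    elim: (size (s * q)) => [|m [l [ul sl]]]; first by exists [::].
    by have [x xl] := Kinf l; exists (x :: l); rewrite /= xl ul sl.
  have := max_poly_roots sq0 _ ul; rewrite rl ltnn => -> //.
  by apply/allP => x _; rewrite rootE H.
by move/eqP: sq0; rewrite mulf_eq0 (negbTE s0) => /eqP.
Qed.

Lemma poly_fun_eq0 (q : {poly K}) : (forall x, q.[x] = 0) -> q = 0.
Proof. by move=> q0; apply: (@poly_cofinite_eq0 _ 1) => //; exact: oner_neq0. Qed.

Lemma mpoly_fun_eq0 n (P : {mpoly K[n]}) : (forall t, P.@[t] = 0) -> P = 0.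
Proof.
elim: n P => [|n IH] P P0.
  have PC : P = (P@_0%MM)%:MP.
    by apply/mpolyP => m; rewrite mcoeffC (_ : m = 0%MM) ?eqxx ?mulr1 //; apply/mnmP => -[].
  by have := P0 (fun _ => 0); rewrite PC mevalC => ->; rewrite mpolyC0.
apply: muni_inj; apply/polyP => i; rewrite coef0; apply: IH => t.
have mp0 : map_poly (meval t) (muni P) = 0.
  apply: poly_fun_eq0 => s.
  pose ts i := if unlift ord_max i is Some j then t j else s.
  have := P0 ts; rewrite muni_meval /ts unlift_none => <-; congr (_.[_]).
  apply: eq_map_poly => p; apply: meval_eq => j.
  have -> : widen_ord (leqnSn n) j = lift ord_max j.
    by apply/val_inj; rewrite /= /bump leqNgt ltn_ord.
  by rewrite liftK.
by have := congr1 (fun q : {poly K} => q`_i) mp0; rewrite coef_map coef0.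
Qed.

End InfiniteField.

(** [msize] is the degree plus one; in this form the degree bound also covers zero factors. *)
Lemma msizeM_leS n (K : idomainType) (P Q : {mpoly K[n]}) a b :
  (msize P <= a.+1)%N -> (msize Q <= b.+1)%N -> (msize (P * Q) <= (a + b).+1)%N.
Proof.
move=> Pa Qb; have [->|P0] := eqVneq P 0; first by rewrite mul0r msize0.
have [->|Q0] := eqVneq Q 0; first by rewrite mulr0 msize0.
rewrite msizeM // -ltnS prednK; last by rewrite addn_gt0 lt0n mmeasure_poly_eq0 P0.
by rewrite -addSn -addnS leq_add.
Qed.

Section AlgebraicDependence.
Variable K : fieldType.

(** Products of powers of the [P i] with exponents below [k] outnumber the monomials they can
    involve, so their coefficient matrix has a nonzero left kernel. *)
Lemma algebraic_dependence e n (P : 'I_n -> {mpoly K[e]}) : (e < n)%N ->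
  exists2 Q : {mpoly K[n]}, Q != 0 & forall t, Q.@[fun k => (P k).@[t]] = 0.
Proof.
(* The products have degree at most k n D, hence exponents below B = k c. As k > c^e and n > e, k^n
   >= k^(e+1) > k^e c^e = B^e. *)
move=> en; pose D := (\sum_k msize (P k))%N; pose c := (n * D).+1.
pose k := (c ^ e).+1; pose B := (k * c)%N.
pose A := {ffun 'I_n -> 'I_k}; pose Bf := {ffun 'I_e -> 'I_B}.
pose mA (a : A) := [multinom (a i : nat) | i < n].
pose mB (b : Bf) := [multinom (b i : nat) | i < e].
pose M (a : A) := \prod_i P i ^+ a i.
have sP i : (msize (P i) <= D.+1)%N by rewrite /D (bigD1 i) //= leqW // leq_addr.
have sM a : (msize (M a) <= (k * n * D).+1)%N.
  have H (s : seq 'I_n) : (msize (\prod_(i <- s) P i ^+ a i) <= (size s * (k * D)).+1)%N.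
    elim: s => [|i s IH]; first by rewrite big_nil msize1.
    rewrite big_cons mulSn; apply: msizeM_leS IH.
    have : (msize (P i ^+ a i) <= (a i * D).+1)%N.
      elim: (nat_of_ord (a i)) => [|j IHj]; first by rewrite expr0 msize1.
      by rewrite exprS mulSn; apply: msizeM_leS.
    by move/leq_trans; apply; rewrite ltnS leq_mul2r ltnW ?ltn_ord ?orbT.
  by have := H (enum 'I_n); rewrite big_enum size_enum_ord mulnA [(n * k)%N]mulnC.
pose G := \matrix_(a < #|{: A}|, b < #|{: Bf}|) (M (enum_val a))@_(mB (enum_val b)).
have cards : (#|{: Bf}| < #|{: A}|)%N.
  rewrite !card_ffun !card_ord /B expnMn.
  apply: (@leq_trans (k ^ e * k)); first by rewrite ltn_pmul2l ?expn_gt0.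
  by rewrite -expnSr leq_pexp2l.
have : kermx G != 0.
  by rewrite -mxrank_eq0 mxrank_ker subn_eq0 -ltnNge (leq_ltn_trans (rank_leq_col _)).
case/rowV0Pn => u /sub_kermxP uG u0.
exists (\sum_a u 0 a *: 'X_[mA (enum_val a)]).
  apply: contraNneq u0 => Q0; apply/eqP/rowP => a; rewrite mxE.
  have := congr1 (mcoeff (mA (enum_val a))) Q0.
  rewrite mcoeff0 raddf_sum /= (bigD1 a) //= mcoeffZ mcoeffX eqxx mulr1.
  rewrite big1 ?addr0 // => a' a'a; rewrite mcoeffZ mcoeffX.
  case: eqP => [E|]; rewrite ?mulr0 //; case/negP: a'a; apply/eqP/enum_val_inj/ffunP => i.
  by move/mnmP: E => /(_ i); rewrite !mnmE => /val_inj.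
have comb0 : \sum_a u 0 a *: M (enum_val a) = 0.
  apply/mpolyP => m; rewrite mcoeff0 raddf_sum /=.
  have [/forallP mb|] := boolP [forall i, m i < B]%N.
    pose b : Bf := [ffun i => Ordinal (mb i)].
    have mbE : m = mB b by apply/mnmP => i; rewrite mnmE ffunE.
    have := congr1 (fun X : 'rV_#|{: Bf}| => X 0 (enum_rank b)) uG; rewrite !mxE => uGb; rewrite -[RHS]uGb.
    by apply: eq_bigr => a _; rewrite mcoeffZ mxE enum_rankK mbE.
  rewrite negb_forall => /existsP[l]; rewrite -leqNgt => Bi.
  apply: big1 => a _; rewrite mcoeffZ memN_msupp_eq0 ?mulr0 //.
  apply: contraL Bi => /msize_mdeg_lt; rewrite -ltnNge => mdM.
  have im : (m l <= mdeg m)%N by rewrite mdegE (bigD1 l) //= leq_addr.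
  by have := sM (enum_val a); rewrite /B /c; nia.
move=> t; rewrite raddf_sum /=.
have := congr1 (meval t) comb0; rewrite meval0 raddf_sum /= => ct0; rewrite -[RHS]ct0.
apply: eq_bigr => a _; rewrite !mevalZ mevalX /M rmorph_prod /=.
by congr (_ * _); apply: eq_bigr => i _; rewrite rmorphXn mnmE.
Qed.

End AlgebraicDependence.

(** * Chains of irreducible sets and algebraic independence *)

Section Dimension.
Variable K : fieldType.
Hypothesis Kinf : forall s : seq K, exists x, x \notin s.
Variables (T I : Type) (coord : I -> T -> K).

Definition zindep (S : T -> Prop) n (f : 'I_n -> T -> K) :=
  forall P : {mpoly K[n]}, (forall x, S x -> P.@[fun k => f k x] = 0) -> P = 0.

Definition polymap e (phi : ('I_e -> K) -> T) :=
  forall i, polyfun (@acoord K e) (fun t => coord i (phi t)).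

Definition image e (phi : ('I_e -> K) -> T) : T -> Prop :=
  fun x => exists t, x = phi t.

Lemma zirreducible_mul_eq0 Z (f g : T -> K) : zirreducible coord Z ->
  polyfun coord f -> polyfun coord g -> (forall x, Z x -> f x * g x = 0) ->
  (forall x, Z x -> f x = 0) \/ (forall x, Z x -> g x = 0).
Proof.
move=> [_ _ irrZ] pf pg fg.
have cl h : polyfun coord h -> zclosed coord (fun x => h x = 0).
  move=> ph; exists (fun k => k = h); split=> [k ->|x] //.
  by split=> [hx k ->|] //; apply.
apply: irrZ (cl _ pf) (cl _ pg) _ => x /fg/eqP.
by rewrite mulf_eq0 => /orP[] /eqP; [left | right].
Qed.

Lemma polyfun_horner_map n (f : 'I_n -> T -> K) g (Q : {poly {mpoly K[n]}}) :
  (forall k, polyfun coord (f k)) -> polyfun coord g ->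
  polyfun coord (fun x => (map_poly (meval (fun k => f k x)) Q).[g x]).
Proof.
move=> pf pg; elim/poly_ind: Q => [|Q c IH].
  by apply: polyfun_ext (pf_const coord 0) _ => x; rewrite rmorph0 horner0.
apply: polyfun_ext (pf_add (pf_mul IH pg) (polyfun_meval c pf)) _ => x.
by rewrite rmorphD rmorphM /= map_polyX map_polyC !hornerE.
Qed.

(** A strict inclusion of [Z k] in [Z k.+1] provides a function [g] vanishing on the first set but
    not on the second. In a relation involving [g], the part free of [g] vanishes on [Z k], so it is
    zero by induction; irreducibility then permits division by [g]. *)
Lemma zchain_zindep X n : zchain coord X n ->
  exists Z, [/\ zirreducible coord Z, zsubset Z X &
    exists f : 'I_n -> T -> K, (forall k, polyfun coord (f k)) /\ zindep Z f].
Proof.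
move=> [Z [irr inc]]; exists (Z n).
have [iZ ZX] := irr n (leqnn n); split=> // {iZ ZX}.
suff: forall k, (k <= n)%N ->
    exists f : 'I_k -> T -> K, (forall j, polyfun coord (f j)) /\ zindep (Z k) f.
  by apply.
have {}irr k : (k <= n)%N -> zirreducible coord (Z k) by case/irr.
elim=> [|k IH] kn.
  exists (fun _ _ => 0); split=> [j|P P0]; first exact: pf_const.
  have [_ [x Zx] _] := irr 0%N kn; apply: mpoly_fun_eq0 => // t.
  by rewrite -(P0 x Zx); apply: meval_eq => -[].
have [f [pf indf]] := IH (ltnW kn); have [ZkS ZSk] := inc k kn.
have [[F [pF dF]] _ _] := irr k (ltnW kn).
have [g [Fg gk [y [Zy gy]]]] : exists g, [/\ polyfun coord g,
    forall x, Z k x -> g x = 0 & exists y, Z k.+1 y /\ g y <> 0].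
  have /existsNP [y /not_implyP[Zy nZy]] := ZSk.
  have /existsNP [g /not_implyP[Fg gy]] : ~ forall f, F f -> f y = 0.
    by move=> H; apply: nZy; apply/dF.
  exists g; split; [exact: pF | by move=> x /dF/(_ _ Fg) | by exists y].
pose f' i := if unlift ord_max i is Some j then f j else g.
exists f'; split=> [i|P P0]; first by rewrite /f'; case: unliftP.
have {}P0 x : Z k.+1 x -> (map_poly (meval (fun j => f j x)) (muni P)).[g x] = 0.
  move=> /P0; rewrite muni_meval /f' unlift_none => <-; congr (_.[_]).
  apply: eq_map_poly => p; apply: meval_eq => j.
  have -> : widen_ord (leqnSn k) j = lift ord_max j.
    by apply/val_inj; rewrite /= /bump leqNgt ltn_ord.
  by rewrite liftK.
(* View the relation as a polynomial in [g] and remove its coefficients starting from the constant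
   one. *)
apply: muni_inj; elim/poly_ind: (muni P) P0 => [|Q c IHQ] //= Q0.
have {}Q0 x : Z k.+1 x ->
    (map_poly (meval (fun j => f j x)) Q).[g x] * g x + c.@[fun j => f j x] = 0.
  by move=> /Q0; rewrite rmorphD rmorphM /= map_polyX map_polyC !hornerE.
have c0 : c = 0.
  by apply: indf => x Zx; have := Q0 x (ZkS _ Zx); rewrite (gk x Zx) mulr0 add0r.
have [||gZ] := zirreducible_mul_eq0 (irr _ kn) (polyfun_horner_map Q pf Fg) Fg.
- by move=> x /Q0; rewrite c0 meval0 addr0.
- by move=> /IHQ ->; rewrite mul0r add0r c0.
- by case: gy; apply: gZ.
Qed.

Lemma polymap_comp e (phi : ('I_e -> K) -> T) f : polymap phi -> polyfun coord f ->
  polyfun (@acoord K e) (fun t => f (phi t)).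
Proof. by move=> pphi pf; apply: (polyfun_comp (c2 := coord)). Qed.

Lemma zclosure_image_irreducible e (phi : ('I_e -> K) -> T) :
  polymap phi -> zirreducible coord (zclosure coord (image phi)).
Proof.
move=> pphi; split; first exact: zclosure_closed.
  by exists (phi (fun _ => 0)); apply: zclosure_sub; exists (fun _ => 0).
move=> Z1 Z2 cZ1 cZ2 cov.
have [|H1] := EM (zsubset (image phi) Z1); first by left; apply: zclosure_min.
have [|H2] := EM (zsubset (image phi) Z2); first by right; apply: zclosure_min.
have wit Z : zclosed coord Z -> ~ zsubset (image phi) Z ->
    exists f, [/\ polyfun coord f, forall x, Z x -> f x = 0 &
      exists t, f (phi t) <> 0].
  move=> [F [pF dF]] /existsNP [x /not_implyP[[t ->] nZ]].
  have /existsNP [g /not_implyP[Fg gy]] : ~ forall f, F f -> f (phi t) = 0.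
    by move=> H; apply: nZ; apply/dF.
  by exists g; split; [exact: pF | move=> y /dF/(_ _ Fg) | exists t].
have [f1 [p1 f1Z [t1 n1]]] := wit _ cZ1 H1.
have [f2 [p2 f2Z [t2 n2]]] := wit _ cZ2 H2.
have [P1 e1] := polyfun_acoordP (polymap_comp pphi p1).
have [P2 e2] := polyfun_acoordP (polymap_comp pphi p2).
have /eqP : P1 * P2 = 0.
  apply: mpoly_fun_eq0 => // t; rewrite mevalM -e1 -e2.
  have [/f1Z->|/f2Z->] := cov (phi t) (zclosure_sub (ex_intro _ t erefl)).
    by rewrite mul0r.
  by rewrite mulr0.
rewrite mulf_eq0 => /orP[] /eqP P0; first by case: n1; rewrite e1 P0 meval0.
by case: n2; rewrite e2 P0 meval0.
Qed.

Lemma zindep_image_leq e (phi : ('I_e -> K) -> T) n (f : 'I_n -> T -> K) Z :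
  polymap phi -> (forall k, polyfun coord (f k)) -> zindep Z f ->
  zsubset Z (zclosure coord (image phi)) -> (n <= e)%N.
Proof.
move=> pphi pf indf Zphi; rewrite leqNgt; apply/negP => en.
have /choice [P eP] k := polyfun_acoordP (polymap_comp pphi (pf k)).
have [Q Q0 Qphi] := algebraic_dependence P en.
case/eqP: Q0; apply: indf => x /Zphi zx.
apply: (zx (fun x => Q.@[fun k => f k x])); first exact: polyfun_meval.
by move=> _ [t ->]; rewrite -[RHS](Qphi t); apply: meval_eq => k; rewrite eP.
Qed.

(** Upper bound for the dimension: a chain of length [m] yields an irreducible set carrying [m]
    independent functions; it lies in a single piece of the cover, whose number of parameters is
    then at least [m]. *)
Lemma zchain_cover (J : finType) (e : J -> nat) (phi : forall j, ('I_(e j) -> K) -> T)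
    X n m : (forall j, polymap (phi j)) ->
  zsubset X (fun x => exists j, zclosure coord (image (phi j)) x) ->
  (forall j, (e j <= n)%N) -> (n < m)%N -> ~ zchain coord X m.
Proof.
move=> pphi cov en nm /zchain_zindep [Z [irrZ ZX [f [pf indf]]]].
have [j] := zirreducible_subU irrZ (fun j => zclosure_closed coord (image (phi j)))
  (fun x Zx => cov x (ZX x Zx)).
by move=> /(zindep_image_leq (pphi j) pf indf); rewrite leqNgt (leq_ltn_trans (en j)).
Qed.

End Dimension.

(** * Dimension of a parametrised set *)

Section TangentDimension.
Variable K : fieldType.
Hypothesis Kinf : forall s : seq K, exists x, x \notin s.
Variables (T I : Type) (coord : I -> T -> K).

(* The lowest homogeneous component of a relation [P] among the [f k] vanishes
   at every tangent vector [t]: it is the leading term in [s] of [P] along a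
   curve with velocity [t]. *)
Lemma zindep_tangent S n (f : 'I_n -> T -> K) :
  (forall t : 'I_n -> K, exists q : 'I_n -> {poly K}, exists x : K -> T,
    forall s, S (x s) /\ forall k, f k (x s) = s * t k + s ^+ 2 * (q k).[s]) ->
  zindep S f.
Proof.
move=> curve P P0; apply/mpolyP => m; rewrite mcoeff0.
have [l] := ubnP (mdeg m); elim: l m => // l IH m; rewrite ltnS => ml.
case: (ltngtP (mdeg m) l) ml => // [/IH->//|ml _].
pose Pl := \sum_(m <- msupp P | mdeg m == l) P@_m *: 'X_[m].
have -> : P@_m = Pl@_m.
  rewrite /Pl raddf_sum /=; have [mP|mP] := boolP (m \in msupp P).
    rewrite -big_filter (bigD1_seq m) ?filter_uniq ?msupp_uniq ?mem_filter ?ml ?eqxx //=.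
    rewrite mcoeffZ mcoeffX eqxx mulr1 big1 ?addr0 // => m' /negbTE m'm.
    by rewrite mcoeffZ mcoeffX m'm mulr0.
  rewrite memN_msupp_eq0 // big_seq_cond big1 // => m' /andP[m'P _].
  rewrite mcoeffZ mcoeffX; case: eqP => [E|]; last by rewrite mulr0.
  by rewrite -E m'P in mP.
suff -> : Pl = 0 by rewrite mcoeff0.
apply: (mpoly_fun_eq0 Kinf) => t; have [q [x Sx]] := curve t.
(* Along the curve [f k] equals [s * c k], so [P] becomes a polynomial in [s] whose coefficient in
   degree [l] is the value of [Pl] at [t]. *)
pose c k := (t k)%:P + 'X * q k.
have R0 : \sum_(m <- msupp P) P@_m *: ('X ^+ mdeg m * \prod_k c k ^+ m k) = 0.
  apply: (poly_fun_eq0 Kinf) => s; have [/P0 Ps fs] := Sx s.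
  rewrite horner_sum -[RHS]Ps mevalE; apply: eq_bigr => m' _.
  rewrite hornerZ hornerM hornerXn horner_prod mdegE -prodrXr -big_split /=.
  congr (_ * _); apply: eq_bigr => k _; rewrite fs horner_exp -exprMn.
  by rewrite !hornerE; congr (_ ^+ _); ring.
have := congr1 (fun p : {poly K} => p`_l) R0; rewrite coef0 coef_sum => E.
rewrite -[RHS]E /Pl raddf_sum /= [RHS](bigID (fun m' => mdeg m' == l)) /=.
rewrite [X in _ = _ + X]big1 ?addr0 => [|m' ml'].
  apply: eq_bigr => m' /eqP ml'; rewrite mevalZ mevalX coefZ coefXnM ml' ltnn subnn.
  rewrite -horner_coef0 horner_prod; congr (_ * _); apply: eq_bigr => k _.
  by rewrite horner_exp /c !hornerE.
rewrite coefZ coefXnM; case: ltnP => [|lm]; first by rewrite mulr0.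
by rewrite IH ?mul0r // ltn_neqAle ml' lm.
Qed.

Variables (e : nat) (phi : ('I_e -> K) -> T) (f : 'I_e -> T -> K).
Hypothesis pphi : polymap coord phi.
Hypothesis pf : forall k, polyfun coord (f k).
Hypothesis tangent_phi : forall t, exists q : 'I_e -> {poly K}, forall s k,
  f k (phi (fun l => s * t l)) = s * t k + s ^+ 2 * (q k).[s].

(** The chain consists of the closures of the images of the first [i] coordinates. Inclusions are
    strict: [i + 1] of the [f k] are independent on the larger set, while the smaller one has only
    [i] parameters. *)
Lemma zchain_image : zchain coord (zclosure coord (image phi)) e.
Proof.
pose tr i (t : 'I_e -> K) := fun l : 'I_e => if (l < i)%N then t l else 0.
exists (fun i => zclosure coord (image (fun t => phi (tr i t)))).
have ptr i : polymap coord (fun t => phi (tr i t)).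
  move=> k; apply: (polyfun_comp (c2 := @acoord K e)) (pphi k) => j.
  by rewrite /acoord /tr; case: (j < i)%N; [exact: (pf_coord _ j) | exact: pf_const].
split=> i ie; split.
- exact: zclosure_image_irreducible.
- apply: zclosure_min; first exact: zclosure_closed.
  by move=> _ [t ->]; apply: zclosure_sub; exists (tr i t).
- apply: zclosure_min; first exact: zclosure_closed.
  move=> _ [t ->]; apply: zclosure_sub; exists (tr i t); congr phi; apply/funext => l.
  by rewrite /tr; case: (ltnP l i) => li; rewrite ?if_same // ltnS ltnW.
move=> sub; pose f' (k : 'I_i.+1) := f (widen_ord ie k).
have indf : zindep (zclosure coord (image (fun t => phi (tr i.+1 t)))) f'.
  apply: zindep_tangent => t.
  pose t' (l : 'I_e) := if insub (val l) is Some l' then t l' else 0 : K.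
  have [q qE] := tangent_phi t'.
  exists (fun k => q (widen_ord ie k)), (fun s => phi (fun l => s * t' l)) => s.
  split=> [|k].
    apply: zclosure_sub; exists (fun l => s * t' l); congr phi; apply/funext => l.
    by rewrite /tr /t'; case: insubP => [l' ->|/negbTE->] //; rewrite mulr0.
  by rewrite /f' qE /t' valK.
pose phii (t : 'I_i -> K) :=
  phi (fun l => if insub (val l) is Some l' then t l' else 0).
have pphii : polymap coord phii.
  move=> k; apply: (polyfun_comp (c2 := @acoord K e)) (pphi k) => j.
  by rewrite /acoord /=; case: insubP => [l _ _|_]; [exact: (pf_coord _ l) | exact: pf_const].
have := zindep_image_leq pphii (fun k => pf (widen_ord ie k)) indf.
rewrite ltnn => H; have // : false; apply: H => x /sub; apply: zclosure_min.
  exact: zclosure_closed.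
move=> _ [t ->]; apply: zclosure_sub; exists (fun l => t (widen_ord (ltnW ie) l)).
congr phi; apply/funext => l; rewrite /tr; case: insubP => [l' _ ll'|/negbTE->] //.
by rewrite -ll' ltn_ord; congr t; apply/val_inj; rewrite /= ll'.
Qed.

Lemma has_dim_image : has_dim coord (zclosure coord (image phi)) e.
Proof.
split; first exact: zchain_image.
apply: (@zchain_cover K Kinf T I coord unit (fun _ => e) (fun _ => phi)) (leqnn _) => // x; exists tt.
Qed.

End TangentDimension.

(** * Evaluation of relations *)

Section Evaluation.
Variables (N : nat) (d : 'I_N.+1 -> nat).
Local Notation V := (Var d).
Local Notation mkV i b := (Tagged (fun k => 'I_(d k)) (b : 'I_(d i)) : V).

Definition ev (S : comNzRingType) (x : V -> S) (q : Rd d) : S :=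
  mmap (intmul 1) (fun k => x (enum_val k)) q.

HB.instance Definition _ S x := GRing.RMorphism.copy (@ev S x)
  (mmap (intmul 1) (fun k => x (enum_val k))).

Lemma ev_xvar (S : comNzRingType) (x : V -> S) v : ev x (xvar v) = x v.
Proof. by rewrite /ev /xvar mmapX mmap1U enum_rankK. Qed.

Lemma ev_eq (S : comNzRingType) (x y : V -> S) q : x =1 y -> ev x q = ev y q.
Proof. by move=> xy; congr ev; apply/funext. Qed.

Lemma rmorph_ev (S S' : comNzRingType) (g : {rmorphism S -> S'}) (x : V -> S) q :
  g (ev x q) = ev (fun v => g (x v)) q.
Proof.
rewrite /ev /mmap rmorph_sum; apply: eq_bigr => m _.
rewrite rmorphM rmorph_int /mmap1 rmorph_prod; congr (_ * _).
by apply: eq_bigr => i _; rewrite rmorphXn.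
Qed.

Lemma comp_mpoly_ev k (x : V -> {mpoly int[k]}) q :
  comp_mpoly [tuple x (enum_val k) | k < nvar d] q = ev x q.
Proof.
rewrite /comp_mpoly /ev /mmap; apply: eq_bigr => m _; congr (_ * _).
  by rewrite -{1}[q@_m]intz rmorph_int.
by apply: eq_bigr => i _; rewrite tnth_mktuple.
Qed.

Lemma ev_id q : ev (@xvar N d) q = q.
Proof.
rewrite -[RHS]comp_mpoly_id -comp_mpoly_ev; congr comp_mpoly.
by apply/eq_from_tnth => k; rewrite !tnth_mktuple /xvar enum_valK.
Qed.

(** Indexing by natural numbers lets the same position [b] be used in groups of different sizes
    without casts; only the entries with [b < d i] matter. *)
Definition evn (S : comNzRingType) (z : 'I_N.+1 -> nat -> S) (q : Rd d) : S :=
  ev (fun v => z (tag v) (tagged v)) q.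

HB.instance Definition _ S z := GRing.RMorphism.copy (@evn S z)
  (ev (fun v => z (tag v) (tagged v))).

Definition xn i (b : nat) : Rd d :=
  if insub b is Some b' then xvar (mkV i b') else 0.

Lemma xn_xvar (v : V) : xn (tag v) (tagged v) = xvar v.
Proof. by rewrite /xn valK; case: v. Qed.

Lemma evn_xn (S : comNzRingType) (z : 'I_N.+1 -> nat -> S) i b :
  (b < d i)%N -> evn z (xn i b) = z i b.
Proof. by move=> bd; rewrite /xn insubT /evn ev_xvar. Qed.

Lemma eq_evn (S : comNzRingType) (z z' : 'I_N.+1 -> nat -> S) q :
  (forall i b, (b < d i)%N -> z i b = z' i b) -> evn z q = evn z' q.
Proof. by move=> zz'; apply: ev_eq => v; exact: zz'. Qed.

Lemma evn_id q : evn xn q = q.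
Proof. by rewrite -[RHS]ev_id; apply: ev_eq => v; exact: xn_xvar. Qed.

Lemma rmorph_evn (S S' : comNzRingType) (g : {rmorphism S -> S'})
    (z : 'I_N.+1 -> nat -> S) q : g (evn z q) = evn (fun i b => g (z i b)) q.
Proof. exact: rmorph_ev. Qed.

Lemma evn_evn (S : comNzRingType) (z : 'I_N.+1 -> nat -> S) y q :
  evn z (evn y q) = evn (fun i b => evn z (y i b)) q.
Proof. exact: (rmorph_evn (evn z)). Qed.

Lemma Sd_act_ev s q : Sd_act s q =
  ev (fun v => xvar (mkV (tag v) (s (tag v) (tagged v)))) q.
Proof. exact: comp_mpoly_ev. Qed.

Lemma evn_sym (S : comNzRingType) (z : 'I_N.+1 -> nat -> S) q tau : inH q ->
  (forall i b, (b < d i)%N -> (tau i b < d i)%N) ->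
  (forall i, {in gtn (d i) &, injective (tau i)}) ->
  evn (fun i b => z i (tau i b)) q = evn z q.
Proof.
move=> Hq td tinj.
have inj i : injective (fun b : 'I_(d i) => Ordinal (td i b (ltn_ord b))).
  by move=> b c /(congr1 val) /= /tinj; rewrite !inE => bc; apply/val_inj/bc.
rewrite -{2}(Hq (fun i => perm (inj i))) Sd_act_ev /evn.
rewrite (rmorph_ev (ev (fun v => z (tag v) (tagged v)))).
by apply: ev_eq => v; rewrite /= ev_xvar /= permE.
Qed.

Lemma psi_ev r q : psi r q = ev (psi_img r) q :> Td d r.
Proof. exact: comp_mpoly_ev. Qed.

(** Such a point factors through [psi]: send the y's to the entries of group [p] and the remaining
    variables to their own values. *)
Lemma evn_psi (S : comNzRingType) (z : 'I_N.+1 -> nat -> S) r q p : psi r q = 0 ->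
  (forall i b, (b <= r)%N -> (b < d i)%N -> z i b = z p b) -> evn z q = 0.
Proof.
move=> psiq zp; pose y (t : TVar d r) :=
  match t with inl b => z p b | inr w => z (tag (val w)) (tagged (val w)) end.
have := congr1 (mmap (intmul 1 : int -> S) (fun k => y (enum_val k))) psiq.
rewrite psi_ev (rmorph_ev (mmap _ _)) raddf0 => q0; rewrite -[RHS]q0.
apply: ev_eq => v; rewrite /psi_img; case: insubP => [w _ wv|].
  by rewrite /= mmapX mmap1U enum_rankK /= wv.
rewrite -ltnNge ltnS => vr; rewrite /= mmapX mmap1U enum_rankK /= inordK //.
exact: zp.
Qed.

End Evaluation.

(** Taking for [D] a difference of two variables, substituting one for the other does not change a
    polynomial modulo [D]. *)
Lemma ev_cong N (d : 'I_N.+1 -> nat) (S : comNzRingType) (D : S) (x y : Var d -> S) q :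
  (forall v, exists c, x v - y v = D * c) -> exists c, ev x q - ev y q = D * c.
Proof.
move=> xy; pose cong u w := exists c, u - w = D * c.
have cong_refl u : cong u u by exists 0; rewrite subrr mulr0.
have congM u u' w w' : cong u u' -> cong w w' -> cong (u * w) (u' * w').
  move=> [c uc] [e we]; exists (c * w + u' * e); rewrite mulrDr mulrA -uc mulrCA -we.
  by rewrite !mulrBl !mulrBr; ring.
rewrite -/(cong _ _) /ev /mmap; apply: (big_ind2 cong) => [|u u' w w' [c uc] [e we]|m _]; first exact: cong_refl.
  by exists (c + e); rewrite mulrDr -uc -we; ring.
apply: (congM _ _ _ _) => //; rewrite /mmap1; apply: (big_ind2 cong) => [||i _]; [exact: cong_refl | exact: congM |].
by elim: (m i) => // k IH; rewrite !exprS; apply: (congM _ _ _ _).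
Qed.

(** * Divisibility by differences of variables *)

Section Divisibility.
Variables (N : nat) (d : 'I_N.+1 -> nat).
Local Notation V := (Var d).

Lemma xvar_inj : injective (@xvar N d).
Proof.
move=> v w vw; have := ev_xvar (fun u => (u == v)%:R : int) w.
by rewrite -vw ev_xvar eqxx; case: eqP => [->|].
Qed.

Definition subst (a b v : V) : Rd d := if v == a then xvar b else xvar v.

(** After dividing by one difference, the quotient is still killed by the other substitutions: these
    do not annihilate the difference removed, because no pair is repeated or reversed. *)
Lemma dvd_prod_sub (E : seq (V * V)) q : uniq E ->
  (forall a b, (a, b) \in E -> a <> b /\ (b, a) \notin E) ->
  (forall a b, (a, b) \in E -> ev (subst a b) q = 0) ->
  exists q', q = q' * \prod_(e <- E) (xvar e.1 - xvar e.2).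
Proof.
elim: E q => [|[a b] E IH] q /=; first by exists q; rewrite big_nil mulr1.
move=> /andP[abE uE] rE q0; have [nab _] := rE a b (mem_head _ _).
have [q' qq'] : exists q', q = (xvar a - xvar b) * q'.
  have [|c] := @ev_cong N d _ (xvar a - xvar b) (@xvar N d) (subst a b) q.
    move=> v; rewrite /subst; case: eqP => [->|_]; first by exists 1; rewrite mulr1.
    by exists 0; rewrite subrr mulr0.
  by rewrite ev_id q0 ?mem_head // subr0; exists c.
have [//|c e ceE|c e ceE|q'' qE] := IH q'.
- have [nce ecE] := rE c e (mem_behead (s := (a, b) :: E) ceE).
  by split=> //; apply: contra ecE => ecE; rewrite inE ecE orbT.
- have := q0 c e (mem_behead (s := (a, b) :: E) ceE).
  rewrite qq' rmorphM rmorphB /= !ev_xvar => /eqP.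
  rewrite mulf_eq0 subr_eq0 => /orP[/eqP|/eqP //].
  have [_ ecE] := rE c e (mem_behead (s := (a, b) :: E) ceE).
  rewrite /subst; case: eqP => [ac|nac]; case: eqP => [bc|nbc] /xvar_inj //.
  + by rewrite ac bc in nab.
  + by move=> eb; rewrite ac -eb ceE in abE.
  + by move=> ae; rewrite inE ae bc eqxx in ecE.
by exists q''; rewrite qq' qE big_cons /=; ring.
Qed.

Lemma msize_prod_sub (E : seq (V * V)) : (forall e, e \in E -> e.1 <> e.2) ->
  msize (\prod_(e <- E) (xvar e.1 - xvar e.2) : Rd d) = (size E).+1.
Proof.
have sub_neq0 (a b : V) : a <> b -> xvar a - xvar b != 0.
  by move=> ab; rewrite subr_eq0; apply/eqP => /xvar_inj.
elim: E => [|[a b] E IH] nE; first by rewrite big_nil msize1.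
have nab := nE _ (mem_head _ _); have {}IH := IH (fun e eE => nE e (mem_behead (s := (a, b) :: E) eE)).
rewrite big_cons msizeM ?sub_neq0 //; last by rewrite -msize_poly_eq0 IH.
rewrite IH addnS /=; suff -> : msize (xvar a - xvar b) = 2%N by [].
apply/eqP; rewrite eqn_leq; apply/andP; split.
  apply: leq_trans (mmeasureD_le _ _ _) _.
  by rewrite mmeasureN /xvar !mmeasureX /= !mdeg1.
rewrite ltnNge; apply/negP => /msize1_polyC; move: (_@_0%MM) => k abC.
have kE (x : V -> int) : x a - x b = k.
  by have := congr1 (ev x) abC; rewrite rmorphB /= !ev_xvar /ev mmapC => ->; exact: intz.
have := kE (fun v => (v == a)%:R); rewrite -(kE (fun=> 0)) subr0 eqxx.
by case: eqP => // ba; case: nab.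
Qed.

Lemma msize_ev_homog c (x : V -> Rd d) q : (forall v, (msize (x v) <= 2)%N) ->
  q \is c.-homog -> (msize (ev x q) <= c.+1)%N.
Proof.
move=> x2 /dhomogP hq; rewrite /ev /mmap big_seq.
elim/big_ind: _ => [|u w uc wc|m mq]; first by rewrite msize0.
  by apply: leq_trans (mmeasureD_le _ _ _) _; rewrite geq_max uc.
rewrite -[c]add0n; apply: msizeM_leS.
  have -> : 1 *~ q@_m = (q@_m)%:MP :> Rd d by rewrite -{2}[q@_m]intz rmorph_int.
  by rewrite mmeasureC; case: eqP.
have := hq m mq; rewrite /= mdegE => <-; rewrite /mmap1.
elim/big_ind2: _ => [|u a w b|i _]; first by rewrite msize1.
  exact: msizeM_leS.
elim: (m i) => [|k IH]; first by rewrite expr0 msize1.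
by rewrite exprS; apply: (@msizeM_leS _ _ _ _ 1 k).
Qed.

End Divisibility.

(** * Vanishing along patterns *)

Section Patterns.
Variables (N : nat) (d : 'I_N.+1 -> nat) (r : nat) (p : 'I_N.+1).
Local Notation V := (Var d).
Local Notation n := (d p).
Hypothesis rn : (r < n)%N.
Hypothesis dmin : forall i, (n <= d i)%N.
Implicit Types (M : nat -> {set 'I_N.+1}) (q : Rd d).

(* The pattern [M] identifies, for each [b < n], the variable [x_(i,b)] with
   [x_(p,b)] for all the groups [i] outside [M b]. *)
Definition compat (S : Type) M (z : 'I_N.+1 -> nat -> S) :=
  forall i b, (b < n)%N -> i \notin M b -> z i b = z p b.

Definition vanish M q :=
  forall z : 'I_N.+1 -> nat -> Rd d, compat M z -> evn z q = 0.

(** Copying the entries of group [p] imposes the matchings of [M]. Applied to the variables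
    themselves, this gives the generic point of the pattern. *)
Definition zgen (S : Type) M (c : 'I_N.+1 -> nat -> S) i b :=
  if (b < n)%N && (i \notin M b) then c p b else c i b.

Lemma evn_zgen (S : comNzRingType) (z : 'I_N.+1 -> nat -> S) M q :
  evn z (evn (zgen M (@xn N d)) q) = evn (zgen M z) q.
Proof.
rewrite evn_evn; apply: eq_evn => i b bd; rewrite /zgen.
by case: ifP => [/andP[bn _]|_]; rewrite evn_xn.
Qed.

Lemma vanish_zgen M q : evn (zgen M (@xn N d)) q = 0 -> vanish M q.
Proof.
move=> q0 z cz; have := congr1 (evn z) q0; rewrite evn_zgen raddf0 => E.
rewrite -[RHS]E; apply: eq_evn => i b _; rewrite /zgen.
by case: ifP => // /andP[bn iM]; rewrite cz.
Qed.

Lemma compat_zgen (S : Type) M (c : 'I_N.+1 -> nat -> S) :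
  (forall b, p \notin M b) -> compat M (zgen M c).
Proof. by move=> pM i b bn iM; rewrite /zgen bn iM pM. Qed.

Lemma evn_perm (S : comNzRingType) (z : 'I_N.+1 -> nat -> S) q (tau : nat -> nat) :
  inH q -> (forall b, (b < n)%N -> (tau b < n)%N) -> {in gtn n &, injective tau} ->
  (forall b, (n <= b)%N -> tau b = b) -> evn (fun i b => z i (tau b)) q = evn z q.
Proof.
move=> Hq tn tinj tid; apply: (@evn_sym _ _ _ z q (fun _ => tau) Hq) => i b.
  by case: (ltnP b n) => [/tn/leq_trans-> //|/tid->].
move=> c _ _; case: (ltnP b n) => bn; case: (ltnP c n) => cn.
- by apply: tinj; rewrite inE.
- by rewrite (tid c) // => E; have := tn b bn; rewrite E ltnNge cn.
- by rewrite (tid b) // => E; have := tn c cn; rewrite -E ltnNge bn.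
- by rewrite !tid.
Qed.

(** By symmetry the positions of [J] can be moved to the front in all groups at once, where they
    cover the [r + 1] positions identified by [psi]. *)
Lemma vanish_full M q (J : {set 'I_n}) : inA r q -> (r < #|J|)%N ->
  (forall j, j \in J -> M j = set0) -> vanish M q.
Proof.
move=> [Hq psiq] rJ MJ z cz; pose s := enum J ++ enum (~: J).
have sn : size s = n by rewrite size_cat -!cardE cardsC card_ord.
have us : uniq s.
  rewrite cat_uniq !enum_uniq andbT /=; apply/hasPn => j.
  by rewrite !mem_enum inE.
pose tau b := if (b < n)%N then nth 0%N (map val s) b else b.
have tauE (b : nat) (bn : (b < n)%N) : tau b = nth (Ordinal bn) s b.
  by rewrite /tau bn (nth_map (Ordinal bn)) ?sn.
rewrite -(@evn_perm _ z q tau) //; first last.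
- by move=> b; rewrite leqNgt /tau => /negbTE->.
- move=> b c; rewrite !inE /tau => bn cn; rewrite bn cn => /eqP.
  by rewrite nth_uniq ?size_map ?sn ?(map_inj_uniq val_inj) // => /eqP.
- by move=> b bn; rewrite tauE ltn_ord.
apply: (evn_psi psiq (p := p)) => i b br _; have bn : (b < n)%N := leq_ltn_trans br rn.
rewrite tauE; apply: cz; rewrite ?ltn_ord // MJ ?inE //.
rewrite nth_cat -cardE (leq_ltn_trans br rJ) -mem_enum mem_nth //.
by rewrite -cardE (leq_ltn_trans br rJ).
Qed.

Definition swapn (j c b : nat) := if b == j then c else if b == c then j else b.

Lemma swapn_lt j c b m : (j < m)%N -> (c < m)%N -> (b < m)%N -> (swapn j c b < m)%N.
Proof. by rewrite /swapn => *; do 2 case: eqP => // _. Qed.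

Lemma swapn_inj j c : injective (swapn j c).
Proof.
move=> a b; rewrite /swapn.
by case: (a =P j) => ?; case: (b =P j) => ?; case: (a =P c) => ?; case: (b =P c) => ?;
  congruence.
Qed.

(** Exchanging the variables [j] and [c] inside group [i] turns the equality into a matching at [j];
    as [c] is free for [i], no earlier matching is lost. *)
Lemma vanish_single M q i (j c : nat) (z : 'I_N.+1 -> nat -> Rd d) :
  inH q -> i != p -> (j < n)%N -> (c < d i)%N -> i \in M j ->
  (n <= c)%N || (i \in M c) ->
  vanish (fun b => if b == j then M j :\ i else M b) q ->
  compat M z -> z p j = z i c -> evn z q = 0.
Proof.
move=> Hq ip jn cd iMj icM van cz zjc.
rewrite -(@evn_sym _ _ _ z q (fun k => if k == i then swapn j c else id)) //; first last.
- by move=> k b e; case: eqP => _ // _ _; apply: swapn_inj.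
- move=> k b; case: eqP => [->|] // bd; apply: swapn_lt => //.
  exact: leq_trans jn (dmin i).
apply: van => k b bn /=; rewrite [p == i]eq_sym (negbTE ip) /=.
case: eqP => [->|bj].
  rewrite !inE; case: (k =P i) => [->|_] /=; last exact: cz.
  by rewrite /swapn eqxx.
case: (k =P i) => [->|_] iMb; last exact: cz.
rewrite /swapn; case: eqP => // _; case: eqP => [bc|_]; last exact: cz.
by move: icM; rewrite -bc leqNgt bn (negbTE iMb).
Qed.

(** Exchange [j] and [k] in the groups of [M j]. These are matched at [k], so after the exchange [j]
    is matched in every group, at the price of freeing them at [k]. *)
Lemma vanish_pair M q (j k : nat) (z : 'I_N.+1 -> nat -> Rd d) :
  (forall b, p \notin M b) -> inH q -> (j < n)%N -> (k < n)%N -> j != k ->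
  M j :&: M k = set0 ->
  vanish (fun b => if b == j then set0 else if b == k then M j :|: M k else M b) q ->
  compat M z -> z p j = z p k -> evn z q = 0.
Proof.
move=> pM Hq jn kn jk MM van cz zjk.
have nMk i : i \in M j -> i \notin M k.
  by move=> ij; apply/negP => ik; have := in_set0 i; rewrite -MM inE ij ik.
rewrite -(@evn_sym _ _ _ z q (fun i => if i \in M j then swapn j k else id)) //; first last.
- by move=> i b e; case: ifP => _ // _ _; apply: swapn_inj.
- move=> i b; case: ifP => // _ bd; apply: swapn_lt => //.
    exact: leq_trans jn (dmin i).
  exact: leq_trans kn (dmin i).
apply: van => i b bn /=; rewrite (negbTE (pM j)).
case: (b =P j) => [->|bj] iM'.
  case: ifP => ij; last by apply: cz; rewrite ?ij.
  by rewrite /swapn eqxx zjk; apply: cz; rewrite ?nMk.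
move: iM'; case: (b =P k) => [->|bk]; first by rewrite !inE negb_or => /andP[/negbTE-> ik]; apply: cz.
by move=> ib; case: ifP => ij; rewrite /swapn; do ?case: eqP => // _; apply: cz.
Qed.

Definition vpos (v : V) : nat := tagged v.

(* Pairs of variables whose identification turns the pattern [M] into a pattern
   with more coincidences. *)
Definition spairs M : seq (V * V) := [seq e <- enum {: V * V} |
  [&& tag e.1 == p, tag e.2 != p, tag e.2 \in M (vpos e.1) &
      (n <= vpos e.2)%N || (tag e.2 \in M (vpos e.2))]].

Definition dpairs M : seq (V * V) := [seq e <- enum {: V * V} |
  [&& tag e.1 == p, tag e.2 == p, (vpos e.1 < vpos e.2)%N,
      M (vpos e.1) != set0, M (vpos e.2) != set0 &
      M (vpos e.1) :&: M (vpos e.2) == set0]].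

Definition pairs M := spairs M ++ dpairs M.

Lemma pairs_uniq M : uniq (pairs M).
Proof.
have u P : uniq [seq e <- enum {: V * V} | P e] by rewrite filter_uniq ?enum_uniq.
rewrite cat_uniq !u andbT; apply/hasPn => e.
by rewrite !mem_filter => /andP[/and3P[-> -> _] _].
Qed.

Lemma pairs_oriented M a b : (a, b) \in pairs M -> a <> b /\ (b, a) \notin pairs M.
Proof.
have mE (e : V * V) : e \in Finite.enum _ by rewrite -enumT mem_enum.
rewrite !mem_cat !mem_filter /= !mE !andbT.
case/orP => [/and3P[ap bp _]|/and3P[ap bp /andP[ab _]]].
  by split; [move=> E; rewrite -E ap in bp | rewrite (negbTE bp) ap].
split; first by move=> E; rewrite E ltnn in ab.
by rewrite bp ap /= ltnNge ltnW.
Qed.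

(** Digits [i] and [b] in base [N.+1]: an integral point with pairwise distinct coordinates. *)
Definition mcode (i : 'I_N.+1) (b : nat) : int := (i + b * N.+1)%:Z.

Lemma mcode_inj i b j c : mcode i b = mcode j c -> i = j /\ b = c.
Proof.
rewrite /mcode => -[E]; have [ilt jlt] := (ltn_ord i, ltn_ord j).
have bc : b = c.
  have := congr1 (fun k => k %/ N.+1)%N E.
  by rewrite !divnDr ?dvdn_mull // !mulnK // !divn_small // !add0n.
by split=> //; apply/val_inj; rewrite bc in E; exact: addIn E.
Qed.

(** The restriction of [q] to the generic point is divisible by the product of the differences,
    whose degree is at least [c]. If it is nonzero, then [c] is the number of pairs and the cofactor
    is a constant; that constant is detected at the test point, where no difference vanishes. *)
Lemma vanish_of_pairs M q c : (forall b, p \notin M b) -> q \is c.-homog ->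
  (forall a b, (a, b) \in pairs M -> ev (subst a b) (evn (zgen M (@xn N d)) q) = 0) ->
  (c <= size (pairs M))%N ->
  (c = size (pairs M) -> evn (zgen M mcode) q = 0) -> vanish M q.
Proof.
move=> pM qc van cE ev0; apply: vanish_zgen.
set Q := evn _ q in van *; apply/eqP; apply: contraT => Q0.
have [Q' QE] := dvd_prod_sub (pairs_uniq M) (@pairs_oriented M) van.
have Q'0 : Q' != 0 by apply: contraNneq Q0 => Q'0; rewrite QE Q'0 mul0r.
have sE : msize (\prod_(e <- pairs M) (xvar e.1 - xvar e.2) : Rd d) = (size (pairs M)).+1.
  by apply: msize_prod_sub => -[a b] /pairs_oriented[].
have sx i b : (msize (xn d i b) <= 2)%N.
  by rewrite /xn; case: insubP => [u _ _|_]; rewrite ?msize0 // /xvar msizeX mdeg1.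
have sQ : (msize Q <= c.+1)%N.
  apply: msize_ev_homog qc => v; rewrite /zgen; by case: ifP.
have s0 : (0 < msize Q')%N by rewrite lt0n msize_poly_eq0.
move: sQ; rewrite QE msizeM // ?sE; last by rewrite -msize_poly_eq0 sE.
rewrite addnS /= => sQ; have {}cE : c = size (pairs M).
  by apply/eqP; rewrite eqn_leq cE -ltnS (leq_trans _ sQ) // -(add1n (size _)) leq_add2r.
have /msize1_polyC : (msize Q' <= 1)%N by move: sQ; rewrite cE -(add1n (size _)) leq_add2r.
move: (_@_0%MM) => k Q'k; have := congr1 (evn mcode) QE.
rewrite /Q evn_zgen ev0 // rmorphM rmorph_prod /= Q'k {1}/evn {1}/ev mmapC => /esym/eqP.
rewrite mulf_eq0 => /orP[|].
  move=> /eqP k0; have {}k0 : k = 0 by rewrite -[LHS]intz; exact: k0.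
  by move: Q'0; rewrite Q'k k0 mpolyC0 eqxx.
rewrite prodf_seq_eq0 => /hasP[[a b] abE /=].
rewrite rmorphB /= /evn !ev_xvar subr_eq0 => /eqP/mcode_inj[E1 E2].
have [nab _] := pairs_oriented abE; case: nab.
move: a b E1 E2 {abE} => [i a] [j b] /= ij; rewrite -ij in b *.
by move=> ab; congr Tagged; apply/val_inj.
Qed.

End Patterns.

(** Turns binomial identities into polynomial ones, suitable for [lia] and [nia]. *)
Lemma double_bin2 m : ('C(m, 2).*2 + m = m * m)%N.
Proof. by elim: m => // m; rewrite binS bin1; lia. Qed.

Lemma card_increasing_pairs n (A : pred 'I_n) :
  (\sum_(j < n) \sum_(k < n) [&& j < k, A j & A k] = 'C(\sum_(j < n) A j, 2))%N.
Proof.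
set P := (LHS); set m := (\sum_(j < n) A j)%N; apply/double_inj/(@addIn m).
have mE : m = (\sum_(j < n) \sum_(k < n) ((j == k) && A j))%N.
  apply: eq_bigr => j _; rewrite (bigD1 j) //= eqxx big1 ?addn0 // => k.
  by rewrite eq_sym => /negbTE->.
transitivity (\sum_(j < n) \sum_(k < n)
    ([&& j < k, A j & A k] + [&& k < j, A k & A j] + ((j == k) && A j)))%N.
  rewrite mE -addnn; under [RHS]eq_bigr do rewrite !big_split /=.
  by rewrite !big_split /=; congr (_ + _ + _)%N; rewrite /P exchange_big.
rewrite double_bin2 /m big_distrlr /=; apply: eq_bigr => j _; apply: eq_bigr => k _.
case: (ltngtP j k) => [jk|kj|/val_inj <-]; rewrite ?eqxx; last by case: (A j).
  by rewrite (_ : (j == k) = false); [case: (A j); case: (A k) | apply/negP => /eqP E; rewrite E ltnn in jk].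
by rewrite (_ : (j == k) = false); [case: (A j); case: (A k) | apply/negP => /eqP E; rewrite E ltnn in kj].
Qed.

(** * Counting the differences of a pattern *)

Section Weights.
Variables (N : nat) (d : 'I_N.+1 -> nat) (r : nat) (p : 'I_N.+1).
Local Notation V := (Var d).
Local Notation n := (d p).
Hypothesis rn : (r < n)%N.
Hypothesis dmin : forall i, (n <= d i)%N.
Implicit Types (M : nat -> {set 'I_N.+1}) (q : Rd d).

Definition wcost (w : 'I_N.+1 -> nat) : nat :=
  ('C(n - r, 2) + \sum_(i | i != p) (w i * (d i - n) + 'C((w i).+1, 2)))%N.

Definition pweight M i : nat := (\sum_(b < n) (i \in M b))%N.

Lemma big_Var (F : V -> nat) :
  (\sum_v F v = \sum_i \sum_(b < d i) F (Tagged (fun i => 'I_(d i)) b))%N.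
Proof. by rewrite sig_big_dep /=; apply: eq_bigr => -[]. Qed.

Lemma size_enum_pairs (P : V -> V -> bool) :
  size [seq e <- enum {: V * V} | P e.1 e.2] = (\sum_a \sum_b P a b)%N.
Proof.
rewrite pair_bigA -sum1_size big_filter big_enum_cond /= big_mkcond.
by apply: eq_bigr => e _; case: (P _ _).
Qed.

(** For each [i], there are [pweight M i] choices of the variable in group [p]; in group [i] the
    free positions below [n] and all those from [n] on are available. *)
Lemma size_spairs M : size (spairs d p M) =
  (\sum_(i | i != p) pweight M i * (pweight M i + (d i - n)))%N.
Proof.
rewrite (size_enum_pairs (fun a b => [&& tag a == p, tag b != p, tag b \in M (vpos a) &
  (n <= vpos b)%N || (tag b \in M (vpos b))])) big_Var (bigD1 p) //= [X in (_ + X)%N]big1 ?addn0; last first.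
  by move=> i /negbTE ip; apply: big1 => b _; apply: big1 => v _; rewrite /= ip.
rewrite (eq_bigr (fun a : 'I_n => \sum_(i | i != p) (i \in M a) *
    (\sum_(b < d i) ((n <= b) || (i \in M b))))%N) => [|a _].
  rewrite exchange_big; apply: eq_bigr => i ip /=.
  rewrite -big_distrl /= -/(pweight M i); congr (_ * _)%N.
  rewrite -(big_mkord xpredT (fun b => (n <= b)%N || (i \in M b) : nat)).
  rewrite (@big_cat_nat _ _ _ n) //= [X in (X + _)%N]big_mkord; congr (_ + _)%N.
    by apply: eq_bigr => b _; rewrite leqNgt ltn_ord.
  rewrite big_nat_cond (eq_bigr (fun _ => 1%N)) => [|b /andP[/andP[-> _] _]] //.
  by rewrite -big_nat_cond sum_nat_const_nat muln1.
rewrite big_Var eqxx /= [RHS]big_mkcond; apply: eq_bigr => i _.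
have [->|ip] /= := eqVneq i p; first by apply: big1.
rewrite big_distrr; apply: eq_bigr => b _ /=.
by rewrite /vpos /=; case: (_ \in _); rewrite ?mul1n ?mul0n.
Qed.

Lemma size_dpairs M : size (dpairs d p M) =
  (\sum_(a < n) \sum_(b < n) [&& a < b, M a != set0, M b != set0 & M a :&: M b == set0])%N.
Proof.
rewrite (size_enum_pairs (fun a b => [&& tag a == p, tag b == p, (vpos a < vpos b)%N,
  M (vpos a) != set0, M (vpos b) != set0 & M (vpos a) :&: M (vpos b) == set0]))
  big_Var (bigD1 p) //= [X in (_ + X)%N]big1 ?addn0; last first.
  by move=> i /negbTE ip; apply: big1 => b _; apply: big1 => v _; rewrite /= ip.
apply: eq_bigr => a _; rewrite big_Var (bigD1 p) //= [X in (_ + X)%N]big1 ?addn0; last first.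
  by move=> i /negbTE ip; apply: big1 => b _; rewrite /= ip andbF.
by apply: eq_bigr => b _; rewrite /= eqxx.
Qed.

(** Write w (w + m) = w m + binom(w+1,2) + binom(w,2). The surplus binom(w_i,2) counts the pairs of
    positions both free for [i], so every pair of nonempty positions is counted: in [dpairs] if
    disjoint, in a surplus if they share a group. *)
Lemma size_pairs_ge M : (forall b, p \notin M b) ->
  ('C(\sum_(a < n) (M a != set0), 2) +
   \sum_(i | i != p) (pweight M i * (d i - n) + 'C((pweight M i).+1, 2))
   <= size (pairs d p M))%N.
Proof.
move=> pM; rewrite size_cat size_spairs size_dpairs.
have -> : (\sum_(i | i != p) pweight M i * (pweight M i + (d i - n)) =
   \sum_(i | i != p) (pweight M i * (d i - n) + 'C((pweight M i).+1, 2)) +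
   \sum_(i | i != p) 'C(pweight M i, 2))%N.
  rewrite -big_split /=; apply: eq_bigr => i _; rewrite binS bin1.
  by have := double_bin2 (pweight M i); move: (pweight M i) => w; rewrite mulnDr; lia.
rewrite addnC -addnA leq_add2l -card_increasing_pairs.
under [X in (_ <= X + _)%N]eq_bigr do rewrite /pweight -card_increasing_pairs.
rewrite [X in (_ <= X + _)%N]exchange_big /= -big_split leq_sum // => a _ /=.
rewrite [X in (_ <= X + _)%N]exchange_big /= -big_split leq_sum // => b _ /=.
case ab: (a < b)%N => //=; case Ma: (M a != set0) => //=; case Mb: (M b != set0) => //=.
have [//|/set0Pn [k]] := eqVneq (M a :&: M b) set0; first by rewrite addn1.
rewrite inE => /andP[ka kb]; rewrite addn0.
by rewrite (bigD1 k) /= ?ka ?kb //; apply: contraTneq ka => ->; apply: pM.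
Qed.

End Weights.

(** * Patterns freeing at most one group per position *)

Section Injectivity.
Variables (N : nat) (d : 'I_N.+1 -> nat) (r : nat) (p : 'I_N.+1).
Local Notation V := (Var d).
Local Notation n := (d p).
Hypothesis rn : (r < n)%N.
Hypothesis dmin : forall i, (n <= d i)%N.
Implicit Types (M : nat -> {set 'I_N.+1}) (q : Rd d) (beta : 'I_n -> 'I_N.+1).
Local Notation vanish := (@vanish N d p).

Definition prof beta i : nat := #|[set j | beta j == i]|.

(** Position [j] is free for the single group [beta j]; the value [p] encodes a fully matched
    position. *)
Definition Mb beta (b : nat) : {set 'I_N.+1} :=
  if insub b is Some j then [set i | (i == beta j) && (i != p)] else set0.

Lemma Mb_ord beta (j : 'I_n) : Mb beta j = [set i | (i == beta j) && (i != p)].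
Proof. by rewrite /Mb valK. Qed.

Lemma pNMb beta b : p \notin Mb beta b.
Proof. by rewrite /Mb; case: insub => [j|]; rewrite !inE // eqxx andbF. Qed.

Lemma Mb_eq0 beta (j : 'I_n) : (Mb beta j == set0) = (beta j == p).
Proof.
rewrite Mb_ord; apply/eqP/eqP => [E|->].
  by have := in_set0 (beta j); rewrite -E inE eqxx /= => /negbFE/eqP.
by apply/setP => i; rewrite !inE andbN.
Qed.

Lemma pweight_Mb beta i : i != p -> pweight d p (Mb beta) i = prof beta i.
Proof.
move=> ip; rewrite /pweight /prof -sum1_card [RHS]big_mkcond; apply: eq_bigr => j _.
by rewrite Mb_ord !inE ip andbT eq_sym; case: eqP.
Qed.

Lemma count_nonempty_Mb beta : prof beta p = r ->
  (\sum_(b < n) (Mb beta b != set0) = n - r)%N.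
Proof.
move=> <-; rewrite -[n in RHS]card_ord -(cardC [set j | beta j == p]) addKn -sum1_card.
by rewrite [RHS]big_mkcond; apply: eq_bigr => j _; rewrite !inE Mb_eq0; case: eqP.
Qed.

Lemma wcost_le_pairs beta : prof beta p = r ->
  (wcost d r p (prof beta) <= size (pairs d p (Mb beta)))%N.
Proof.
move=> pr; apply: leq_trans (size_pairs_ge rn dmin (@pNMb beta)).
rewrite count_nonempty_Mb // leq_add2l; apply: eq_leq.
by apply: eq_bigr => i ip; rewrite pweight_Mb.
Qed.

Lemma vanish_eq M M' q : (forall b, (b < n)%N -> M b = M' b) -> vanish M q -> vanish M' q.
Proof. by move=> E van z cz; apply: van => i b bn; rewrite E //; apply: cz. Qed.

(** Identifying a pair in the generic point gives a point of one of the two patterns of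
    [vanish_single] and [vanish_pair], so vanishing there is enough. *)
Lemma ev_pairs_eq0 M q : (forall b, p \notin M b) -> inH q ->
  (forall i (j : 'I_n), i \in M j -> i != p ->
     vanish (fun b => if b == j then M j :\ i else M b) q) ->
  (forall j k : 'I_n, j != k -> M j != set0 -> M k != set0 -> M j :&: M k = set0 ->
     vanish (fun b => if b == j then set0 else if b == k then M j :|: M k else M b) q) ->
  forall a b, (a, b) \in pairs d p M ->
    ev (subst a b) (evn (zgen d p M (@xn N d)) q) = 0.
Proof.
move=> pM Hq van1 van2 a b.
have mE (e : V * V) : e \in Finite.enum _ by rewrite -enumT mem_enum.
pose z i c := ev (subst a b) (zgen d p M (@xn N d) i c).
have cz : compat d p M z.
  by move=> i c cn iM; rewrite /z (compat_zgen (xn d) pM cn iM).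
have zE : ev (subst a b) (evn (zgen d p M (@xn N d)) q) = evn z q.
  exact: (rmorph_evn (ev (subst a b))).
have zp c : z p c = ev (subst a b) (xn d p c).
  rewrite /z.
  rewrite {1}/zgen.
  rewrite if_same.
  reflexivity.
have za : tag a = p -> z p (vpos a) = xvar b.
  by move=> ap; rewrite zp -{1}ap xn_xvar ev_xvar /subst eqxx.
have xnb : ev (subst a b) (xn d (tag b) (vpos b)) = xvar b.
  by rewrite xn_xvar ev_xvar /subst; case: eqP.
have zpb : tag b = p -> z p (vpos b) = xvar b.
  by move=> bp; rewrite zp -{1}bp.
have zb : (n <= vpos b)%N || (tag b \in M (vpos b)) -> z (tag b) (vpos b) = xvar b.
  move=> bb; rewrite -xnb /z; congr (ev _ _); rewrite /zgen.
  case: ifP => [/andP[bn bM]|_]; last reflexivity.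
  by exfalso; move: bb; rewrite leqNgt bn (negbTE bM).
rewrite zE; clearbody z; move: {zE xnb}z cz zp za zpb zb => z cz zp za zpb zb.
rewrite mem_cat !mem_filter /= !mE !andbT.
case/orP => [/and4P[/eqP ap bp bM bb]|/and5P[/eqP ap /eqP bp ab Ma /andP[Mb' /eqP Mab]]].
- have an : (vpos a < n)%N by rewrite -ap ltn_ord.
  apply: (vanish_single dmin Hq bp an (ltn_ord (tagged b)) bM bb _ cz).
    exact: (van1 _ (Ordinal an)).
  by rewrite (za ap) -(zb bb).
- have an : (vpos a < n)%N by rewrite -ap ltn_ord.
  have bn : (vpos b < n)%N by rewrite -bp ltn_ord.
  have nab : vpos a != vpos b by rewrite neq_ltn ab.
  apply: (vanish_pair dmin pM Hq an bn nab Mab _ cz).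
    exact: (van2 (Ordinal an) (Ordinal bn)).
  by rewrite (za ap) (zpb bp).
Qed.

(** Exactly [r] positions are fully matched, and either kind of identification completes one more,
    so [vanish_full] applies to all pairs. The value at one test point then decides. *)
Lemma vanish_Mb beta q c : inA r q -> q \is c.-homog -> prof beta p = r ->
  (c <= wcost d r p (prof beta))%N -> evn (zgen d p (Mb beta) (@mcode N)) q = 0 ->
  vanish (Mb beta) q.
Proof.
move=> Aq qc pr cw q0; have [Hq _] := Aq.
apply: (vanish_of_pairs (@pNMb beta) qc) => //; last exact: leq_trans (wcost_le_pairs pr).
have full (j : 'I_n) M : Mb beta j != set0 -> M j = set0 ->
    (forall b : 'I_n, Mb beta b = set0 -> M b = set0) -> vanish M q.
  rewrite Mb_eq0 => bj Mj MM.
  apply: (vanish_full rn dmin (J := j |: [set b | beta b == p]) Aq).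
    by rewrite cardsU1 inE bj -/(prof beta p) pr.
  move=> b; rewrite !inE => /predU1P[->//|/eqP bp].
  by apply: MM; apply/eqP; rewrite Mb_eq0 bp.
apply: ev_pairs_eq0 => // [|i j ij ip|j k jk Mj Mk Mjk]; first exact: pNMb.
- apply: (full j); first by apply/set0Pn; exists i.
    rewrite eqxx; apply/setP => k; rewrite !inE; apply/negP => /andP[ki].
    move: ij; rewrite Mb_ord !inE => /andP[/eqP iE _] /andP[/eqP kE _].
    by rewrite iE kE eqxx in ki.
  move=> b b0; case: eqP => [bj|_]; last exact: b0.
  by rewrite -bj b0 set0D.
- apply: (full j) => [||b b0]; rewrite ?eqxx //; case: eqP => [//|_].
  by case: eqP => [bk|_]; [rewrite -bk b0 eqxx in Mk | exact: b0].
Qed.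

Lemma count_prof beta i : count_mem i [seq beta j | j <- enum 'I_n] = prof beta i.
Proof.
rewrite count_map /prof cardE -size_filter; congr size; rewrite /enum_mem -filter_predI.
by apply: eq_in_filter => j _; rewrite /= !inE andbT.
Qed.

Lemma vanish_Mb_perm beta beta' q : inH q -> (forall i, prof beta i = prof beta' i) ->
  vanish (Mb beta) q -> vanish (Mb beta') q.
Proof.
move=> Hq E van z cz.
have [s sE] : exists s : 'S_n, forall j, beta j = beta' (s j).
  have : perm_eq [tuple beta j | j < n] [tuple beta' j | j < n].
    by apply/allP => i _ /=; rewrite !count_prof E.
  case/tuple_permP => s sE; exists s => j.
  have := congr1 (fun t : seq 'I_N.+1 => nth p t j) sE.
  by rewrite -!tnth_nth !tnth_mktuple.
pose tau (b : nat) : nat := if insub b is Some j then s j : nat else b.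
rewrite -(@evn_perm _ _ _ dmin _ z q tau Hq); first last.
- by move=> b nb; rewrite /tau insubF // ltnNge nb.
- move=> b c; rewrite !inE /tau => bn cn; rewrite !insubT /= => /val_inj/perm_inj.
  by move/(congr1 val).
- by move=> b bn; rewrite /tau insubT ltn_ord.
apply: van => i b bn iM; have -> : b = Ordinal bn by [].
rewrite /tau valK; apply: cz; rewrite ?ltn_ord // Mb_ord -sE.
by move: iM; rewrite -[b]/(val (Ordinal bn)) Mb_ord.
Qed.
End Injectivity.

(** * Descent over all patterns *)

Section VanishingDegree.
Variables (N : nat) (d : 'I_N.+1 -> nat) (r : nat) (p : 'I_N.+1).
Local Notation n := (d p).
Hypothesis rn : (r < n)%N.
Hypothesis dmin : forall i, (n <= d i)%N.
Implicit Types (M : nat -> {set 'I_N.+1}) (q : Rd d) (beta : 'I_n -> 'I_N.+1).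
Local Notation vanish := (@vanish N d p).
Local Notation Mb := (@Mb N d p).

(** Keep [n - r] nonempty positions, with one free group chosen at each, and declare the others
    matched. *)
Lemma select_pattern M : (forall b, p \notin M b) ->
  (n - r <= \sum_(b < n) (M b != set0))%N ->
  exists beta, (forall b, beta b != p -> beta b \in M b) /\ prof beta p = r.
Proof.
move=> pM; pose J := [set b : 'I_n | M b != set0].
have -> : (\sum_(b < n) (M b != set0) = #|J|)%N.
  rewrite -sum1_card [RHS]big_mkcond; apply: eq_bigr => b _.
  by rewrite inE; case: (_ != _).
rewrite cardE => nJ; pose s := take (n - r) (enum J).
have ss : size s = (n - r)%N by rewrite size_takel.
have us : uniq s by rewrite take_uniq ?enum_uniq.
have sM b : b \in s -> M b != set0 by move=> /mem_take; rewrite mem_enum inE.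
pose beta b := if b \in s then odflt p [pick i in M b] else p.
have bE b : b \in s -> beta b \in M b.
  move=> bs; rewrite /beta bs; case: pickP => //= M0.
  have /set0Pn [k kM] := sM b bs; have := M0 k; by rewrite kM.
have bp b : (beta b == p) = (b \notin s).
  have [bs|bs] := boolP (b \in s); last by rewrite /beta (negbTE bs) eqxx.
  by apply/negbTE; apply: contraTneq (bE b bs) => ->; apply: pM.
exists beta; split=> [b|]; first by rewrite bp negbK; apply: bE.
rewrite /prof (_ : [set j | _] = ~: [set b in s]); last first.
  by apply/setP => b; rewrite !inE bp.
rewrite cardsCs setCK card_ord cardsE (card_uniqP us) ss.
by rewrite subKn // ltnW.
Qed.

(** Decreases along both moves: [vanish_single] removes an element, and [vanish_pair] keeps the
    total cardinality but leaves one nonempty position fewer. *)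
Definition pmeasure M : nat := (\sum_(b < n) ((#|M b|).*2 + (M b != set0)))%N.

Lemma pmeasure_single M i (j : 'I_n) : i \in M j ->
  (pmeasure (fun b => if b == j then M j :\ i else M b) < pmeasure M)%N.
Proof.
move=> ij; rewrite /pmeasure [X in (X < _)%N](bigD1 j) // [X in (_ < X)%N](bigD1 j) //=.
rewrite eqxx -addSn leq_add //; last first.
  by apply: eq_leq; apply: eq_bigr => b /negbTE; rewrite -val_eqE /= => ->.
rewrite (cardsD1 i (M j)) ij (_ : M j != set0); last by apply/set0Pn; exists i.
by have := leq_b1 (M j :\ i != set0); move: #|_| (nat_of_bool _) => /=; lia.
Qed.

Lemma pmeasure_pair M (j k : 'I_n) : j != k -> M j != set0 -> M k != set0 ->
  M j :&: M k = set0 ->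
  (pmeasure (fun b => if b == j then set0 else if b == k then M j :|: M k else M b)
    < pmeasure M)%N.
Proof.
move=> jk Mj Mk Mjk; have kj : (k == j :> nat) = false.
  by apply/negbTE; rewrite val_eqE eq_sym.
rewrite /pmeasure [X in (X < _)%N](bigD1 j) // [X in (_ < X)%N](bigD1 j) //=.
have kj' : k != j by rewrite eq_sym.
rewrite (bigD1 k) // [X in (_ < _ + X)%N](bigD1 k) //=.
rewrite !eqxx kj cards0 Mj Mk !addnA -addSn leq_add //; last first.
  apply: eq_leq; apply: eq_bigr => b; rewrite -!val_eqE => /andP[/negbTE-> /negbTE->] //.
have := cardsUI (M j) (M k); rewrite Mjk cards0 addn0 => ->.
by have := leq_b1 (M j :|: M k != set0); move: (nat_of_bool _) => /=; lia.
Qed.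

(** Induction on patterns by [pmeasure]. With more than [r] full matches [vanish_full] applies;
    otherwise [M] contains some [Mb beta], and it has more than [c] pairs unless it equals [Mb beta]
    and [c] is the cost of its profile. *)
Lemma vanish_low_degree q c : inA r q -> q \is c.-homog ->
  (forall beta, prof beta p = r -> (c <= wcost d r p (prof beta))%N) ->
  (forall beta, prof beta p = r -> c = wcost d r p (prof beta) -> vanish (Mb beta) q) ->
  q = 0.
Proof.
move=> Aq qc cle ceq; have [Hq _] := Aq.
(* The pattern without matchings imposes no condition, so its case is [q = 0] itself. *)
suff van M : (forall b, p \notin M b) -> vanish M q.
  rewrite -[LHS]evn_id; apply: (van (fun _ => ~: [set p])) => [b|i b _].
    by rewrite !inE eqxx.
  by rewrite !inE negbK => /eqP->.
have [k] := ubnP (pmeasure M); elim: k M => // k IH M; rewrite ltnS => Mk pM.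
pose J := [set b : 'I_n | M b != set0].
have JE : (\sum_(b < n) (M b != set0) = #|J|)%N.
  rewrite -sum1_card [RHS]big_mkcond; apply: eq_bigr => b _.
  by rewrite inE; case: (_ != _).
case: (ltnP r #|~: J|) => [rJ|Jr].
  apply: (vanish_full rn dmin Aq rJ) => j.
  by rewrite !inE negbK => /eqP.
have nJ : (n - r <= #|J|)%N.
  have := cardsC J; rewrite card_ord leq_subLR; move: #|J| => a JJ.
  by move: Jr; move: #|~: J| JJ => b <-; rewrite addnC leq_add2r.
have [|beta [bM br]] := select_pattern pM; first by rewrite JE.
have wle i : i != p -> (prof beta i <= pweight d p M i)%N.
  move=> ip; rewrite /prof -sum1_card big_mkcond; apply: leq_sum => b _; rewrite inE.
  by case: eqP => // bi; have := bM b; rewrite bi ip => ->.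
pose g i w := (w * (d i - n) + 'C(w.+1, 2))%N.
have gle i w w' : (w <= w')%N -> (g i w <= g i w')%N.
  by move=> ww; rewrite leq_add ?leq_mul ?leq_bin2l.
have glt i w w' : (w < w')%N -> (g i w < g i w')%N.
  move=> ww; apply: leq_trans (gle i _ _ ww); rewrite /g -addnS leq_add ?leq_mul //.
  by rewrite [X in (_ < X)%N]binS bin1; lia.
have sz := size_pairs_ge rn dmin pM; rewrite JE in sz.
have CJ : ('C(n - r, 2) <= 'C(#|J|, 2))%N by rewrite leq_bin2l.
have pairsM a b : (a, b) \in pairs d p M ->
    ev (subst a b) (evn (zgen d p M (xn d)) q) = 0.
  apply: (ev_pairs_eq0 dmin pM Hq) => [i j ij ip|j k' jk Mj Mk' Mjk].
    apply: IH => [|b']; first exact: leq_trans (pmeasure_single ij) Mk.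
    by case: eqP => _; rewrite ?inE (negbTE (pM _)) ?andbF.
  apply: IH => [|b']; first exact: leq_trans (pmeasure_pair jk Mj Mk' Mjk) Mk.
  by case: eqP => _; [rewrite inE | case: eqP => _; rewrite ?inE ?(negbTE (pM _))].
have sum_le : (wcost d r p (prof beta) <= size (pairs d p M))%N.
  apply: leq_trans sz; rewrite leq_add // leq_sum // => i ip; exact: gle (wle i ip).
have of_lt : (c < size (pairs d p M))%N -> vanish M q.
  move=> cs; apply: (vanish_of_pairs pM qc pairsM (ltnW cs)) => E.
  by rewrite E ltnn in cs.
(* A group with more free positions in [M] than in [beta] makes the number of pairs exceed [c]. *)
have [/forallP weq|] :=
    boolP [forall i, (i != p) ==> (pweight d p M i == prof beta i)]; last first.
  rewrite negb_forall => /existsP [k']; rewrite negb_imply => /andP[kp kw]; apply: of_lt.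
  apply: leq_ltn_trans (cle _ br) _; apply: leq_trans sz.
  rewrite -addnS; apply: leq_add => //.
  rewrite (bigD1 k') //= [X in (_ < X)%N](bigD1 k') //= -addSn.
  apply: leq_add; first by apply: glt; rewrite ltn_neqAle wle // andbT eq_sym.
  by apply: leq_sum => i /andP[ip _]; exact: gle (wle i ip).
have [ceq'|cne] := eqVneq c (wcost d r p (prof beta)); last first.
  by apply: of_lt; apply: leq_trans sum_le; rewrite ltn_neqAle cne cle.
(* The pattern of [beta] is contained in [M] and has the same weights, so the two coincide. *)
apply: vanish_eq (ceq _ br ceq') => b bn.
rewrite -[b]/(val (Ordinal bn)); move: (Ordinal bn) => {bn}b.
apply/setP => i; rewrite Mb_ord inE.
have [->|ip] := eqVneq i p; first by rewrite andbF (negbTE (pM _)).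
have sub : [set b : 'I_n | beta b == i] \subset [set b : 'I_n | i \in M b].
  by apply/fintype.subsetP => c'; rewrite !inE => /eqP bi; have := bM c'; rewrite bi => ->.
have /eqP E : [set b : 'I_n | beta b == i] == [set b : 'I_n | i \in M b].
  rewrite eqEcard sub /=; have := weq i; rewrite ip /= /prof => /eqP <-.
  rewrite -sum1_card big_mkcond; apply: leq_sum => c' _.
  by rewrite inE; case: (_ \in _).
by have := congr1 (fun A : {set 'I_n} => b \in A) E; rewrite /= !inE andbT eq_sym.
Qed.

End VanishingDegree.

(** * Determinantal classes *)

(** By pigeonhole every permutation sends some row of [J] to a column outside [K]. *)
Lemma det_zero_block (S : comNzRingType) n (A : 'M[S]_n) (J K : {set 'I_n}) :
  (forall j k, j \in J -> k \notin K -> A j k = 0) -> (#|K| < #|J|)%N -> \det A = 0.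
Proof.
move=> A0 KJ; rewrite /determinant big1 // => s _.
have [j jJ sj] : exists2 j, j \in J & s j \notin K.
  apply/exists_inP; apply: contraLR KJ; rewrite negb_exists_in => /forall_inP sJ.
  rewrite -leqNgt -(card_imset J (@perm_inj _ s)); apply: subset_leq_card.
  by apply/fintype.subsetP => _ /imsetP [j jJ ->]; have := sJ j jJ; rewrite negbK.
by rewrite (bigD1 j) //= A0 // mul0r mulr0.
Qed.

Section DeterminantalClass.
Variables (N : nat) (d : 'I_N.+1 -> nat) (p : 'I_N.+1).
Local Notation V := (Var d).
Local Notation n := (d p).
Variable beta : 'I_n -> 'I_N.+1.

(** Columns sharing a value of [beta] receive the exponents 0, 1, 2 and so on in order. *)
Definition brank (k : 'I_n) : nat := #|[set k' : 'I_n | (k' < k)%N && (beta k' == beta k)]|.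

Lemma brank_lt k : (brank k < prof beta (beta k))%N.
Proof.
apply: proper_card; apply/properP; split.
  by apply/fintype.subsetP => k'; rewrite !inE => /andP[].
by exists k; rewrite !inE ?eqxx ?ltnn.
Qed.

Lemma brank_inj k k' : beta k = beta k' -> brank k = brank k' -> k = k'.
Proof.
wlog kk' : k k' / (k <= k')%N.
  move=> H b1 b2; case: (leqP k k') => [/H->//|/ltnW/H E]; exact/esym/E.
move=> bb; case: (ltngtP k k') kk' => // [kk' _|/val_inj-> //].
suff lt : (brank k < brank k')%N by move=> E; rewrite E ltnn in lt.
apply: proper_card; apply/properP; split.
  apply/fintype.subsetP => j; rewrite !inE -bb => /andP[jk ->].
  by rewrite (ltn_trans jk kk').
by exists k; rewrite !inE ?ltnn // kk' bb eqxx.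
Qed.

Section Ring.
Variable S : comNzRingType.
Implicit Type z : 'I_N.+1 -> nat -> S.

Definition xfac z i (t : S) : S := if i == p then 1 else \prod_(c < d i) (z i c - t).

Definition xmat z : 'M[S]_n :=
  \matrix_(j, k) (xfac z (beta k) (z p j) * z p j ^+ brank k).

Definition vmat z : 'M[S]_n := Vandermonde n (\row_j z p j).

Lemma xfac_eq0 z i (j : 'I_n) : (n <= d i)%N -> i != p -> z i j = z p j ->
  xfac z i (z p j) = 0.
Proof.
move=> ni ip zij; rewrite /xfac (negbTE ip).
by rewrite (bigD1 (widen_ord ni j)) //= zij subrr mul0r.
Qed.
End Ring.

Lemma evn_det_xmat (S : comNzRingType) (z : 'I_N.+1 -> nat -> S) :
  evn z (\det (xmat (xn d))) = \det (xmat z).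
Proof.
rewrite -det_map_mx; congr (\det _); apply/matrixP => j k; rewrite !mxE.
rewrite rmorphM rmorphXn /= evn_xn //; congr (_ * _); rewrite /xfac.
case: eqP => _; first by rewrite rmorph1.
by rewrite rmorph_prod; apply: eq_bigr => c _; rewrite rmorphB /= !evn_xn.
Qed.

Lemma evn_det_vmat (S : comNzRingType) (z : 'I_N.+1 -> nat -> S) :
  evn z (\det (vmat (xn d))) = \det (vmat z).
Proof.
rewrite -det_map_mx; congr (\det _); apply/matrixP => j k; rewrite !mxE.
by rewrite rmorphXn /= evn_xn.
Qed.

Lemma det_vmat_neq0 (S : idomainType) (z : 'I_N.+1 -> nat -> S) :
  (forall i j : 'I_n, z p i = z p j -> i = j) -> \det (vmat z) != 0.
Proof.
move=> zinj; rewrite det_Vandermonde; apply/prodf_neq0 => i _.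
apply/prodf_neq0 => j ij; rewrite !mxE subr_eq0; apply/eqP => /zinj E.
by rewrite E ltnn in ij.
Qed.

Lemma xn_inj i b j c : (b < d i)%N -> (c < d j)%N -> xn d i b = xn d j c -> i = j /\ b = c.
Proof.
by move=> bi cj /(congr1 (evn (@mcode N))); rewrite !evn_xn // => /mcode_inj.
Qed.

Lemma det_vmat_xn_neq0 : \det (vmat (xn d)) != 0.
Proof. by apply: det_vmat_neq0 => i j /xn_inj[] // _ /val_inj. Qed.

(** Identifying two variables of group [p] makes two rows of [xmat] equal, so each factor of the
    Vandermonde determinant divides. *)
Lemma dvd_det_vmat : exists q, \det (xmat (xn d)) = q * \det (vmat (xn d)).
Proof.
pose xp (j : 'I_n) : V := Tagged (fun i => 'I_(d i)) j.
have xpE j : xvar (xp j) = xn d p j by rewrite -xn_xvar.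
have xp_inj : injective xp.
  by move=> i j /(congr1 (@xvar _ _)); rewrite !xpE => /xn_inj[] // _ /val_inj.
pose E := [seq (xp j, xp i) | i : 'I_n <- enum 'I_n,
  j : 'I_n <- filter (fun j : 'I_n => (i < j)%N) (enum 'I_n)].
have [||a b|q qE] := @dvd_prod_sub _ _ E (\det (xmat (xn d))); last first.
- exists q; rewrite qE; congr (_ * _).
  rewrite big_allpairs_dep det_Vandermonde big_enum; apply: eq_bigr => i _ /=.
  by rewrite big_filter big_enum_cond; apply: eq_bigr => j _ /=; rewrite !mxE !xpE.
- case/allpairsPdep => i [j [_]]; rewrite mem_filter => /andP[ij _] [-> ->].
  pose z k c := ev (subst (xp j) (xp i)) (xn d k c).
  have -> : ev (subst (xp j) (xp i)) (\det (xmat (xn d))) = \det (xmat z).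
    transitivity (evn z (\det (xmat (xn d)))); last exact: evn_det_xmat.
    by rewrite /evn; apply: ev_eq => v; rewrite /z xn_xvar ev_xvar.
  apply: (@determinant_alternate _ _ _ i j); first by apply: contraTneq ij => ->; rewrite ltnn.
  move=> k; rewrite !mxE; suff -> : z p i = z p j by [].
  rewrite /z -!xpE !ev_xvar /subst eqxx.
  by case: eqP.
- move=> a b /allpairsPdep [i [j [_]]]; rewrite mem_filter => /andP[ij _] [-> ->].
  split; first by move/xp_inj => E'; rewrite E' ltnn in ij.
  apply/negP => /allpairsPdep[i' [j' [_]]]; rewrite mem_filter => /andP[ij' _].
  by move=> [/xp_inj ii' /xp_inj jj']; rewrite -ii' -jj' ltnNge ltnW in ij'.
- apply: allpairs_uniq_dep => [|i _|]; [exact: enum_uniq | exact/filter_uniq/enum_uniq |].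
  by move=> [i j] [i' j'] _ _ /= [/xp_inj-> /xp_inj->].
Qed.

End DeterminantalClass.

(** The functionals embed [M] in Z^t with elements on each axis, that is, as a lattice of full rank.
    The basis produced is of Hermite type, since the diagonal values need not be units. *)
Lemma free_Zmod_rank_triangular (V : lmodType int) (M : V -> Prop) t (c : 'I_t -> V -> int) :
  M 0 -> (forall a x y, M x -> M y -> M (a *: x + y)) ->
  (forall k a x y, c k (a *: x + y) = a * c k x + c k y) ->
  (forall x, M x -> (forall k, c k x = 0) -> x = 0) ->
  (forall k, exists x, [/\ M x, c k x != 0 & forall l, l != k -> c l x = 0]) ->
  free_Zmod_rank M t.
Proof.
move=> M0 MD cD cinj diag.
have c0 k : c k 0 = 0 by have := cD k (-1) 0 0; rewrite scaler0 addr0 mulN1r addNr.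
have cadd k x y : c k (x + y) = c k x + c k y by rewrite -{1}[x]scale1r cD mul1r.
have cscale k a x : c k (a *: x) = a * c k x by rewrite -[a *: x]addr0 cD c0 addr0.
have csum k (a : 'I_t -> int) (b : 'I_t -> V) :
    c k (\sum_j a j *: b j) = \sum_j a j * c k (b j).
  by elim/big_ind2: _ => [|x y x' y' <- <-|j _]; rewrite ?c0 ?cadd ?cscale.
pose low (k : 'I_t) x := M x /\ forall l : 'I_t, (l < k)%N -> c l x = 0.
(* Among the elements killed by the earlier functionals, one with the smallest nonzero absolute
   value of [c k] has a value dividing all the others. *)
have /choice [b bP] k : exists b, [/\ low k b, c k b != 0 &
    forall x, low k x -> exists m, c k x = m * c k b].
  have ex : exists s : nat, `[< exists x, [/\ low k x, c k x != 0 & `|c k x|%N = s] >].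
    have [x [Mx kx lx]] := diag k; exists `|c k x|%N; apply/asboolP; exists x; split=> //.
    by split=> // l lk; apply: lx; rewrite neq_ltn lk.
  case: (ex_minnP ex) => s /asboolP[b [[Mb lb] kb bs]] smin.
  exists b; split=> // x [Mx lx]; exists (c k x %/ c k b)%Z.
  rewrite [LHS](divz_eq _ (c k b)) -[RHS]addr0; congr (_ + _); apply/eqP.
  apply: contraT => rem0; pose y := - (c k x %/ c k b)%Z *: b + x.
  have ky : c k y = (c k x %% c k b)%Z by rewrite /y cD /modz; ring.
  have /smin : `[< exists y, [/\ low k y, c k y != 0 & `|c k y|%N = `|(c k x %% c k b)%Z|%N] >].
    apply/asboolP; exists y; split; rewrite ?ky //; split; first exact: MD.
    by move=> l lk; rewrite /y cD (lb l lk) (lx l lk) mulr0 addr0.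
  rewrite leqNgt -bs; case/negP.
  by have := ltz_mod (c k x) kb; have := modz_ge0 (c k x) kb; lia.
have cb0 (k l : 'I_t) : (l < k)%N -> c l (b k) = 0.
  by have [[_ lb] _ _] := bP k; exact: lb.
exists b; split=> [k|a ab k|x Mx]; first by have [[]] := bP k.
  have [m] := ubnP k; elim: m k => // m IH k; rewrite ltnS => km.
  have [_ kb _] := bP k; have := congr1 (c k) ab; rewrite csum c0 (bigD1 k) //= big1.
    by move/eqP; rewrite addr0 mulf_eq0 (negbTE kb) orbF => /eqP.
  move=> j jk; case: (ltngtP j k) => [jk'|kj|/val_inj E]; last by rewrite E eqxx in jk.
    by rewrite IH ?mul0r // (leq_trans jk' km).
  by rewrite cb0 ?mulr0.
have Msum (a : 'I_t -> int) : M (\sum_j a j *: b j).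
  elim/big_rec: _ => // j y _ My; apply: MD => //.
  by have [[]] := bP j.
(* Clear the functionals one at a time; subtracting a multiple of [b k] does not disturb the earlier
   ones. *)
have /(_ t (leqnn t)) [a aP] : forall k, (k <= t)%N -> exists a : 'I_t -> int,
    forall l : 'I_t, (l < k)%N -> c l (x - \sum_j a j *: b j) = 0.
  elim=> [|k IH] kt; first by exists (fun _ => 0).
  have [a al] := IH (ltnW kt); pose k' := Ordinal kt.
  have [_ _ /(_ (x - \sum_j a j *: b j))[|m mE]] := bP k'.
    by split=> //; rewrite addrC -scaleN1r; apply: MD.
  exists (fun j => a j + (j == k')%:R * m) => l.
  have -> : \sum_j (a j + (j == k')%:R * m) *: b j = \sum_j a j *: b j + m *: b k'.
    rewrite (eq_bigr (fun j => a j *: b j + ((j == k')%:R * m) *: b j)).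
      rewrite big_split /=; congr (_ + _); rewrite (bigD1 k') //= eqxx mul1r big1 ?addr0 //.
      by move=> j /negbTE->; rewrite mul0r scale0r.
    by move=> j _; rewrite scalerDl.
  rewrite opprD addrA -scaleNr cadd cscale ltnS leq_eqVlt => /predU1P[lk|lk].
    by have -> : l = k' by [apply/val_inj]; rewrite mE; ring.
  by rewrite al // cb0 // mulr0 addr0.
exists a; apply/eqP; rewrite -subr_eq0; apply/eqP/cinj => [|k]; last exact: aP.
by rewrite addrC -scaleN1r; apply: MD.
Qed.

Section HomogeneousDet.
Variables (R : comNzRingType) (m : nat).
Local Notation P := {mpoly R[m]}.

Lemma dhomog_bigprod (I : Type) (s : seq I) (Q : pred I) (F : I -> P) (e : I -> nat) :
  (forall i, Q i -> F i \is (e i).-homog) ->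
  \prod_(i <- s | Q i) F i \is (\sum_(i <- s | Q i) e i)%N.-homog.
Proof.
move=> hF; elim/big_rec2: _ => [|i e' y Qi hy]; first exact: dhomog1.
by apply: dhomogM => //; apply: hF.
Qed.

Lemma dhomog_det n (A : 'M[P]_n) (e : 'I_n -> nat) :
  (forall i j, A i j \is (e i).-homog) -> \det A \is (\sum_i e i)%N.-homog.
Proof.
move=> hA; apply: rpred_sum => s _; rewrite -signr_odd.
have hp : \prod_i A i (s i) \is (\sum_i e i)%N.-homog by apply: dhomog_bigprod.
by case: (odd _); rewrite ?expr0 ?expr1 ?mul1r ?mulN1r ?rpredN.
Qed.

(** Used to read the degree of a quotient from those of the dividend and of the divisor. *)
Lemma pihomogM a v (q Q : P) : Q \is v.-homog ->
  pihomog [measure of mdeg] (a + v) (q * Q) = pihomog [measure of mdeg] a q * Q.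
Proof.
move=> hQ; rewrite {1}[q]mpolyE mulr_suml raddf_sum /= pihomogE mulr_suml [RHS]big_mkcond.
apply: eq_bigr => k _; have h : (q@_k *: 'X_[k]) * Q \is (mdeg k + v).-homog.
  by apply: dhomogM => //; rewrite dhomogZ // dhomogX.
case: eqP => [<-|ka]; first exact: pihomog_dE.
by rewrite (pihomog_ne0 _ h) // eqn_add2r; apply/eqP.
Qed.
End HomogeneousDet.

Lemma det_row_perm (S : comNzRingType) n (s : 'S_n) (A : 'M[S]_n) :
  \det (row_perm s A) = (-1) ^+ s * \det A.
Proof. by rewrite row_permE det_mulmx det_perm. Qed.

Lemma det_col_perm (S : comNzRingType) n (s : 'S_n) (A : 'M[S]_n) :
  \det (col_perm s A) = (-1) ^+ s * \det A.
Proof. by rewrite col_permE det_mulmx det_perm odd_permV mulrC. Qed.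

Section ClassProperties.
Variables (N : nat) (d : 'I_N.+1 -> nat) (r : nat) (p : 'I_N.+1).
Local Notation V := (Var d).
Local Notation n := (d p).
Hypothesis rn : (r < n)%N.
Hypothesis dmin : forall i, (n <= d i)%N.
Variable beta : 'I_n -> 'I_N.+1.
Hypothesis beta_r : prof beta p = r.

Lemma class_eval (S : comNzRingType) (z : 'I_N.+1 -> nat -> S) q :
  \det (xmat beta (xn d)) = q * \det (vmat d p (xn d)) ->
  \det (xmat beta z) = evn z q * \det (vmat d p z).
Proof. by move=> qE; rewrite -evn_det_xmat qE rmorphM /= evn_det_vmat. Qed.

(** The factors [xfac] are symmetric in their group, and a permutation of group [p] multiplies both
    determinants by the same sign. *)
Lemma class_inH q : \det (xmat beta (xn d)) = q * \det (vmat d p (xn d)) -> inH q.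
Proof.
move=> qE s.
pose z i c : Rd d := if insub c is Some c' then
  xvar (Tagged (fun i => 'I_(d i)) (s i c')) else 0.
have zE i (c : 'I_(d i)) : z i c = xn d i (s i c).
  by rewrite /z valK -xn_xvar.
have -> : Sd_act s q = evn z q.
  by rewrite Sd_act_ev /evn; apply: ev_eq => v; rewrite zE -xn_xvar.
have facE i t : xfac d p z i t = xfac d p (xn d) i t.
  rewrite /xfac; case: eqP => // _; rewrite [RHS](reindex_inj (@perm_inj _ (s i))) /=.
  by apply: eq_bigr => c _; rewrite zE.
have := class_eval z qE.
have -> : xmat beta z = row_perm (s p) (xmat beta (xn d)).
  by apply/matrixP => j k; rewrite !mxE facE zE.
have -> : vmat d p z = col_perm (s p) (vmat d p (xn d)).
  by apply/matrixP => j k; rewrite !mxE zE.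
rewrite det_row_perm det_col_perm; move: qE (det_vmat_xn_neq0 d p) (evn z q).
move: (\det (vmat d p (xn d))) (\det (xmat beta (xn d))) => D X -> D0 Q.
have: (-1) ^+ s p != 0 :> Rd d by rewrite signr_eq0.
move: ((-1) ^+ s p : Rd d) => e e0 E; apply/esym/(mulfI e0)/(mulIf D0).
by rewrite -mulrA E; ring.
Qed.

Lemma card_prof i : #|[set k | beta k == i]| = prof beta i.
Proof. by []. Qed.

(** After [psi], the [r + 1] rows of identified variables are supported on the [r] columns with
    [beta k = p], while the Vandermonde determinant stays nonzero. *)
Lemma class_psi q : \det (xmat beta (xn d)) = q * \det (vmat d p (xn d)) -> psi r q = 0.
Proof.
move=> qE.
pose z (i : 'I_N.+1) (c : nat) : Td d r := if insub c is Some c' then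
  psi_img r (Tagged (fun i => 'I_(d i)) (c' : 'I_(d i))) else 0.
have zE i (c : 'I_(d i)) : z i c = psi_img r (Tagged (fun i => 'I_(d i)) c : V).
  by rewrite /z valK.
have -> : psi r q = evn z q.
  by rewrite psi_ev /evn; apply: ev_eq => v; rewrite zE; case: v.
have zr i (c : 'I_(d i)) : (c <= r)%N -> z i c = 'X_(enum_rank (inl (inord c) : TVar d r)).
  by move=> cr; rewrite zE /psi_img insubF //= ltnNge cr.
have zinj (i j : 'I_n) : z p i = z p j -> i = j.
  have XI (a b : TVar d r) : 'X_(enum_rank a) = 'X_(enum_rank b) :> Td d r -> a = b.
    move=> /(congr1 (mcoeff U_(enum_rank a))); rewrite !mcoeffXU eqxx.
    by case: eqP => // /enum_rank_inj->.
  rewrite !zE /psi_img; case: insubP => [v _ vE|]; case: insubP => [w _ wE|] //=.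
  - by move=> /XI [vw]; have := congr1 val vw; rewrite vE wE => /eqP; rewrite eq_Tagged => /eqP.
  - by move=> _ /XI.
  - by move=> _ /XI.
  rewrite -!ltnNge => jr ir /XI [/(congr1 val)]; rewrite /= !inordK //.
  exact: val_inj.
have := class_eval z qE.
rewrite (@det_zero_block _ _ _ [set j : 'I_n | (j <= r)%N] [set k | beta k == p]).
- by move/esym/eqP; rewrite mulf_eq0 (negbTE (det_vmat_neq0 zinj)) orbF => /eqP.
- move=> j k; rewrite !inE => jr bk; rewrite mxE (xfac_eq0 (dmin _)) ?mul0r //.
  by rewrite (zr _ (widen_ord (dmin (beta k)) j)) ?zr.
rewrite card_prof beta_r -sum1_card (eq_bigl (fun j : 'I_n => (j < r.+1)%N)) => [|j].
  by rewrite -(big_ord_widen n (fun=> 1%N) rn) sum1_card card_ord.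
by rewrite inE.
Qed.

Lemma sum_prof : (\sum_i prof beta i = n)%N.
Proof.
rewrite -[RHS]card_ord -sum1_card (partition_big beta xpredT) //=.
by apply: eq_bigr => i _; rewrite /prof -sum1_card; apply: eq_bigl => k; rewrite inE.
Qed.

Lemma sum_brank : (\sum_k brank beta k = \sum_i 'C(prof beta i, 2))%N.
Proof.
under [RHS]eq_bigr => i _.
  rewrite (_ : prof beta i = \sum_(j < n) (beta j == i))%N; last first.
    by rewrite /prof -sum1_card big_mkcond; apply: eq_bigr => j _; rewrite inE; case: eqP.
  rewrite -(card_increasing_pairs (fun j => beta j == i)) exchange_big; over.
rewrite exchange_big; apply: eq_bigr => k _ /=; rewrite /brank -sum1_card big_mkcond exchange_big.
apply: eq_bigr => j _ /=; rewrite inE (bigD1 (beta k)) //= eqxx andbT big1 ?addn0.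
  by case: (_ && _).
by move=> i /negbTE; rewrite eq_sym => ->; rewrite andbF andbF.
Qed.

(** The sum of the [j] is the degree of the Vandermonde determinant, and the right side that of
    [xmat], column by column. *)
Lemma wcost_degree : (wcost d r p (prof beta) + \sum_(j < n) j =
  \sum_k ((if beta k == p then 0 else d (beta k)) + brank beta k))%N.
Proof.
have -> : (\sum_(j < n) j = 'C(n, 2))%N by rewrite -bin2_sum big_mkord.
rewrite big_split /= sum_brank (partition_big beta xpredT) //=.
rewrite (eq_bigr (fun i => if i != p then (prof beta i * d i)%N else 0%N)); last first.
  move=> i _; case: eqP => [->|ip] /=; first by apply: big1 => k /eqP->; rewrite eqxx.
  rewrite /prof -sum_nat_const; apply: eq_big => k; first by rewrite inE.
  by move=> /eqP->; case: eqP.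
rewrite -big_mkcond /= [X in (_ = _ + X)%N](bigD1 p) //= beta_r /wcost.
have := sum_prof; rewrite (bigD1 p) //= beta_r; set s := (\sum_(i | _) _)%N => nE.
have AE : (\sum_(i | i != p) (prof beta i * (d i - n) + 'C((prof beta i).+1, 2)) + s * n =
  \sum_(i | i != p) prof beta i * d i + \sum_(i | i != p) 'C(prof beta i, 2) + s)%N.
  rewrite /s big_distrl -!big_split /=; apply: eq_bigr => i _.
  rewrite binS bin1 mulnBr; have := leq_mul2l (prof beta i) n (d i).
  by rewrite dmin orbT; lia.
have -> : (n - r = s)%N by rewrite -nE addKn.
have := double_bin2 s; have := double_bin2 n; have := double_bin2 r.
move: AE nE; move: (\sum_(i | _) _)%N (\sum_(i | _) _)%N (\sum_(i | _) _)%N => a b c.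
by move: n ('C(s, 2)) ('C(r, 2)) => m; move: ('C(m, 2)) => *; nia.
Qed.

Lemma class_homog q : \det (xmat beta (xn d)) = q * \det (vmat d p (xn d)) ->
  q \is (wcost d r p (prof beta)).-homog.
Proof.
move=> qE; have hx i c : xn d i c \is 1.-homog.
  by rewrite /xn; case: insubP => [u _ _|_]; rewrite ?dhomog0 // /xvar dhomogX /= mdeg1.
have hV : \det (vmat d p (xn d)) \is (\sum_(j < n) j)%N.-homog.
  apply: dhomog_det => i j; rewrite !mxE -[X in X.-homog]mul1n; exact: dhomogMn.
have hX : \det (xmat beta (xn d)) \is
    (\sum_k ((if beta k == p then 0 else d (beta k)) + brank beta k))%N.-homog.
  rewrite -det_tr; apply: dhomog_det => k j; rewrite !mxE; apply: dhomogM; last first.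
    by rewrite -[X in X.-homog]mul1n; exact: dhomogMn.
  rewrite /xfac; case: eqP => _; first exact: dhomog1.
  have := @dhomog_bigprod int (nvar d) _ (index_enum 'I_(d (beta k))) xpredT
    (fun c => xn d (beta k) c - xn d p j) (fun=> 1%N).
  rewrite sum1_card card_ord; apply => c _; exact: rpredB.
suff <- : pihomog [measure of mdeg] (wcost d r p (prof beta)) q = q by exact: pihomogP.
apply: (mulIf (det_vmat_xn_neq0 d p)).
by rewrite -(pihomogM _ _ hV) -qE pihomog_dE // wcost_degree.
Qed.

Lemma class_exists : exists q, inAc r (wcost d r p (prof beta)) q /\
  \det (xmat beta (xn d)) = q * \det (vmat d p (xn d)).
Proof.
have [q qE] := dvd_det_vmat beta; exists q; split=> //.
by split; [split; [exact: class_inH | exact: class_psi] | exact: class_homog].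
Qed.

End ClassProperties.

Lemma rmorph_det_xmat N (d : 'I_N.+1 -> nat) (p : 'I_N.+1) (beta : 'I_(d p) -> 'I_N.+1)
    (S S' : comNzRingType) (g : {rmorphism S -> S'}) (z : 'I_N.+1 -> nat -> S) :
  g (\det (xmat beta z)) = \det (xmat beta (fun i c => g (z i c))).
Proof.
rewrite -det_map_mx; congr (\det _); apply/matrixP => j k; rewrite !mxE.
rewrite rmorphM rmorphXn /=; congr (_ * _); rewrite /xfac.
case: eqP => _; first by rewrite rmorph1.
by rewrite rmorph_prod; apply: eq_bigr => c _; rewrite rmorphB.
Qed.

Section Nonvanishing.
Variables (N : nat) (d : 'I_N.+1 -> nat) (p : 'I_N.+1).
Local Notation n := (d p).
Variable beta : 'I_n -> 'I_N.+1.

(* A vector in the kernel is a family of polynomials [H i], one per block of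
   columns, with too many roots. *)
Lemma det_xmat_neq0 (F : fieldType) (z : 'I_N.+1 -> nat -> F) :
  (forall i j : 'I_n, z p i = z p j -> i = j) ->
  (forall i (j : 'I_n), i != p -> (xfac d p z i (z p j) == 0) = (beta j != i)) ->
  \det (xmat beta z) != 0.
Proof.
move=> zinj facE; rewrite -det_tr; apply/negP => /det0P [v v0 vX].
pose H i := \sum_(k | beta k == i) v 0 k *: 'X^(brank beta k).
have rowE (j : 'I_n) : \sum_i xfac d p z i (z p j) * (H i).[z p j] = 0.
  have := congr1 (fun A : 'rV_n => A 0 j) vX; rewrite !mxE => vj; rewrite -[RHS]vj.
  rewrite [RHS](partition_big beta xpredT) //=; apply: eq_bigr => i _.
  rewrite /H horner_sum mulr_sumr; apply: eq_bigr => k /eqP bk.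
  by rewrite hornerZ hornerXn !mxE bk mulrCA.
have sH i : (size (H i) <= prof beta i)%N.
  apply: leq_trans (size_sum _ _ _) _; apply/bigmax_leqP => k /eqP <-.
  apply: leq_trans (size_scale_leq _ _) _; rewrite size_polyXn; exact: brank_lt.
have H0 i : (forall j, beta j == i -> (H i).[z p j] = 0) -> H i = 0.
  move=> Hroot; apply/eqP; apply: contraT => Hi0.
  have := max_poly_roots Hi0 (rs := [seq z p j | j : 'I_n in [set j | beta j == i]]).
  have -> : all (root (H i)) [seq z p j | j : 'I_n in [set j | beta j == i]].
    by apply/allP => _ /imageP [j jb ->]; rewrite inE in jb; rewrite rootE Hroot.
  rewrite map_inj_uniq ?enum_uniq => [|j k]; last exact: zinj.
  by rewrite size_map -cardE => /(_ isT isT); rewrite ltnNge sH.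
have facp j : xfac d p z p (z p j) = 1 by rewrite /xfac eqxx.
(* At a row with [beta j = i] only the factors of [i] and [p] can be nonzero, so [H p] has to be
   eliminated first. *)
have Hp : H p = 0.
  apply: H0 => j bj; have := rowE j; rewrite (bigD1 p) //= facp mul1r big1 ?addr0 // => i ip.
  have /eqP -> : xfac d p z i (z p j) == 0 by rewrite facE // (eqP bj) eq_sym.
  by rewrite mul0r.
have Hi i : H i = 0.
  have [->//|ip] := eqVneq i p; apply: H0 => j bj; have := rowE j.
  rewrite (bigD1 i) //= big1 => [|k ki].
    rewrite addr0 => /eqP; rewrite mulf_eq0 facE // bj /= => /eqP //.
  have [->|kp] := eqVneq k p; first by rewrite Hp horner0 mulr0.
  have /eqP -> : xfac d p z k (z p j) == 0 by rewrite facE // (eqP bj) eq_sym.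
  by rewrite mul0r.
case/eqP: v0; apply/rowP => k; rewrite mxE.
have := congr1 (fun q : {poly F} => q`_(brank beta k)) (Hi (beta k)).
rewrite coef0 coef_sum (bigD1 k) //= coefZ coefXn eqxx mulr1 big1 ?addr0 // => k' /andP[/eqP bk kk].
rewrite coefZ coefXn; case: eqP => [E|]; last by rewrite mulr0.
by rewrite (brank_inj bk (esym E)) eqxx in kk.
Qed.

End Nonvanishing.

(** * Lowest nonzero component of the ideal of relations *)

Section AlgebraSide.
Variables (N : nat) (d : 'I_N.+1 -> nat) (r : nat) (p : 'I_N.+1).
Local Notation n := (d p).
Hypothesis rn : (r < n)%N.
Hypothesis dmin : forall i, (n <= d i)%N.
Implicit Type beta : 'I_n -> 'I_N.+1.

Definition zpt beta : 'I_N.+1 -> nat -> int := zgen d p (Mb beta) (@mcode N).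

Lemma zpt_p beta j : zpt beta p j = mcode p j.
Proof. by rewrite /zpt /zgen if_same. Qed.

Lemma zpt_inj beta (i j : 'I_n) : zpt beta p i = zpt beta p j -> i = j.
Proof. by rewrite !zpt_p => /mcode_inj[_ /val_inj]. Qed.

Lemma xfac_zpt beta i (j : 'I_n) : i != p ->
  (xfac d p (zpt beta) i (zpt beta p j) == 0) = (beta j != i).
Proof.
move=> ip; rewrite /xfac (negbTE ip) zpt_p; apply/idP/idP.
  rewrite prodf_seq_eq0 => /hasP[c _ /=]; rewrite subr_eq0 /zpt /zgen.
  case: ifP => [/andP[cn iM] /eqP/mcode_inj[_ cj]|_ /eqP/mcode_inj[E]]; last by rewrite E eqxx in ip.
  by move: iM; rewrite cj Mb_ord inE ip andbT eq_sym.
move=> bj; rewrite (bigD1 (widen_ord (dmin i) j)) //= mulf_eq0 subr_eq0 /zpt /zgen.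
by rewrite Mb_ord inE ip andbT [i == _]eq_sym bj ltn_ord eqxx.
Qed.

Lemma det_xmat_zpt_neq0 beta : \det (xmat beta (zpt beta)) != 0.
Proof.
have := @det_xmat_neq0 N d p beta rat (fun i c => (zpt beta i c)%:~R).
rewrite -(rmorph_det_xmat _ (intmul 1 : {rmorphism int -> rat})) /= intr_eq0; apply.
  by move=> i j /intr_inj/zpt_inj.
move=> i j ip; rewrite -xfac_zpt // /xfac (negbTE ip).
under eq_bigr do rewrite -rmorphB /=; by rewrite -rmorph_prod intr_eq0.
Qed.

(** The columns of [i] vanish on all rows with [beta' j] different from [i], and these rows
    outnumber the remaining columns. *)
Lemma det_xmat_zpt_eq0 beta beta' i : i != p -> (prof beta' i < prof beta i)%N ->
  \det (xmat beta (zpt beta')) = 0.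
Proof.
move=> ip lt; apply: (@det_zero_block _ _ _ [set j | beta' j != i] [set k | beta k != i]).
  move=> j k; rewrite !inE negbK => bj /eqP bk; rewrite mxE bk.
  have /eqP -> : xfac d p (zpt beta') i (zpt beta' p j) == 0 by rewrite xfac_zpt.
  by rewrite mul0r.
have cE (b : 'I_n -> 'I_N.+1) : #|[set j | b j != i]| = (n - prof b i)%N.
  have := cardsC [set j | b j == i]; rewrite card_ord -/(prof b i).
  rewrite (_ : ~: [set j | b j == i] = [set j | b j != i]); last by apply/setP => j; rewrite !inE.
  by move/(congr1 (fun m => m - prof b i)%N); rewrite /= /prof addKn.
rewrite !cE; have := max_card (mem [set j | beta j == i]); rewrite card_ord -/(prof beta i).
by move: lt; move: (prof _ i) (prof _ i) => a b; move: n => m; lia.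
Qed.

Lemma prof_surj (w : 'I_N.+1 -> nat) : (\sum_i w i = n)%N ->
  exists beta, forall i, prof beta i = w i.
Proof.
move=> wn; pose s := flatten [seq nseq (w i) i | i <- enum 'I_N.+1].
have ss : size s = n.
  rewrite size_flatten /shape -map_comp sumnE big_map big_enum /= -wn.
  by apply: eq_bigr => i _; rewrite size_nseq.
exists (fun j => nth p s j) => i; rewrite -count_prof.
have -> : [seq nth p s j | j : 'I_n <- enum 'I_n] = s.
  rewrite (map_comp (nth p s) val) val_enum_ord -ss.
  by rewrite map_nth_iota0 ?take_size.
rewrite count_flatten -map_comp sumnE big_map big_enum /= (bigD1 i) //=.
rewrite count_nseq /= eqxx mul1n big1 ?addn0 // => k /negbTE ki.
by rewrite count_nseq /= ki.
Qed.

Definition weights : {set {ffun 'I_N.+1 -> 'I_n.+1}} :=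
  [set w : {ffun 'I_N.+1 -> 'I_n.+1} | (w p == r :> nat) && (\sum_i w i == n)%N].

Definition wnat (w : {ffun 'I_N.+1 -> 'I_n.+1}) (i : 'I_N.+1) : nat := w i.

Lemma prof_le beta i : (prof beta i < n.+1)%N.
Proof. by rewrite ltnS -[X in (_ <= X)%N]card_ord; apply: max_card. Qed.

Lemma algebra_side (C : nat) :
  (forall w, w \in weights -> (C <= wcost d r p (wnat w))%N) ->
  (exists2 w, w \in weights & wcost d r p (wnat w) = C) ->
  [/\ exists q : Rd d, inAc r C q /\ q <> 0,
      forall c, (c < C)%N -> forall q : Rd d, inAc r c q -> q = 0 &
      free_Zmod_rank (@inAc N d r C) #|[set w in weights | wcost d r p (wnat w) == C]|].
Proof.
move=> Cmin [w0 w0W w0C]; set Wm := [set w in _ | _].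
pose wof beta : {ffun 'I_N.+1 -> 'I_n.+1} := [ffun i => Ordinal (prof_le beta i)].
have wofE beta i : wnat (wof beta) i = prof beta i by rewrite /wnat ffunE.
have wcost_eq (w w' : 'I_N.+1 -> nat) : w =1 w' -> wcost d r p w = wcost d r p w'.
  by move=> ww; congr (wcost _ _ _ _); apply/funext.
have wofW beta : prof beta p = r -> wof beta \in weights.
  move=> br; rewrite inE -[val (wof beta p)]/(wnat _ p) wofE br eqxx /=.
  rewrite (eq_bigr (prof beta)) ?sum_prof // => i _; exact: wofE.
have Cprof beta : prof beta p = r -> (C <= wcost d r p (prof beta))%N.
  by move=> /wofW/Cmin; rewrite (wcost_eq _ _ (wofE beta)).
have /choice [bw bwP] (w : {ffun 'I_N.+1 -> 'I_n.+1}) :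
    exists beta, w \in weights -> forall i, prof beta i = wnat w i.
  have [|_] := boolP (w \in weights); last by exists (fun _ => p).
  rewrite inE => /andP[_ /eqP/prof_surj[b bE]]; by exists b.
have bwp w : w \in weights -> prof (bw w) p = r.
  by move=> wW; rewrite bwP //; move: wW; rewrite inE => /andP[/eqP].
(* Serves twice: below degree [C] the last condition is void, and in degree [C] it makes evaluation
   at the test points injective. *)
have low c (q : Rd d) : inAc r c q -> (c <= C)%N ->
    (c = C -> forall w, w \in Wm -> evn (zpt (bw w)) q = 0) -> q = 0.
  move=> [Aq qc] cC q0; apply: (vanish_low_degree rn dmin Aq qc) => beta br.
    exact: leq_trans (Cprof _ br).
  move=> cE; have cCE : c = C by apply/eqP; rewrite eqn_leq cC /= cE; exact: Cprof.
  have wW := wofW _ br; pose w := wof beta.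
  have bE i : prof (bw w) i = prof beta i by rewrite bwP // wofE.
  apply: (vanish_Mb_perm dmin (beta := bw w)) => //; first by case: Aq.
  apply: (vanish_Mb rn dmin Aq qc); rewrite ?bwp //.
    by rewrite (wcost_eq _ _ bE) cE.
  apply: q0 => //; rewrite inE wW /= (wcost_eq _ _ (wofE beta)) -cE cCE //.
have Wm_weights w : w \in Wm -> w \in weights by rewrite inE => /andP[].
have class w : w \in Wm -> exists q : Rd d, inAc r C q /\
    forall w', w' \in Wm -> (evn (zpt (bw w')) q != 0) = (w' == w).
  move=> wW; have wW' := Wm_weights w wW.
  have [q [qA qE]] := class_exists rn dmin (bwp _ wW').
  exists q; split.
    move: wW; rewrite inE => /andP[_ /eqP <-].
    by rewrite -(wcost_eq _ _ (bwP w wW')).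
  move=> w' w'W; have w'W' := Wm_weights w' w'W.
  have E := class_eval (zpt (bw w')) qE.
  have D0 : \det (vmat d p (zpt (bw w'))) != 0 by apply: det_vmat_neq0; exact: zpt_inj.
  have [ww'|ww'] := eqVneq w' w.
    subst w'; apply: contraTneq (det_xmat_zpt_neq0 (bw w)) => q0.
    by rewrite E q0 mul0r eqxx.
  apply/negbTE; rewrite negbK.
  (* Profiles have the same sum and agree at [p]; if none of the others dropped, they would all be
     equal. *)
  have [i ip lt] : exists2 i, i != p & (prof (bw w') i < prof (bw w) i)%N.
    apply/exists_inP; apply: contraNT ww'; rewrite negb_exists_in => /forall_inP le.
    have le' i : (prof (bw w) i <= prof (bw w') i)%N.
      have [->|ip] := eqVneq i p; first by rewrite !bwp.
      by rewrite leqNgt le.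
    have [_ /esym] := leqif_sum (fun i (_ : xpredT i) => leqif_eq (le' i)).
    rewrite !sum_prof eqxx => /forall_inP eqi; apply/eqP/ffunP => i; apply/val_inj.
    by have := eqi i isT; rewrite (bwP w) // (bwP w') // => /eqP.
  by move: E; rewrite (det_xmat_zpt_eq0 ip lt) => /esym/eqP; rewrite mulf_eq0 (negbTE D0) orbF.
have w0Wm : w0 \in Wm by rewrite inE w0W w0C eqxx.
split.
- have [q [qA qE]] := class w0 w0Wm; exists q; split=> // q0.
  by have := qE w0 w0Wm; rewrite q0 raddf0 !eqxx.
- move=> c cC q qA; apply: (low c) => //; first exact: ltnW.
  by move=> E; rewrite E ltnn in cC.
apply: (free_Zmod_rank_triangular (c := fun k q => evn (zpt (bw (enum_val k))) q)).
- split; last exact: dhomog0.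
  by split=> [s|]; rewrite ?psi_ev ?Sd_act_ev raddf0.
- move=> a x y [[Hx px] hx] [[Hy py] hy]; split; last by rewrite rpredD ?rpredZ.
  split=> [s|].
    by rewrite /Sd_act comp_mpolyD comp_mpolyZ -!/(Sd_act s _) Hx Hy.
  by rewrite /psi comp_mpolyD comp_mpolyZ -!/(psi r _) px py scaler0 addr0.
- move=> k a x y; rewrite raddfD /=; congr (_ + _).
  by rewrite /evn /ev mmapZ; congr (_ * _); exact: intz.
- move=> x xA x0; apply: (low C) => // _ w wW.
  by have := x0 (enum_rank_in w0Wm w); rewrite enum_rankK_in.
- move=> k; have [q [qA qE]] := class _ (enum_valP k); exists q; split=> //.
    by rewrite qE ?enum_valP.
  move=> l lk; apply/eqP; rewrite -[_ == _]negbK qE ?enum_valP //.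
  by apply: contraNneq lk => /enum_val_inj->.
Qed.

End AlgebraSide.

(** * Representations indexed by natural numbers *)

Section Composites.
Variables (K : fieldType) (dl : nat -> nat).
Implicit Types (B : forall k, 'M[K]_(dl k.+1, dl k)) (H e : forall k, 'M[K]_(dl k)).

(* The composite of the arrows from [s] to [t]; only meaningful for [s <= t]. *)
Fixpoint cmp B s t : 'M[K]_(dl t, dl s) :=
  match t with
  | 0 => conform_mx 0 (1%:M : 'M_(dl s))
  | t'.+1 => if t'.+1 == s then conform_mx 0 (1%:M : 'M_(dl s)) else B t' *m cmp B s t'
  end.

Lemma cmpp B s : cmp B s s = 1%:M.
Proof. by case: s => [|s] /=; rewrite ?eqxx conform_mx_id. Qed.

Lemma cmpS B s t : (s <= t)%N -> cmp B s t.+1 = B t *m cmp B s t.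
Proof. by move=> st; rewrite /= gtn_eqF // ltnS. Qed.

Lemma cmp_cat B s m t : (s <= m)%N -> (m <= t)%N -> cmp B s t = cmp B m t *m cmp B s m.
Proof.
move=> sm; elim: t => [|t IH]; first by case: m sm => //; case: s => // _ _; rewrite !cmpp mul1mx.
rewrite leq_eqVlt => /predU1P[->|mt]; first by rewrite cmpp mul1mx.
by rewrite !cmpS ?(leq_trans sm) // IH // mulmxA.
Qed.

Lemma cmp_ext B B' s t : (s <= t)%N -> (forall k, (s <= k < t)%N -> B k = B' k) ->
  cmp B s t = cmp B' s t.
Proof.
elim: t => [|t IH]; first by case: s => // _ _; rewrite !cmpp.
rewrite leq_eqVlt => /predU1P[->|]; first by rewrite !cmpp.
rewrite ltnS => st BB; rewrite !cmpS // BB ?st ?ltnSn // IH // => k /andP[sk kt].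
by rewrite BB // sk ltnW.
Qed.

(** Since [H k] has square zero, [1 - H k] inverts [1 + H k], and the intermediate factors
    cancel. *)
Lemma cmp_conj B H s t : (s <= t)%N -> (forall k, (s <= k < t)%N -> H k *m H k = 0) ->
  cmp (fun k => (1%:M + H k.+1) *m B k *m (1%:M - H k)) s t *m (1%:M + H s) =
  (1%:M + H t) *m cmp B s t.
Proof.
elim: t => [|t IH]; first by case: s => // _ _; rewrite !cmpp mul1mx mulmx1.
rewrite leq_eqVlt => /predU1P[->|]; first by rewrite !cmpp mul1mx mulmx1.
rewrite ltnS => st HH; rewrite !cmpS // -mulmxA IH //; last first.
  by move=> k /andP[sk kt]; rewrite HH // sk ltnW.
have E : (1%:M - H t) *m (1%:M + H t) = 1%:M.
  by rewrite mulmxDr mulmx1 mulmxBl mul1mx HH ?st ?ltnSn // subr0 subrK.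
by rewrite -!mulmxA [(1%:M - H t) *m _]mulmxA E mul1mx.
Qed.

Lemma cmp_upper B e s t : (s <= t)%N -> (forall k, e k *m e k = e k) ->
  (forall k, (s <= k < t)%N -> (1%:M - e k.+1) *m B k *m e k = 0) ->
  (1%:M - e t) *m cmp B s t *m e s = 0.
Proof.
move=> + ee; elim: t => [|t IH].
  by case: s => // _ _; rewrite cmpp mulmx1 mulmxBl mul1mx ee subrr.
rewrite leq_eqVlt => /predU1P[->|]; first by rewrite cmpp mulmx1 mulmxBl mul1mx ee subrr.
rewrite ltnS => st HB; rewrite cmpS //.
have {}IH : (1%:M - e t) *m cmp B s t *m e s = 0.
  by apply: IH => // k /andP[sk kt]; apply: HB; rewrite sk ltnW.
have E : (1%:M - e t.+1) *m B t = (1%:M - e t.+1) *m B t *m (1%:M - e t).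
  by rewrite mulmxBr mulmx1 HB ?st ?ltnSn // subr0.
by rewrite mulmxA E -mulmxA -mulmxA [(1%:M - e t) *m _]mulmxA IH mulmx0.
Qed.

Lemma rank_cmp_upper B e s t : (s <= t)%N -> (forall k, e k *m e k = e k) ->
  (forall k, (s <= k < t)%N -> (1%:M - e k.+1) *m B k *m e k = 0) ->
  (\rank (cmp B s t) <= \rank (e t) + \rank (1%:M - e s)%R)%N.
Proof.
move=> st ee HB; have U := cmp_upper st ee HB; set X := cmp B s t in U *.
have -> : X = e t *m X + (1%:M - e t) *m X *m (1%:M - e s).
  by rewrite mulmxBr mulmx1 U subr0 mulmxBl mul1mx addrC subrK.
apply: leq_trans (mxrank_add _ _) _; rewrite leq_add ?mxrankM_maxl ?mxrankM_maxr //.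
Qed.

End Composites.

(** * Matrices of block identities *)

Section PartialIdentities.
Variable K : fieldType.

Lemma mul_pid_mxE m n r (A : 'M[K]_(m, n)) i j :
  ((pid_mx r : 'M_m) *m A) i j = if (i < r)%N then A i j else 0.
Proof.
rewrite mxE (bigD1 i) //= big1 ?addr0 => [|k ki]; rewrite mxE.
  by rewrite eqxx; case: ltnP => _; rewrite ?mul1r ?mul0r.
by rewrite eq_sym val_eqE (negbTE ki) mul0r.
Qed.

Lemma mul_mx_pidE m n r (A : 'M[K]_(m, n)) i j :
  (A *m (pid_mx r : 'M_n)) i j = if (j < r)%N then A i j else 0.
Proof.
rewrite mxE (bigD1 j) //= big1 ?addr0 => [|k kj]; rewrite mxE.
  by rewrite eqxx; case: ltnP => _; rewrite ?mulr1 ?mulr0.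
rewrite val_eqE (negbTE kj); by rewrite mulr0.
Qed.

Lemma mul_copid_mxE m n r (A : 'M[K]_(m, n)) i j :
  ((1%:M - (pid_mx r : 'M_m)) *m A) i j = if (i < r)%N then 0 else A i j.
Proof.
rewrite mulmxBl mul1mx mxE [X in _ + X]mxE mul_pid_mxE.
by case: ifP; rewrite ?subrr ?subr0.
Qed.

(* [shift_mx m r] embeds the first [m] basis vectors as those of index at least [r]. *)
Definition shift_mx n q m r : 'M[K]_(n, q) :=
  \matrix_(a, c) ((a == (r + c)%N :> nat) && (c < m)%N)%:R.

(** A truncated identity from the first [r] basis vectors to the first [r'], and another between the
    remaining ones. *)
Definition bd_mx n' n r' r : 'M[K]_(n', n) :=
  \matrix_(a, b) ((if (b < r)%N then (a < r')%N && (a == b :> nat)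
                   else (r' <= a)%N && (a - r' == b - r)%N) : bool)%:R.

Lemma mulmx_col_delta m n q (A : 'M[K]_(m, n)) (J : 'M_(n, q)) a c (b : 'I_n) :
  (forall b', J b' c = (b' == b)%:R) -> (A *m J) a c = A a b.
Proof.
move=> Jc; rewrite mxE (bigD1 b) //= Jc eqxx mulr1 big1 ?addr0 // => b' /negbTE bb.
by rewrite Jc bb mulr0.
Qed.

Lemma mulmx_col0 m n q (A : 'M[K]_(m, n)) (J : 'M_(n, q)) a c :
  (forall b', J b' c = 0) -> (A *m J) a c = 0.
Proof. by move=> Jc; rewrite mxE big1 // => b _; rewrite Jc mulr0. Qed.

Lemma bd_mx_shift n' n q r' r m : (r + m <= n)%N ->
  bd_mx n' n r' r *m shift_mx n q m r = shift_mx n' q m r'.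
Proof.
move=> rmn; apply/matrixP => a c; rewrite [RHS]mxE.
case: (ltnP c m) => cm; last first.
  by rewrite andbF mulmx_col0 // => b; rewrite mxE ltnNge cm andbF.
have bn : (r + c < n)%N by rewrite (leq_trans _ rmn) // ltn_add2l.
rewrite (@mulmx_col_delta _ _ _ _ _ _ _ (Ordinal bn)) => [|b].
  rewrite mxE /= ltnNge leq_addr /= addKn andbT; congr (_%:R).
  by case: (leqP r' a) => ra /=; apply/esym; apply/eqP; lia.
by rewrite mxE cm andbT.
Qed.

Lemma bd_mx_pid n' n q r' r m : (r <= n)%N -> (m <= r)%N -> (m <= r')%N ->
  bd_mx n' n r' r *m (pid_mx m : 'M_(n, q)) = pid_mx m.
Proof.
move=> rn mr mr'; apply/matrixP => a c; rewrite [RHS]mxE.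
case: (ltnP c m) => cm; last first.
  rewrite mulmx_col0 => [|b]; first by case: eqP => //= ->; rewrite ltnNge cm.
  by rewrite mxE; case: eqP => //= ->; rewrite ltnNge cm.
have bn : (c < n)%N by lia.
rewrite (@mulmx_col_delta _ _ _ _ _ _ _ (Ordinal bn)) => [|b].
  rewrite mxE /= (leq_trans cm mr) andbC; congr (_%:R).
  by case: eqP => //= ->; rewrite cm (leq_trans cm mr').
rewrite mxE -val_eqE /=; congr (_%:R).
by case: eqP => //= ->; rewrite cm.
Qed.

Lemma bd_mx_comm n' n r' r :
  (pid_mx r' : 'M_n') *m bd_mx n' n r' r = bd_mx n' n r' r *m (pid_mx r : 'M_n).
Proof.
apply/matrixP => a b; rewrite mul_pid_mxE mul_mx_pidE !mxE.
by case: (ltnP b r) => br; case: (ltnP a r') => ar.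
Qed.

Lemma tr_shift_mxK n m r : (r + m <= n)%N ->
  (shift_mx n m m r)^T *m shift_mx n m m r = 1%:M.
Proof.
move=> rmn; apply/matrixP => c c'; have bn : (r + c' < n)%N.
  by rewrite (leq_trans _ rmn) // ltn_add2l.
rewrite (@mulmx_col_delta _ _ _ _ _ _ _ (Ordinal bn)) => [|b].
  by rewrite !mxE /= ltn_ord andbT eqn_add2l eq_sym.
by rewrite mxE ltn_ord andbT.
Qed.

Lemma shift_mx_copid n r : (r <= n)%N ->
  shift_mx n (n - r) (n - r) r *m (shift_mx n (n - r) (n - r) r)^T = 1%:M - pid_mx r.
Proof.
move=> rn; apply/matrixP => a b; rewrite !mxE.
case: (ltnP b r) => br.
  rewrite big1 => [|c _]; last by rewrite !mxE [(b == _ :> nat)](_ : _ = false) ?mulr0 //; apply/negbTE; lia.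
  rewrite -val_eqE /=; case: eqP => //= ab; rewrite ?subr0 // ab br ?subrr //.
have bc : (b - r < n - r)%N by rewrite ltn_sub2r // (leq_ltn_trans br).
rewrite (bigD1 (Ordinal bc)) //= big1 => [|c cb].
  rewrite !mxE /= bc subnKC // eqxx mulr1 addr0 andbT -val_eqE /=.
  by case: eqP => //= ab; rewrite ?subr0 // ab ltnNge br subr0.
rewrite !mxE [X in _ * X](_ : _ = 0) ?mulr0 //; case: eqP => //= bE.
by case/eqP: cb; apply/val_inj => /=; lia.
Qed.

End PartialIdentities.

Section BlockDiagonal.
Variables (K : fieldType) (dl v : nat -> nat).
Implicit Types (s t : nat).
Local Notation B0 := (fun k => bd_mx K (dl k.+1) (dl k) (v k.+1) (v k)).
Local Notation e k := (pid_mx (v k) : 'M[K]_(dl k)).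

(** No complementary block along the way is smaller than the one at [s], so the composite is
    injective there. *)
Lemma cmp_bd_linv s t : (s <= t)%N -> (forall k, (s <= k <= t)%N -> (v k <= dl k)%N) ->
  (forall k, (s <= k <= t)%N -> (dl s - v s <= dl k - v k)%N) ->
  exists L, L *m cmp B0 s t *m (1%:M - e s) = 1%:M - e s.
Proof.
move=> st vd us; pose m := (dl s - v s)%N; pose J k := shift_mx K (dl k) m m (v k).
have vm k : (s <= k <= t)%N -> (v k + m <= dl k)%N.
  by move=> sk; have := vd k sk; have := us k sk; rewrite /m; lia.
have BJ : cmp B0 s t *m J s = J t.
  elim: {us vd}t st vm => [|t IH]; first by case: s @m @J => // *; rewrite cmpp mul1mx.
  rewrite leq_eqVlt => /predU1P[<-|]; first by rewrite cmpp mul1mx.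
  rewrite ltnS => st vm; rewrite cmpS // -mulmxA IH //; last first.
    by move=> k /andP[sk kt]; rewrite vm // sk leqW.
  by apply: bd_mx_shift; rewrite vm // st leqnSn.
exists (J s *m (J t)^T); rewrite -(shift_mx_copid _ (vd s _)) ?leqnn ?st //.
rewrite -/m -/(J s) -!mulmxA [cmp _ _ _ *m _]mulmxA BJ.
by rewrite [(J t)^T *m _]mulmxA tr_shift_mxK ?mul1mx // vm // st leqnn.
Qed.

Lemma cmp_bd_pid m q s t : (s <= t)%N -> (forall k, (s <= k <= t)%N -> (v k <= dl k)%N) ->
  (forall k, (s <= k <= t)%N -> (m <= v k)%N) ->
  cmp B0 s t *m (pid_mx m : 'M_(dl s, q)) = pid_mx m.
Proof.
elim: t => [|t IH] st vd vm.
  by case: s st {vd vm} => // _; rewrite cmpp mul1mx.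
move: (st); rewrite leq_eqVlt => /predU1P[<-|]; first by rewrite cmpp mul1mx.
rewrite ltnS => st'; rewrite cmpS // -mulmxA IH // => [|k /andP[sk kt]|k /andP[sk kt]].
- by apply: bd_mx_pid; rewrite ?vm ?vd ?st' ?st ?leqnSn ?leqnn.
- by rewrite vd // sk leqW.
- by rewrite vm // sk leqW.
Qed.

Lemma cmp_bd_rinv s t : (s <= t)%N -> (forall k, (s <= k <= t)%N -> (v k <= dl k)%N) ->
  (forall k, (s <= k <= t)%N -> (v t <= v k)%N) ->
  cmp B0 s t *m (pid_mx (v t) : 'M_(dl s, dl t)) = e t.
Proof. exact: cmp_bd_pid. Qed.

(** The composite is onto the first block at [t] and injective on the complementary block at [s]; it
    respects the decomposition, so the two ranks add. *)
Lemma rank_cmp_bd s t : (s <= t)%N -> (forall k, (s <= k <= t)%N -> (v k <= dl k)%N) ->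
  (forall k, (s <= k <= t)%N -> (dl s - v s <= dl k - v k)%N) ->
  (forall k, (s <= k <= t)%N -> (v t <= v k)%N) ->
  (v t + (dl s - v s) <= \rank (cmp B0 s t))%N.
Proof.
move=> st vd us vt; have [L LE] := cmp_bd_linv st vd us.
have RE := cmp_bd_rinv st vd vt; set X := cmp B0 s t in LE RE *.
set Rm := pid_mx _ in RE.
have comm : e t *m X = X *m e s.
  rewrite /X; elim: {us vt LE RE Rm X L}t st vd => [|t IH] st vd.
    by case: s st {vd} => // _; rewrite !cmpp mul1mx mulmx1.
  move: st; rewrite leq_eqVlt => /predU1P[<-|]; first by rewrite cmpp mul1mx mulmx1.
  rewrite ltnS => st; rewrite cmpS // mulmxA bd_mx_comm -!mulmxA IH // => k /andP[sk kt].
  by rewrite vd // sk leqW.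
have ee k : e k *m e k = e k.
  by apply/matrixP => a b; rewrite mul_pid_mxE !mxE; case: ltnP => //; case: eqP.
have fe : e t *m (X *m (1%:M - e s)) = 0.
  by rewrite mulmxA comm -mulmxA mulmxBr mulmx1 ee subrr mulmx0.
have XR : X *m Rm = e t by [].
have ee' : e s *m (1%:M - e s) = 0 by rewrite mulmxBr mulmx1 ee subrr.
have ee'' : (1%:M - e t) *m e t = 0 by rewrite mulmxBl mul1mx ee subrr.
have E : col_mx (e t) (L *m (1%:M - e t)) *m X *m row_mx Rm (1%:M - e s) =
    block_mx (e t) 0 0 (1%:M - e s).
  rewrite mul_col_mx mul_col_row; congr block_mx.
  - by rewrite -mulmxA XR ee.
  - by rewrite -mulmxA fe.
  - by rewrite -!mulmxA XR ee'' mulmx0.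
  - have -> : L *m (1%:M - e t) *m X = L *m X - L *m X *m e s.
      by rewrite mulmxBr mulmx1 mulmxBl -[L *m e t *m X]mulmxA comm mulmxA.
    by rewrite mulmxBl LE -!mulmxA ee' !mulmx0 subr0.
have := mxrankM_maxr (col_mx (e t) (L *m (1%:M - e t))) (X *m row_mx Rm (1%:M - e s)).
rewrite mulmxA E rank_diag_block_mx => /leq_trans/(_ (mxrankM_maxl _ _)); apply: leq_trans.
by rewrite rank_pid_mx ?rank_copid_mx // vd // ?st ?leqnn.
Qed.

End BlockDiagonal.

Section NatIndexedRep.
Variables (K : fieldType) (N : nat) (d : 'I_N.+1 -> nat).
Local Notation dl k := (dn d k).
Local Notation coord := (@repcoord K N d).

Definition arr (A : Rep K d) k : 'M[K]_(dl k.+1, dl k) :=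
  match @idP (k < N)%N with ReflectT h => A (Ordinal h) | ReflectF _ => 0 end.

Definition mkRep (B : forall k, 'M[K]_(dl k.+1, dl k)) : Rep K d := fun i => B i.

Lemma arr_Ordinal A k (h : (k < N)%N) : arr A k = A (Ordinal h).
Proof. by rewrite /arr; case: {-}_ / idP => // h'; rewrite (bool_irrelevance h' h). Qed.

Lemma arrE A (i : 'I_N) : arr A i = A i.
Proof. by case: i => k h; exact: (arr_Ordinal A h). Qed.

Lemma arr_mkRep B k : (k < N)%N -> arr (mkRep B) k = B k.
Proof. by move=> h; rewrite (arr_Ordinal _ h). Qed.

Lemma prodRep_cmp (A : Rep K d) k (h : (k <= N)%N) : prodRep A h = cmp (arr A) 0 k.
Proof.
elim: k h => [|k IH] h; first by rewrite cmpp.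
by rewrite cmpS //= IH (arr_Ordinal _ h).
Qed.

Definition rcoord (i : 'I_N) (a : 'I_(dl i.+1)) (b : 'I_(dl i)) : RepCoord K d :=
  Tagged (fun i : 'I_N => ('I_(dl i.+1) * 'I_(dl i))%type) (a, b).

Lemma polyfun_arr k i j : polyfun coord (fun A => arr A k i j).
Proof.
case: (boolP (k < N)%N) => h.
  apply: polyfun_ext (pf_coord coord (@rcoord (Ordinal h) i j)) _ => A.
  by rewrite (arr_Ordinal _ h).
apply: polyfun_ext (pf_const coord 0) _ => A; rewrite /arr.
by case: {-}_ / idP => [h'|_]; [rewrite h' in h | rewrite mxE].
Qed.

Lemma polyfun_cmp s t i j : polyfun coord (fun A => cmp (arr A) s t i j).
Proof.
elim: t i j => [|t IH] i j /=; first exact: pf_const.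
case: eqP => _; first exact: pf_const.
by apply: polyfun_mulmx => // *; exact: polyfun_arr.
Qed.

(** The equations are the determinants of all compressions to size [rho.+1], in place of minors; if
    the rank is larger, the bases of the rank normal form give a compression equal to the
    identity. *)
Lemma rank_closed (s t rho : nat) :
  zclosed coord (fun A => (\rank (cmp (arr A) s t) <= rho)%N).
Proof.
exists (fun f => exists (L : 'M[K]_(rho.+1, dl t)) (M : 'M[K]_(dl s, rho.+1)),
  f = fun A => \det (L *m cmp (arr A) s t *m M)).
split=> [f [L [M ->]]|A].
  apply: polyfun_det => i j.
  apply: (polyfun_mulmx (F := fun A => L *m cmp (arr A) s t) (G := fun _ => M)).
    apply: (polyfun_mulmx (F := fun _ => L)) => *; [exact: pf_const | exact: polyfun_cmp].
  by move=> *; exact: pf_const.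
split=> [rA f [L [M ->]]|H].
  apply/eqP; apply: contraTT rA => det0.
  have : L *m cmp (arr A) s t *m M \in unitmx by rewrite unitmxE unitfE.
  move/mxrank_unit => rk; rewrite -ltnNge -rk.
  exact: leq_trans (mxrankM_maxl _ _) (mxrankM_maxr _ _).
rewrite leqNgt; apply/negP => rA; set X := cmp _ _ _ in rA H.
have rt : (rho < dl t)%N := leq_trans rA (rank_leq_row _).
have rs : (rho < dl s)%N := leq_trans rA (rank_leq_col _).
pose L := pid_mx rho.+1 *m invmx (col_ebase X) : 'M_(rho.+1, _).
pose M := invmx (row_ebase X) *m pid_mx rho.+1 : 'M_(_, rho.+1).
have := H _ (ex_intro _ L (ex_intro _ M erefl)).
rewrite /L /M -[X in _ *m X *m _]mulmx_ebase.
rewrite !mulmxA -[pid_mx _ *m invmx _ *m col_ebase _]mulmxA mulVmx ?col_ebase_unit // mulmx1.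
rewrite -[_ *m row_ebase _ *m _]mulmxA mulmxV ?row_ebase_unit // mulmx1.
rewrite !mul_pid_mx [minn _ _](_ : _ = rho.+1); last by move: (\rank X) rA rt rs; lia.
by rewrite pid_mx_1 det1 => /eqP; rewrite oner_eq0.
Qed.

End NatIndexedRep.

(** * Strata *)

Section Strata.
Variables (K : fieldType) (N : nat) (d : 'I_N.+1 -> nat) (v : nat -> nat).
Local Notation dl k := (dn d k).
Local Notation coord := (@repcoord K N d).
Local Notation e k := (pid_mx (v k) : 'M[K]_(dl k)).
Local Notation D := (\sum_(k < N.+1) dl k).+1.

(* [(true, k, a, b)] is the entry [(a, b)] of an endomorphism [H k] of [K^(d_k)] mapping
   the span of the first [v k] basis vectors to that of the others, and [(false, k, a, b)]
   an entry of an arrow [B k] preserving these spans of first basis vectors. *)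
Definition par (x : bool * 'I_N.+1 * 'I_D * 'I_D) : bool :=
  let: (c, k, a, b) := x in
  if c then [&& (v k <= a)%N, (a < dl k)%N & (b < v k)%N]
  else [&& (k < N)%N, (a < dl k.+1)%N, (b < dl k)%N & ~~ ((v k.+1 <= a)%N && (b < v k)%N)].

Definition npar : nat := #|[pred x | par x]|.

(** At most one summand; an entry that is not a parameter gets the empty sum 0. *)
Definition get (t : 'I_npar -> K) c (k a b : nat) : K :=
  \sum_(j | enum_val j == (c, inord k, inord a, inord b)) t j.

Definition tH t k : 'M[K]_(dl k) := \matrix_(a, b) get t true k a b.
Definition tB t k : 'M[K]_(dl k.+1, dl k) := \matrix_(a, b) get t false k a b.

(** The arrow [tB] preserves the standard subspaces, and conjugation moves them to their images
    under [1 + tH], which range over the big cells of the Grassmannians. *)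
Definition phi t : Rep K d :=
  mkRep (fun k => (1%:M + tH t k.+1) *m tB t k *m (1%:M - tH t k)).

Definition stratum : Rep K d -> Prop := zclosure coord (image phi).

Lemma ltn_dl_D k a : (k <= N)%N -> (a < dl k)%N -> (a < D)%N.
Proof.
move=> kN ak; apply: leq_trans ak _; rewrite ltnW // ltnS.
by rewrite (bigD1 (inord k)) //= inordK // leq_addr.
Qed.

Definition ntuple (x : bool * 'I_N.+1 * 'I_D * 'I_D) : bool * nat * nat * nat :=
  let: (c, k, a, b) := x in (c, k : nat, a : nat, b : nat).

Definition npart (y : bool * nat * nat * nat) : bool :=
  let: (c, k, a, b) := y in
  if c then [&& (v k <= a)%N, (a < dl k)%N & (b < v k)%N]
  else [&& (k < N)%N, (a < dl k.+1)%N, (b < dl k)%N & ~~ ((v k.+1 <= a)%N && (b < v k)%N)].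


Lemma get_mk (h : bool * nat * nat * nat -> K) c k a b : (k <= N)%N ->
  (a < dl (if c then k else k.+1))%N -> (b < dl k)%N -> (c || (k < N)%N) ->
  get (fun j => h (ntuple (enum_val j))) c k a b =
  if npart (c, k, a, b) then h (c, k, a, b) else 0.
Proof.
move=> kN adl bdl ck; rewrite /get.
pose x : bool * 'I_N.+1 * 'I_D * 'I_D := (c, inord k, inord a, inord b); rewrite -/x.
have aD : (a < D)%N.
  by move: adl ck; case: c @x => x adl ck; [exact: ltn_dl_D adl | exact: (ltn_dl_D ck)].
have bD : (b < D)%N by exact: (@ltn_dl_D k).
have xE : ntuple x = (c, k, a, b) by rewrite /x /= !inordK.
have xP : (x \in [pred x | par x]) = npart (c, k, a, b) by rewrite inE -xE.
rewrite -xP -xE; case: ifP => px; last first.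
  apply: big_pred0 => j; apply/negbTE/eqP => jx; have := enum_valP j.
  by rewrite jx px.
rewrite (big_pred1 (enum_rank_in px x)) ?enum_rankK_in // => j.
by apply/eqP/eqP => [jx|->]; [apply: enum_val_inj|]; rewrite enum_rankK_in.
Qed.

Lemma get_eq0 t c k a b : (k <= N)%N ->
  (a < dl (if c then k else k.+1))%N -> (b < dl k)%N -> (c || (k < N)%N) ->
  ~~ npart (c, k, a, b) -> get t c k a b = 0.
Proof.
move=> kN adl bdl ck np; apply: big_pred0 => j; apply/negbTE/eqP => jx.
have aD : (a < D)%N.
  by move: adl ck; case: c {np jx} => adl ck; [exact: ltn_dl_D adl | exact: (ltn_dl_D ck)].
have bD : (b < D)%N by exact: (@ltn_dl_D k).
have := enum_valP j; rewrite jx inE /=; move: np => /=.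
by rewrite !inordK // => /negbTE->.
Qed.

Lemma eH t k : (k <= N)%N -> e k *m tH t k = 0.
Proof.
move=> kN; apply/matrixP => a b; rewrite mul_pid_mxE !mxE; case: ltnP => // ak.
by apply: get_eq0; rewrite //= leqNgt ak.
Qed.

Lemma He t k : (k <= N)%N -> tH t k *m e k = tH t k.
Proof.
move=> kN; apply/matrixP => a b; rewrite mul_mx_pidE !mxE; case: ltnP => // ak.
by apply/esym/get_eq0; rewrite //= [(b < v k)%N]ltnNge ak !andbF.
Qed.

Lemma HH t k : (k <= N)%N -> tH t k *m tH t k = 0.
Proof. by move=> kN; rewrite -{1}(He t kN) -mulmxA eH // mulmx0. Qed.

Lemma eBe t k : (k < N)%N -> (1%:M - e k.+1) *m tB t k *m e k = 0.
Proof.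
move=> kN; apply/matrixP => a b; rewrite mul_mx_pidE mul_copid_mxE !mxE.
case: ltnP => // bv; case: ltnP => // va.
by apply: get_eq0; rewrite ?(ltnW kN) //= va bv /= !andbF.
Qed.

Lemma ee k : e k *m e k = e k.
Proof. by apply/matrixP => a b; rewrite mul_pid_mxE !mxE; case: ltnP => //; case: eqP. Qed.

Definition entry m n (M : 'M[K]_(m, n)) (a b : nat) : K :=
  if insub a is Some a' then if insub b is Some b' then M a' b' else 0 else 0.

Lemma entryE m n (M : 'M[K]_(m, n)) (a : 'I_m) (b : 'I_n) : entry M a b = M a b.
Proof. by rewrite /entry !valK. Qed.

Definition mkpar (H : forall k, 'M[K]_(dl k)) (B : forall k, 'M[K]_(dl k.+1, dl k))
    : 'I_npar -> K :=
  fun j => let: (c, k, a, b) := ntuple (enum_val j) in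
    if c then entry (H k) a b else entry (B k) a b.

Lemma tH_mk H B k : (k <= N)%N -> e k *m H k = 0 -> H k *m e k = H k ->
  tH (mkpar H B) k = H k.
Proof.
move=> kN eH0 HeH; apply/matrixP => a b; rewrite mxE.
rewrite (@get_mk (fun y => let: (c, k, a, b) := y in
  if c then entry (H k) a b else entry (B k) a b)) //= entryE.
case: ifP => // /negbT np; have := congr1 (fun M : 'M_(dl k) => M a b) eH0.
rewrite mul_pid_mxE mxE; move: np; rewrite ltn_ord /= negb_and.
case: (ltnP a (v k)) => [_ _ ->//|av] /=; rewrite -leqNgt => vb _.
by rewrite -HeH mul_mx_pidE ltnNge vb.
Qed.

Lemma tB_mk H B k : (k < N)%N -> (1%:M - e k.+1) *m B k *m e k = 0 ->
  tB (mkpar H B) k = B k.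
Proof.
move=> kN eBe0; apply/matrixP => a b; rewrite mxE.
rewrite (@get_mk (fun y => let: (c, k, a, b) := y in
  if c then entry (H k) a b else entry (B k) a b)) ?(ltnW kN) //= entryE.
case: ifP => // /negbT; rewrite kN !ltn_ord /= negbK => /andP[va bv].
have := congr1 (fun M : 'M_(dl k.+1, dl k) => M a b) eBe0.
by rewrite mul_mx_pidE mul_copid_mxE bv mxE ltnNge va.
Qed.

Lemma mem_image (A : Rep K d) (H : forall k, 'M[K]_(dl k)) :
  (forall k, (k <= N)%N -> e k *m H k = 0 /\ H k *m e k = H k) ->
  (forall k, (k < N)%N ->
    (1%:M - e k.+1) *m ((1%:M - H k.+1) *m arr A k *m (1%:M + H k)) *m e k = 0) ->
  image phi A.
Proof.
move=> HP BP; pose B k := (1%:M - H k.+1) *m arr A k *m (1%:M + H k).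
exists (mkpar H B); apply/functional_extensionality_dep => i; rewrite /phi /mkRep.
have [iN iN'] := (ltn_ord i, ltnW (ltn_ord i)).
have [h1 h2] := HP i.+1 iN; have [h3 h4] := HP i iN'.
rewrite !tH_mk // tB_mk //; last exact: BP.
have HH0 k : (k <= N)%N -> H k *m H k = 0.
  by move=> /HP[eH0 HeH]; rewrite -{1}HeH -mulmxA eH0 mulmx0.
have inv1 : (1%:M + H i.+1) *m (1%:M - H i.+1) = 1%:M.
  by rewrite mulmxBr mulmx1 mulmxDl mul1mx HH0 // addr0 addrK.
have inv2 : (1%:M + H i) *m (1%:M - H i) = 1%:M.
  by rewrite mulmxBr mulmx1 mulmxDl mul1mx HH0 // addr0 addrK.
by rewrite /B -!mulmxA inv2 mulmx1 mulmxA inv1 mul1mx arrE.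
Qed.
End Strata.

Lemma polyfun_polyP (K : fieldType) F : polyfun (fun (_ : unit) (s : K) => s) F ->
  exists q : {poly K}, forall s, F s = q.[s].
Proof.
elim=> [c|i|g h _ [P hP] _ [Q hQ]|g h _ [P hP] _ [Q hQ]].
- by exists c%:P => s; rewrite hornerC.
- by exists 'X => s; rewrite hornerX.
- by exists (P + Q) => s; rewrite hornerD hP hQ.
- by exists (P * Q) => s; rewrite hornerM hP hQ.
Qed.

Lemma polyfun_adj (K : fieldType) (T I : Type) (coord : I -> T -> K) n (F : T -> 'M[K]_n) :
  (forall i j, polyfun coord (fun x => F x i j)) ->
  forall i j, polyfun coord (fun x => (\adj (F x)) i j).
Proof.
move=> pF i j; apply: polyfun_ext (_ : polyfun coord (fun x => cofactor (F x) j i)) _.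
  apply: pf_mul; first exact: pf_const.
  apply: (polyfun_det (F := fun x => row' j (col' i (F x)))) => a b.
  by apply: polyfun_ext (pF (lift j a) (lift i b)) _ => x; rewrite !mxE.
by move=> x; rewrite mxE.
Qed.

(* If the leading block of [g] is invertible, then [g = (1 + H) p] with [p] block upper
   triangular; [H = (1 - e) g e (e g e + 1 - e)^-1 e]. *)
Lemma big_cell (K : fieldType) n (e g : 'M[K]_n) : e *m e = e ->
  e *m g *m e + (1%:M - e) \in unitmx ->
  exists H : 'M[K]_n, [/\ e *m H = 0, H *m e = H, (1%:M - e) *m (1%:M - H) *m g *m e = 0 &
    (1%:M - e) *m \adj g *m (1%:M + H) *m e = 0].
Proof.
move=> ee; set g' := _ + _ => ug'; set e' := 1%:M - e in g' ug' *.
have ee' : e *m e' = 0 by rewrite mulmxBr mulmx1 ee subrr.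
have e'e : e' *m e = 0 by rewrite mulmxBl mul1mx ee subrr.
have e'e' : e' *m e' = e' by rewrite {2}/e' mulmxBr mulmx1 e'e subr0.
have g'e : g' *m e = e *m g *m e by rewrite mulmxDl -mulmxA ee e'e addr0.
have eg' : e *m g' = e *m g *m e by rewrite mulmxDr !mulmxA ee ee' addr0.
pose H := e' *m g *m e *m invmx g' *m e; exists H.
have eHe : H *m e = H by rewrite /H -mulmxA ee.
split=> //.
- by rewrite /H !mulmxA ee' !mul0mx.
- have -> : e' *m (1%:M - H) *m g *m e = e' *m g *m e - e' *m H *m g *m e.
    by rewrite mulmxBr mulmx1 !mulmxBl.
  have -> : e' *m H *m g *m e = e' *m g *m e *m invmx g' *m (e *m g *m e).
    by rewrite /H !mulmxA e'e'.
  by rewrite -g'e mulmxA mulmxKV // -[e' *m g *m e *m e]mulmxA ee subrr.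
have E : (1%:M + H) *m e = g *m e *m invmx g' *m e.
  have E2 : e *m g *m e *m invmx g' *m e = e by rewrite -eg' mulmxK // ee.
  by rewrite mulmxDl mul1mx eHe /H {1}/e' !mulmxBl !mul1mx E2 addrC subrK.
rewrite -mulmxA E !mulmxA -[e' *m _ *m g]mulmxA mul_adj_mx.
by rewrite mul_mx_scalar -!scalemxAl e'e !mul0mx scaler0.
Qed.

(** * Representations preserving arbitrary subspaces *)

Section Cover.
Variables (K : fieldType) (N : nat) (d : 'I_N.+1 -> nat).
Hypothesis Kinf : forall s : seq K, exists x, x \notin s.
Local Notation dl k := (dn d k).
Local Notation coord := (@repcoord K N d).

Lemma polymap_phi v : polymap coord (@phi K N d v).
Proof.
move=> [i [a b]]; rewrite /repcoord /phi /mkRep /=.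
have pget c k a' b' : polyfun (@acoord K (npar d v)) (fun t => get t c k a' b').
  by apply: polyfun_sum => j _; exact: (pf_coord _ j).
have pH k a' b' : polyfun (@acoord K (npar d v)) (fun t => tH t k a' b').
  by apply: polyfun_ext (pget true k a' b') _ => t; rewrite mxE.
apply: (polyfun_mulmx (F := fun t => (1%:M + tH t i.+1) *m tB t i)
  (G := fun t => 1%:M - tH t i)) => [a' b'|a' b'].
  apply: (polyfun_mulmx (F := fun t => 1%:M + tH t i.+1)) => [a1 b1|a1 b1].
    apply: polyfun_ext (pf_add (pf_const _ ((1%:M : 'M_(dl i.+1)) a1 b1)) (pH i.+1 a1 b1)) _.
    by move=> t; rewrite [RHS]mxE.
  by apply: polyfun_ext (pget false i a1 b1) _ => t; rewrite mxE.
apply: polyfun_ext (polyfun_sub (pf_const _ ((1%:M : 'M_(dl i)) a' b')) (pH i a' b')) _.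
by move=> t; rewrite [RHS]mxE [X in _ = _ + X]mxE.
Qed.

(** The preserved subspaces may lie outside the big cells. Join each [g k] to the identity by a
    line: for all but finitely many [s] the leading blocks are invertible and [As s] lies in the
    image, so [A], reached at [s = 1], lies in its closure. *)
Lemma stratum_conj v (A : Rep K d) (g : forall k, 'M[K]_(dl k))
    (B : forall k, 'M[K]_(dl k.+1, dl k)) :
  (forall k, (k <= N)%N -> g k \in unitmx) ->
  (forall k, (k < N)%N -> arr A k *m g k = g k.+1 *m B k) ->
  (forall k, (k < N)%N ->
    (1%:M - (pid_mx (v k.+1) : 'M_(dl k.+1))) *m B k *m (pid_mx (v k) : 'M_(dl k)) = 0) ->
  stratum v A.
Proof.
move=> ug AB eBe0 f pf f0.
pose e k : 'M[K]_(dl k) := pid_mx (v k).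
pose gs (s : K) k := 1%:M + s *: (g k - 1%:M).
(* The adjugate keeps the family polynomial in [s]; the constant [(\det (g k))^-1] turns it into the
   inverse at [s = 1]. *)
pose As s := mkRep (fun k => gs s k.+1 *m ((\det (g k))^-1 *: B k) *m \adj (gs s k)).
have A1 : As 1 = A.
  apply/functional_extensionality_dep => i; rewrite /As /mkRep -[RHS]arrE.
  have [iN iN'] := (ltn_ord i, ltnW (ltn_ord i)).
  have gs1 k : gs 1 k = g k by rewrite /gs scale1r addrC subrK.
  rewrite !gs1 -scalemxAr -AB // -scalemxAl -mulmxA mul_mx_adj.
  by rewrite mul_mx_scalar scalerA mulVf ?scale1r // -unitfE -unitmxE ug.
pose c1 := fun (_ : unit) (s : K) => s.
have pgs k i j : polyfun c1 (fun s => gs s k i j).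
  apply: polyfun_ext (pf_add (pf_const _ ((1%:M : 'M_(dl k)) i j))
    (pf_mul (pf_coord _ tt) (pf_const _ ((g k - 1%:M) i j)))) _ => s.
  by rewrite /gs [RHS]mxE [X in _ = _ + X]mxE.
have pfs : polyfun c1 (fun s => f (As s)).
  apply: (polyfun_comp (c2 := coord)) pf => -[i [a b]]; rewrite /repcoord /As /mkRep /=.
  apply: (polyfun_mulmx (F := fun s => gs s i.+1 *m ((\det (g i))^-1 *: B i))
    (G := fun s => \adj (gs s i))) => [a' b'|a' b'].
    apply: (polyfun_mulmx (F := fun s => gs s i.+1)
      (G := fun _ => (\det (g i))^-1 *: B i)) => // *; exact: pf_const.
  exact: polyfun_adj.
have [q qE] := polyfun_polyP pfs.
have pd k : polyfun c1 (fun s => \det (e k *m gs s k *m e k + (1%:M - e k))).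
  apply: (polyfun_det (F := fun s => e k *m gs s k *m e k + (1%:M - e k))) => i j.
  have pe i' j' : polyfun c1 (fun s => (e k *m gs s k *m e k) i' j').
    apply: (polyfun_mulmx (F := fun s => e k *m gs s k) (G := fun _ => e k)) => *.
      by apply: (polyfun_mulmx (F := fun _ => e k)) => // *; exact: pf_const.
    exact: pf_const.
  by apply: polyfun_ext (pf_add (pe i j) (pf_const _ ((1%:M - e k) i j))) _ => s; rewrite [RHS]mxE.
(* [S] is the product of the determinants of the leading blocks, equal to 1 at [s = 0]. *)
have [S SE] := polyfun_polyP (polyfun_prod (index_enum 'I_N.+1) (P := xpredT)
  (fun k _ => pd k)).
have S0 : S != 0.
  apply/eqP => S0; have := SE 0; rewrite S0 horner0 big1 => [|k _].
    by move/eqP; rewrite oner_eq0.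
  by rewrite /gs scale0r addr0 mulmx1 ee addrC subrK det1.
have q0 : q = 0.
  apply: (poly_cofinite_eq0 Kinf S0) => s; rewrite -SE => /prodf_neq0 Ss.
  rewrite -qE; apply: f0.
  have exH (k : nat) : exists H : 'M[K]_(dl k), (k <= N)%N ->
     [/\ e k *m H = 0, H *m e k = H, (1%:M - e k) *m (1%:M - H) *m gs s k *m e k = 0 &
      (1%:M - e k) *m \adj (gs s k) *m (1%:M + H) *m e k = 0].
    case: (leqP k N) => kN; last by exists 0.
    have [|H HP] := @big_cell K _ (e k) (gs s k) (ee _ _ _ _); last by exists H.
    rewrite unitmxE unitfE; have := Ss (inord k) isT.
    by rewrite inordK.
  pose H k := sval (cid (exH k)); have HP k : (k <= N)%N -> [/\ e k *m H k = 0, H k *m e k = H k,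
      (1%:M - e k) *m (1%:M - H k) *m gs s k *m e k = 0 &
      (1%:M - e k) *m \adj (gs s k) *m (1%:M + H k) *m e k = 0] := svalP (cid (exH k)).
  apply: (mem_image (H := H)) => k kN; first by have [] := HP k kN.
  rewrite arr_mkRep //; have [_ _ h1 _] := HP _ kN; have [_ _ _ h2] := HP _ (ltnW kN).
  set P := (1%:M - e k.+1) *m (1%:M - H k.+1) *m gs s k.+1.
  set X := \adj (gs s k) *m (1%:M + H k) *m e k.
  have PE : P = P *m (1%:M - e k.+1) by rewrite mulmxBr mulmx1 h1 subr0.
  have XE : X = e k *m X.
    have : (1%:M - e k) *m X = 0 by rewrite /X !mulmxA.
    by rewrite mulmxBl mul1mx => /eqP; rewrite subr_eq0 => /eqP.
  transitivity ((\det (g k))^-1 *: (P *m (B k *m X))).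
    rewrite /P /X -!(scalemxAl, scalemxAr) !mulmxA; by [].
  clearbody P X; rewrite PE XE.
  have -> : P *m (1%:M - e k.+1) *m (B k *m (e k *m X)) =
      P *m ((1%:M - e k.+1) *m B k *m e k *m X) by rewrite !mulmxA.
  by rewrite eBe0 // mul0mx mulmx0 scaler0.
by rewrite -A1 qE q0 horner0.
Qed.

End Cover.

(** * Injectivity of the differential *)

Section StratumDimension.
Variables (K : fieldType) (N : nat) (d : 'I_N.+1 -> nat).
Local Notation dl k := (dn d k).

(** Up to [p] the quotient dimension is the rank of the composite to [N], which cannot decrease with
    [k]; from [p] on, [v k] is the dimension of an image of V_p, which cannot increase and ends at
    0. *)
Record admissible (p : nat) (v : nat -> nat) : Prop := Admissible {
  adm_dl : forall k, (k <= N)%N -> (v k <= dl k)%N;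
  adm_N : v N = 0%N;
  adm_decr : forall k, (p <= k < N)%N -> (v k.+1 <= v k)%N;
  adm_incr : forall k, (k < p)%N -> (dl k - v k <= dl k.+1 - v k.+1)%N }.

Variables (p : nat) (v : nat -> nat).
Hypothesis pN : (p <= N)%N.
Hypothesis dmin : forall k, (k <= N)%N -> (dl p <= dl k)%N.
Hypothesis adm : admissible p v.
Local Notation e k := (pid_mx (v k) : 'M[K]_(dl k)).
Local Notation u k := (dl k - v k)%N.
Let vd := adm_dl adm.

Lemma adm_v_mono s t : (p <= s)%N -> (s <= t)%N -> (t <= N)%N -> (v t <= v s)%N.
Proof.
move=> ps; elim: t => [|t IH]; first by rewrite leqn0 => /eqP->.
rewrite leq_eqVlt => /predU1P[->//|]; rewrite ltnS => st tN.
by apply: leq_trans (IH st (ltnW tN)); apply: (adm_decr adm); rewrite (leq_trans ps st).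
Qed.

Lemma adm_u_mono s t : (s <= t)%N -> (t <= p)%N -> (u s <= u t)%N.
Proof.
elim: t => [|t IH]; first by rewrite leqn0 => /eqP->.
rewrite leq_eqVlt => /predU1P[->//|]; rewrite ltnS => st tp.
by apply: leq_trans (IH st (ltnW tp)) _; exact: (adm_incr adm).
Qed.

Lemma adm_u_min k : (p <= k)%N -> (k <= N)%N -> (u p <= u k)%N.
Proof. by move=> pk kN; have := adm_v_mono (leqnn p) pk kN; have := dmin kN; lia. Qed.

Lemma adm_v_min k : (k <= p)%N -> (v p <= v k)%N.
Proof.
move=> kp; have := adm_u_mono kp (leqnn p); have := dmin (leq_trans kp pN).
by have := vd pN; have := vd (leq_trans kp pN); lia.
Qed.

Definition B0 k : 'M[K]_(dl k.+1, dl k) := bd_mx K (dl k.+1) (dl k) (v k.+1) (v k).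

Lemma rank_cmp_B0 s t : (s <= t)%N -> (t <= N)%N -> (s == p) || (t == p) ->
  (v t + u s <= \rank (cmp B0 s t))%N.
Proof.
move=> st tN sp; apply: rank_cmp_bd => // k /andP[sk kt].
- exact: vd (leq_trans kt tN).
- case/orP: sp => /eqP E; subst; first by apply: adm_u_min; rewrite // (leq_trans kt).
  exact: adm_u_mono.
- case/orP: sp => /eqP E; subst; first exact: adm_v_mono.
  exact: adm_v_min.
Qed.

(** The derivative of [phi] in direction [t] at the point with [H = 0] and [B = B0]. *)
Definition tangent (t : 'I_(npar d v) -> K) k : 'M[K]_(dl k.+1, dl k) :=
  tB t k + tH t k.+1 *m B0 k - B0 k *m tH t k.

(* A tangent vector killed by the differential is a morphism [H] from the subrepresentation
   to the quotient, and there is none: it vanishes at [N], hence at [p], hence everywhere. *)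
Lemma tangent_inj t : (forall k, (k < N)%N -> tangent t k = 0) -> t =1 fun=> 0.
Proof.
move=> T0; pose H := tH t.
have eH0 k : (k <= N)%N -> e k *m H k = 0 by move=> kN; exact: eH.
have HeH k : (k <= N)%N -> H k *m e k = H k by move=> kN; exact: He.
have e'H k : (k <= N)%N -> (1%:M - e k) *m H k = H k.
  by move=> kN; rewrite mulmxBl mul1mx eH0 // subr0.
have comm k : e k.+1 *m B0 k = B0 k *m e k by exact: bd_mx_comm.
(* The corner from subspace to quotient kills the [tB] part and leaves the condition for a
   morphism. *)
have inter k : (k < N)%N -> H k.+1 *m B0 k = B0 k *m H k.
  move=> kN; have kN' := ltnW kN.
  have := congr1 (fun X => (1%:M - e k.+1) *m X *m e k) (T0 k kN).
  rewrite /= mulmx0 mul0mx /tangent mulmxBr mulmxDr mulmxBl mulmxDl eBe // add0r.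
  rewrite -/(H k.+1) -/(H k) !mulmxA e'H // -[_ *m B0 k *m e k]mulmxA -comm mulmxA HeH //.
  have -> : (1%:M - e k.+1) *m B0 k = B0 k *m (1%:M - e k).
    by rewrite mulmxBl mulmxBr mul1mx mulmx1 comm.
  rewrite -[B0 k *m _ *m H k]mulmxA e'H // -mulmxA HeH // => /eqP.
  by rewrite subr_eq0 => /eqP.
have interc s k : (s <= k)%N -> (k <= N)%N -> H k *m cmp B0 s k = cmp B0 s k *m H s.
  elim: k => [|k IH]; first by case: s => // _ _; rewrite cmpp mulmx1 mul1mx.
  rewrite leq_eqVlt => /predU1P[->|sk] kN; first by rewrite cmpp mulmx1 mul1mx.
  by rewrite cmpS // mulmxA inter // -!mulmxA IH // ltnW.
have HN : H N = 0.
  by rewrite -HeH // (adm_N adm) (_ : pid_mx 0 = 0) ?mulmx0 // pid_mx_0.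
(* Where the quotient part of the composite is injective, vanishing at the target gives vanishing at
   the source. *)
have left0 s k : (s <= k)%N -> (k <= N)%N -> (forall j, (s <= j <= k)%N -> (u s <= u j)%N) ->
    H k = 0 -> H s = 0.
  move=> sk kN us Hk0; have [|L LE] := @cmp_bd_linv K (fun k => dl k) v s k sk _ us.
    by move=> j /andP[_ jk]; exact: vd (leq_trans jk kN).
  have := interc s k sk kN; rewrite Hk0 mul0mx => E.
  rewrite -(e'H s (leq_trans sk kN)) -LE -!mulmxA e'H ?(leq_trans sk) //.
  by rewrite -E mulmx0.
have Hp0 : H p = 0.
  apply: (left0 p N) => // j /andP[pj jN]; exact: adm_u_min.
have H0 k : (k <= N)%N -> H k = 0.
  move=> kN; case: (leqP k p) => kp.
    by apply: (left0 k p) => // j /andP[kj jp]; exact: adm_u_mono.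
  (* After [p] the subspaces are images of the one at [p], so vanishing propagates forwards. *)
  have := interc p k (ltnW kp) kN; rewrite Hp0 mulmx0 => E.
  have RE : cmp B0 p k *m _ = _ :=
    @cmp_bd_rinv K (fun k => dl k) v p k (ltnW kp) _ _.
  by rewrite -HeH // -RE ?mulmxA ?E ?mul0mx // => j /andP[pj jk];
    [exact: vd (leq_trans jk kN) | exact: adm_v_mono].
have B00 k : (k < N)%N -> tB t k = 0.
  move=> kN; rewrite -[RHS](T0 k kN) /tangent -/(H k) -/(H k.+1) !H0 ?(ltnW kN) //.
  by rewrite mul0mx mulmx0 addr0 subr0.
move=> j; have jP := enum_valP j; have : enum_val j = enum_val j by [].
case: {-1}(enum_val j) => [[[c k] a] b] jE; rewrite inE jE in jP.
have -> : t j = get t c k a b.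
  rewrite /get (big_pred1 j) // => l; rewrite !inord_val -jE.
  by apply/eqP/eqP => [/enum_val_inj|->].
case: c jE jP => jE /=.
  move=> /and3P[_ ak bk]; have bk' : (b < dl k)%N by rewrite (leq_trans bk) // vd // -ltnS.
  have := congr1 (fun M : 'M_(dl k) => M (Ordinal ak) (Ordinal bk')) (H0 k (ltn_ord k)).
  by rewrite !mxE.
move=> /and4P[kN ak bk _].
have := congr1 (fun M : 'M_(dl k.+1, dl k) => M (Ordinal ak) (Ordinal bk)) (B00 k kN).
by rewrite !mxE.
Qed.

End StratumDimension.

(** * Dimension of a stratum *)

Section StratumHasDim.
Variables (K : fieldType) (N : nat) (d : 'I_N.+1 -> nat).
Hypothesis Kinf : forall s : seq K, exists x, x \notin s.
Local Notation dl k := (dn d k).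
Local Notation coord := (@repcoord K N d).
Variables (p : nat) (v : nat -> nat).
Hypothesis pN : (p <= N)%N.
Hypothesis dmin : forall k, (k <= N)%N -> (dl p <= dl k)%N.
Hypothesis adm : admissible d p v.
Local Notation B0 := (@B0 K N d v).
Local Notation n := (npar d v).

Lemma get_comb (t : 'I_n -> K) c k a b :
  get t c k a b = \sum_j t j * get (fun l => (l == j)%:R) c k a b.
Proof.
rewrite /get; under [RHS]eq_bigr do rewrite mulr_sumr.
rewrite exchange_big; apply: eq_bigr => l _ /=.
by rewrite (bigD1 l) //= eqxx mulr1 big1 ?addr0 // => j /negbTE; rewrite eq_sym => ->; rewrite mulr0.
Qed.

Lemma tB_comb (t : 'I_n -> K) k :
  tB t k = \sum_l t l *: tB (fun m => (m == l)%:R) k.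
Proof.
apply/matrixP => a b; rewrite mxE get_comb summxE.
by apply: eq_bigr => l _; rewrite !mxE.
Qed.

Lemma tH_comb (t : 'I_n -> K) k :
  tH t k = \sum_l t l *: tH (fun m => (m == l)%:R) k.
Proof.
apply/matrixP => a b; rewrite mxE get_comb summxE.
by apply: eq_bigr => l _; rewrite !mxE.
Qed.

Lemma tangent_comb (t : 'I_n -> K) k i j :
  tangent t k i j = \sum_l t l * tangent (fun m => (m == l)%:R) k i j.
Proof.
have -> : tangent t k = \sum_l t l *: tangent (fun m => (m == l)%:R) k.
  rewrite {1}/tangent (tB_comb t) (tH_comb t k) (tH_comb t k.+1) mulmx_suml mulmx_sumr.
  rewrite -big_split -sumrB /=; apply: eq_bigr => l _.
  by rewrite -scalemxAl -scalemxAr -scalerDr -scalerBr.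
by rewrite summxE; apply: eq_bigr => l _; rewrite mxE.
Qed.

Let t0 : 'I_n -> K := mkpar (fun _ => 0) B0.

Lemma curve_tH (t : 'I_n -> K) s k : (k <= N)%N ->
  tH (fun j => t0 j + s * t j) k = s *: tH t k.
Proof.
move=> kN; have h0 : tH t0 k = 0 by rewrite /t0 tH_mk ?mulmx0 ?mul0mx.
apply/matrixP => a b; have := congr1 (fun M : 'M_(dl k) => M a b) h0; rewrite !mxE => E.
by rewrite /get big_split /= [X in X + _]E add0r mulr_sumr.
Qed.

Lemma curve_tB (t : 'I_n -> K) s k : (k < N)%N ->
  tB (fun j => t0 j + s * t j) k = B0 k + s *: tB t k.
Proof.
move=> kN; have h0 : tB t0 k = B0 k.
  by rewrite /t0 tB_mk // -mulmxA -bd_mx_comm mulmxA mulmxBl mul1mx ee subrr mul0mx.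
apply/matrixP => a b; have := congr1 (fun M : 'M_(dl k.+1, dl k) => M a b) h0.
rewrite [LHS]mxE => E; rewrite [LHS]mxE [RHS]mxE [X in _ = _ + X]mxE [X in _ = _ + _ * X]mxE.
by rewrite -E /get big_split /= mulr_sumr.
Qed.

Lemma curve_expansion m m' (H' : 'M[K]_m') (H : 'M[K]_m) (X B : 'M[K]_(m', m)) s :
  (1%:M + s *: H') *m (X + s *: B) *m (1%:M - s *: H) =
  X + s *: (B + H' *m X - X *m H) +
    s ^+ 2 *: (H' *m B - H' *m X *m H - B *m H - s *: (H' *m B *m H)).
Proof.
rewrite !(mulmxDl, mulmxDr, mulmxN, mul1mx, mulmx1) -!(scalemxAl, scalemxAr).
move: (H' *m X) (H' *m B) (X *m H) (B *m H) (H' *m X *m H) (H' *m B *m H).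
by move=> a1 a2 a3 a4 a5 a6; apply/matrixP => x y; rewrite !mxE; ring.
Qed.

Lemma has_dim_stratum : has_dim coord (@stratum K N d v) n.
Proof.
pose phi0 t := phi (fun j => t0 j + t j : K).
have imE : image phi0 = image (@phi K N d v).
  apply/funext => A; apply/propext; split=> -[t ->]; first by exists (fun j => t0 j + t j).
  by exists (fun j => t j - t0 j); congr phi; apply/funext => j; rewrite addrC subrK.
rewrite /stratum -imE.
pose T (t : 'I_n -> K) (c : RepCoord K d) := tangent t (tag c) (tagged c).1 (tagged c).2.
have T_comb t c : T t c = \sum_l t l * T (fun m => (m == l)%:R) c by exact: tangent_comb.
pose J : 'M[K]_(n, #|{: RepCoord K d}|) :=
  \matrix_(j, c) T (fun m => (m == j)%:R) (enum_val c).
have JE j c : J j c = T (fun m => (m == j)%:R) (enum_val c) by rewrite mxE.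
have rJ : row_free J.
  rewrite -kermx_eq0; apply/rowV0P => w /sub_kermxP wJ.
  have T0 k : (k < N)%N -> tangent (fun j => w 0 j) k = 0.
    move=> kN; apply/matrixP => a b; rewrite tangent_comb [RHS]mxE.
    have := congr1 (fun M : 'rV_#|{: RepCoord K d}| => M 0 (enum_rank (@rcoord K N d (Ordinal kN) a b))) wJ.
    rewrite mxE [RHS]mxE => E; rewrite -[RHS]E; apply: eq_bigr => j _.
    by rewrite JE enum_rankK.
  by apply/rowP => j; rewrite mxE (tangent_inj pN dmin adm T0).
(* The Jacobian has independent rows; a right inverse combines the coordinates into functions [f]
   whose derivative along the parametrisation is the identity. *)
pose L := pinvmx J; have JL : J *m L = 1%:M by exact: mulmxVp.
pose A0 : Rep K d := mkRep B0.
pose f (j : 'I_n) (A : Rep K d) : K :=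
  \sum_(c < #|{: RepCoord K d}|) (repcoord (enum_val c) A - repcoord (enum_val c) A0) * L c j.
apply: (has_dim_image Kinf (f := f)).
- move=> c; have := @polyfun_comp K _ _ _ _ (@acoord K n) (@acoord K n)
    (fun t j => t0 j + t j) _ _ (@polymap_phi K N d v c); apply=> j.
  by apply: pf_add; [exact: pf_const | exact: (pf_coord _ j)].
- move=> j; apply: polyfun_sum => c _; apply: pf_mul; last exact: pf_const.
  by apply: polyfun_sub; [exact: pf_coord | exact: pf_const].
move=> t; pose Q1 k := tH t k.+1 *m tB t k - tH t k.+1 *m B0 k *m tH t k - tB t k *m tH t k.
pose Q2 k := tH t k.+1 *m tB t k *m tH t k.
pose q (c : RepCoord K d) : {poly K} := (Q1 (tag c) (tagged c).1 (tagged c).2)%:P -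
  (Q2 (tag c) (tagged c).1 (tagged c).2)%:P * 'X : {poly K}.
exists (fun j => \sum_(c < #|{: RepCoord K d}|) q (enum_val c : RepCoord K d) * (L c j)%:P) => s j.
have phiE (c : RepCoord K d) : repcoord c (phi0 (fun l => s * t l)) - repcoord c A0 =
    s * T t c + s ^+ 2 * (q c).[s].
  case: c => i [a b]; have [iN iN'] := (ltn_ord i, ltnW (ltn_ord i)).
  rewrite /T /repcoord /phi0 /phi /A0 /mkRep /= !curve_tH // curve_tB //.
  have -> : (1%:M + s *: tH t i.+1) *m (B0 i + s *: tB t i) *m (1%:M - s *: tH t i) =
     B0 i + s *: tangent t i + s ^+ 2 *: (Q1 i - s *: Q2 i).
    rewrite /tangent /Q1 /Q2; exact: curve_expansion.
  by rewrite /q !hornerE !mxE /=; ring.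
rewrite /f; under eq_bigr do rewrite phiE mulrDl -(mulrA s (T _ _)) -(mulrA (s ^+ 2)).
rewrite big_split /= -!mulr_sumr; congr (_ * _ + _ * _); last first.
  rewrite horner_sum.
  by apply: eq_bigr => c _; rewrite hornerM hornerC.
have := congr1 (fun M : 'M_n => \sum_l t l * M l j) JL; rewrite /=.
rewrite [X in _ = X -> _](bigD1 j) //= mxE eqxx mulr1 [X in _ = _ + X]big1 => [|l lj]; last first.
  by rewrite mxE (negbTE lj) mulr0.
rewrite addr0 => <-; under [RHS]eq_bigr do rewrite mxE mulr_sumr.
rewrite exchange_big; apply: eq_bigr => c _ /=; rewrite T_comb mulr_suml.
by apply: eq_bigr => l _; rewrite JE mulrA.
Qed.

End StratumHasDim.

(** * Strata covering the rank locus *)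

Section SigmaCover.
Variables (K : fieldType) (N : nat) (d : 'I_N.+1 -> nat).
Hypothesis Kinf : forall s : seq K, exists x, x \notin s.
Local Notation dl k := (dn d k).

(** On the image the composite is conjugate to a block triangular one; the resulting rank bound is a
    closed condition, hence passes to the closure. *)
Lemma stratum_rank v s t : (forall k, (k <= N)%N -> (v k <= dl k)%N) ->
  (s <= t)%N -> (t <= N)%N ->
  zsubset (@stratum K N d v) (fun A => (\rank (cmp (arr A) s t) <= v t + (dl s - v s))%N).
Proof.
move=> vd st tN; apply: zclosure_min; first exact: rank_closed.
move=> _ [x ->]; pose H := tH x.
rewrite (@cmp_ext _ _ _ (fun k => (1%:M + H k.+1) *m tB x k *m (1%:M - H k))) //; last first.
  by move=> k /andP[_ kt]; rewrite arr_mkRep // (leq_trans kt).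
have HH0 k : (k <= N)%N -> H k *m H k = 0 by exact: HH.
have E : cmp (fun k => (1%:M + H k.+1) *m tB x k *m (1%:M - H k)) s t =
    (1%:M + H t) *m cmp (tB x) s t *m (1%:M - H s).
  rewrite -cmp_conj // => [|k /andP[_ kt]]; last by rewrite HH0 // ltnW // (leq_trans kt).
  rewrite -mulmxA mulmxBr mulmx1 mulmxDl mul1mx HH0 ?(leq_trans st) //.
  by rewrite addr0 addrK mulmx1.
rewrite E; apply: leq_trans (mxrankM_maxl _ _) _; apply: leq_trans (mxrankM_maxr _ _) _.
have := @rank_cmp_upper K (fun k => dl k) (tB x) (fun k => pid_mx (v k)) s t st.
move=> H1; apply: leq_trans (H1 _ _) _ => [k|k /andP[_ kt]|]; first exact: ee.
  by apply: eBe; rewrite (leq_trans kt).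
by rewrite rank_pid_mx ?rank_copid_mx ?vd // (leq_trans st).
Qed.

(** The point at which [rank_cmp_B0] shows the bounds of [stratum_rank] to be attained. *)
Lemma stratum_B0 v : @stratum K N d v (mkRep (@B0 K N d v)).
Proof.
apply: zclosure_sub; apply: (mem_image (H := fun _ => 0)) => k kN.
  by rewrite mulmx0 mul0mx.
rewrite arr_mkRep // subr0 addr0 mul1mx mulmx1 -mulmxA -bd_mx_comm mulmxA.
by rewrite mulmxBl mul1mx ee subrr mul0mx.
Qed.

Lemma stratum_Sigma p v r : admissible d p v -> (dl 0 - v 0%N <= r)%N ->
  zsubset (@stratum K N d v) (@Sigma K N d r).
Proof.
move=> adm vr A /(stratum_rank (adm_dl adm) (leq0n N) (leqnn N)).
by rewrite (adm_N adm) add0n /Sigma prodRep_cmp => /leq_trans; apply.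
Qed.

Lemma stratum_rank_le v v' s t : (forall k, (k <= N)%N -> (v' k <= dl k)%N) ->
  (s <= t)%N -> (t <= N)%N ->
  zsubset (@stratum K N d v) (@stratum K N d v') ->
  (\rank (cmp (@B0 K N d v) s t) <= v' t + (dl s - v' s))%N.
Proof.
move=> vd' st tN sub; have := stratum_rank vd' st tN (sub _ (@stratum_B0 v)).
rewrite (@cmp_ext _ _ _ (@B0 K N d v)) // => k /andP[_ kt].
by rewrite arr_mkRep // (leq_trans kt).
Qed.

(** Makes the dimension vectors range over a finite type, as needed for a finite cover. *)
Definition bnd := (\sum_(k < N.+1) dl k).+1.

Definition vnat (w : {ffun 'I_N.+1 -> 'I_bnd}) (k : nat) : nat := w (inord k).

Lemma Sigma_cover p r A : (p <= N)%N -> @Sigma K N d r A ->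
  exists w, [/\ admissible d p (vnat w), (dl 0 - vnat w 0 <= r)%N & stratum (vnat w) A].
Proof.
move=> pN rA; pose P k := cmp (arr A) k N.
have PS k : (k < N)%N -> P k = P k.+1 *m arr A k.
  by move=> kN; rewrite /P (cmp_cat _ (leqnSn k) kN) cmpS // cmpp mulmx1.
(* The kernels and images of the overview as row spaces, hence the transposes. *)
pose S k : 'M[K]_(dl k) := if (k <= p)%N then kermx (P k)^T
  else <<kermx (P p)^T *m (cmp (arr A) p k)^T>>%MS.
have Sle k : (k <= p)%N -> S k = kermx (P k)^T by rewrite /S => ->.
have Sge k : (p <= k)%N -> (S k :=: kermx (P p)^T *m (cmp (arr A) p k)^T)%MS.
  rewrite leq_eqVlt => /predU1P[<-|pk]; first by rewrite Sle // cmpp trmx1 mulmx1.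
  by rewrite /S leqNgt pk; exact: genmxE.
have rank_le k : (k <= p)%N -> (dl k - \rank (S k) = \rank (P k))%N.
  by move=> kp; rewrite Sle // mxrank_ker mxrank_tr subKn // rank_leq_col.
have Sarr k : (k < N)%N -> (S k *m (arr A k)^T <= S k.+1)%MS.
  move=> kN; case: (ltnP k p) => kp.
    rewrite (Sle k (ltnW kp)) (Sle k.+1 kp); apply/sub_kermxP.
    by rewrite -mulmxA -trmx_mul -PS // mulmx_ker.
  rewrite (Sge k.+1 (leqW kp)) cmpS // trmx_mul mulmxA.
  by apply: submxMr; rewrite (Sge k kp).
have Sbd k : (k <= N)%N -> (\rank (S k) < bnd)%N.
  move=> kN; rewrite ltnS (leq_trans (rank_leq_row _)) //.
  by rewrite (bigD1 (inord k)) //= inordK // leq_addr.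
pose w : {ffun 'I_N.+1 -> 'I_bnd} := [ffun k : 'I_N.+1 => inord (\rank (S k))].
have wE k : (k <= N)%N -> vnat w k = \rank (S k).
  by move=> kN; rewrite /vnat ffunE inordK; rewrite ?inordK // Sbd.
exists w; split.
- split=> [k kN||k /andP[pk kN]|k kp].
  + by rewrite wE // rank_leq_row.
  + rewrite wE //; apply/eqP; rewrite mxrank_eq0 -submx0 (Sge N pN) submx0; apply/eqP.
    exact: mulmx_ker.
  + rewrite !wE // ?(ltnW kN) // (Sge k pk) (Sge k.+1 (leqW pk)) cmpS // trmx_mul mulmxA.
    exact: mxrankM_maxl.
  have kN := leq_trans kp pN.
  by rewrite !wE ?(ltnW kN) // !rank_le ?(ltnW kp) // PS // mxrankM_maxl.
- by rewrite wE // rank_le //; move: rA; rewrite /Sigma prodRep_cmp.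
(* The first rows of [row_ebase] span the row space of [S k], so [g k] sends the standard subspace
   to it. *)
pose g k : 'M[K]_(dl k) := (row_ebase (S k))^T.
have ug k : g k \in unitmx by rewrite unitmx_tr row_ebase_unit.
apply: (stratum_conj Kinf (g := g) (B := fun k => invmx (g k.+1) *m arr A k *m g k)) => k kN //.
  by rewrite !mulmxA mulmxV // mul1mx.
rewrite !wE ?(ltnW kN) //; apply: trmx_inj.
rewrite trmx0 !trmx_mul tr_pid_mx linearB /= trmx1 tr_pid_mx.
set e := pid_mx _; set e' := pid_mx _.
have eg_le m : (m <= N)%N -> ((pid_mx (\rank (S m)) : 'M_(dl m)) *m (g m)^T <= S m)%MS.
  move=> mN; rewrite /g trmxK; apply/submxP; exists (invmx (col_ebase (S m))).
  by rewrite -{4}(mulmx_ebase (S m)) !mulmxA mulVmx ?col_ebase_unit ?mul1mx.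
have le_eg m : (m <= N)%N -> (S m <= (pid_mx (\rank (S m)) : 'M_(dl m)) *m (g m)^T)%MS.
  by move=> mN; rewrite /g trmxK -{1}(mulmx_ebase (S m)) -mulmxA submxMl.
have : (e *m (g k)^T *m (arr A k)^T <= e' *m (g k.+1)^T)%MS.
  apply: submx_trans (le_eg _ kN); apply: submx_trans (Sarr k kN).
  by apply: submxMr; apply: eg_le; exact: ltnW.
case/submxP => Y YE; rewrite !mulmxA YE trmx_inv mulmxA mulmxK ?unitmx_tr ?row_ebase_unit //.
by rewrite -mulmxA mulmxBr mulmx1 pid_mx_id ?rank_leq_row // subrr mulmx0.
Qed.

End SigmaCover.

(** * Codimensions of the strata *)

Lemma bin2_left w x : (w <= x)%N -> (w * x + 'C(x - w, 2) = 'C(x, 2) + 'C(w.+1, 2))%N.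
Proof.
move=> wx; have := double_bin2 x; have := double_bin2 w.+1; have := double_bin2 (x - w).
move: 'C(x, 2) 'C(w.+1, 2) 'C(x - w, 2) => a b c; have : x = (x - w + w)%N by rewrite subnK.
move: (x - w)%N => y ->; nia.
Qed.

Lemma bin2_right w y : ('C(y + w, 2) + w = w * y + 'C(w.+1, 2) + 'C(y, 2))%N.
Proof.
have := double_bin2 (y + w); have := double_bin2 w.+1; have := double_bin2 y.
move: 'C(y, 2) 'C(w.+1, 2) 'C(y + w, 2) => a b c; nia.
Qed.

Section Numerics.
Variables (N : nat) (d : 'I_N.+1 -> nat) (p : 'I_N.+1) (v : nat -> nat).
Local Notation dl k := (dn d k).
Local Notation n := (dl p).
Local Notation u k := (dl k - v k)%N.
Hypothesis dmin : forall k, (k <= N)%N -> (n <= dl k)%N.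
Hypothesis adm : admissible d p v.

Let pN : (p <= N)%N. Proof. by rewrite -ltnS. Qed.

(* The drop of [dim V] at [k > p], and the increase of the quotient dimension after [k < p]. *)
Definition wv (k : nat) : nat :=
  (if k < p then u k.+1 - u k else if k == p then u 0 else v k.-1 - v k)%N.

Definition cost k := (wv k * (dl k - n) + 'C((wv k).+1, 2))%N.

(** One step adds w = u_(m+1) - u_m, and w v_m splits as w (d_m - n) + w (n - u_m); [bin2_left]
    absorbs the second term into the binomials. *)
Lemma sum_left m : (m <= p)%N ->
  (\sum_(0 <= k < m) u k.+1 * v k + 'C(n - u m, 2) =
   \sum_(0 <= k < m) u k * v k + \sum_(0 <= k < m) cost k + 'C(n - u 0, 2))%N.
Proof.
elim: m => [|m IH] mp; first by rewrite !big_geq.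
have {}IH := IH (ltnW mp); rewrite !big_nat_recr //=.
have um := adm_incr adm mp; have up := adm_u_mono adm mp (leqnn p).
have mN := leq_trans (ltnW mp) pN; have vm := adm_dl adm mN; have dm := dmin mN.
have vp := adm_dl adm pN.
have [w wE] : exists w, u m.+1 = (u m + w)%N by exists (u m.+1 - u m)%N; rewrite subnKC.
have E : wv m = w by rewrite /wv mp wE addKn.
have wx : (w <= n - u m)%N by lia.
have := bin2_left wx; rewrite -subnDA /cost E wE.
have : v m = (dl m - n + (n - u m))%N by lia.
move: IH; move: (\sum_(0 <= k < m) _)%N (\sum_(0 <= k < m) _)%N (\sum_(0 <= k < m) _)%N => a b c.
move: {um up vm vp wE wx}(u m) => U IH -> h.
move: (n - U)%N (dl m - n)%N ('C(n - u 0, 2)) IH h => x D z IH h.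
move: ('C(x, 2)) ('C(w.+1, 2)) ('C(n - (U + w), 2)) IH h => *; nia.
Qed.

(** Here w = v_m - v_(m+1) multiplies u_(m+1) = (d_(m+1) - n) + (n - v_(m+1)), and [bin2_right]
    absorbs the second part. *)
Lemma sum_right m : (p <= m)%N -> (m <= N)%N ->
  (\sum_(p <= k < m) u k.+1 * v k + v m * n + 'C(v p, 2) + v p =
   \sum_(p <= k < m) u k.+1 * v k.+1 + \sum_(p <= k < m) cost k.+1 + v p * n +
   'C(v m, 2) + v m)%N.
Proof.
elim: m => [|m IH] pm mN.
  by move: pm; rewrite leqn0 => /eqP p0; rewrite p0 !big_geq //; lia.
move: pm; rewrite leq_eqVlt => /predU1P[<-|pm]; first by rewrite !big_geq //; lia.
rewrite ltnS in pm; have {}IH := IH pm (ltnW mN); rewrite !big_nat_recr //=.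
have vm : (v m.+1 <= v m)%N by apply: (adm_decr adm); rewrite pm.
have vd := adm_dl adm mN; have dm := dmin mN; have vp := adm_dl adm pN.
have vle := adm_v_mono adm (leqnn p) pm (ltnW mN).
have [w wE] : exists w, v m = (v m.+1 + w)%N by exists (v m - v m.+1)%N; rewrite subnKC.
have E : wv m.+1 = w.
  rewrite /wv ltnNge (leq_trans pm (leqnSn m)) /= gtn_eqF ?ltnS //.
  by rewrite wE addKn.
have := bin2_right w (v m.+1); rewrite /cost E -wE.
have -> : u m.+1 = (dl m.+1 - n + (n - v m.+1))%N by lia.
have : (n - v m.+1 + v m.+1 = n)%N by lia.
move: IH; move: (\sum_(p <= k < m) _)%N (\sum_(p <= k < m) _)%N (\sum_(p <= k < m) _)%N => a b c.
move: wE; move: (v m) (v m.+1) (v p) (dl m.+1 - n)%N (n - v m.+1)%N n => y' y z D x m'.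
move=> -> IH xE; move: ('C(_, 2)) ('C(_, 2)) ('C(_, 2)) ('C(_, 2)) IH => *; nia.
Qed.

(** The left side counts the entries of the arrows forced to be zero, the first sum on the right the
    parameters of the subspaces; their difference, the codimension, is the cost. *)
Lemma sum_total :
  (\sum_(0 <= k < N) u k.+1 * v k = \sum_(0 <= k < N.+1) u k * v k +
    wcost d (u 0) p (fun i => wv i))%N.
Proof.
have L := sum_left (leqnn p); have R := sum_right pN (leqnn N).
have vp := adm_dl adm pN; rewrite (subKn vp) in L.
rewrite (adm_N adm) mul0n bin0n /= !addn0 in R.
rewrite (@big_cat_nat _ _ _ p) //= [X in _ = (X + _)%N](@big_cat_nat _ _ _ p) //=; last exact: leqW.
rewrite (@big_nat_recl _ _ _ N p) //.
have -> : wcost d (u 0) p (fun i => wv i) =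
    ('C(n - u 0, 2) + (\sum_(0 <= k < p) cost k + \sum_(p <= k < N) cost k.+1))%N.
  have dE i : d i = dl i by rewrite /dn inord_val.
  rewrite /wcost dE; congr (_ + _)%N.
  under eq_bigr do rewrite dE.
  rewrite -(big_mkord (fun k => k != p) cost).
  rewrite (@big_cat_nat _ _ _ p) //=; last exact: leqW.
  congr (_ + _)%N.
    rewrite big_nat_cond [RHS]big_nat_cond; apply: eq_bigl => k.
    by rewrite /= andbT; case: (ltnP k p) => //= kp; rewrite (ltn_eqF kp).
  rewrite big_ltn_cond ?ltnS // eqxx /= big_add1 /= big_nat_cond [RHS]big_nat_cond.
  by apply: eq_bigl => k; rewrite andbT; case: (leqP p k) => //= kp; rewrite gtn_eqF ?ltnS ?andbT.
have n_uv : n = (u p + v p)%N by rewrite subnK.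
have := double_bin2 (v p); move: L R.
rewrite -/(u p); move: (\sum_(0 <= k < p) _)%N (\sum_(0 <= k < p) _)%N (\sum_(0 <= k < p) _)%N.
move: (\sum_(p <= k < N) _)%N (\sum_(p <= k < N) _)%N (\sum_(p <= k < N) _)%N.
move: n_uv ('C(v p, 2)) ('C(_, 2)); move: (u p) (v p) n => a b m -> *; nia.
Qed.

End Numerics.

Lemma card_interval m l n : (n <= m)%N -> (\sum_(a < m) ((l <= a) && (a < n)) = n - l)%N.
Proof.
move=> nm; rewrite -(big_mkord xpredT (fun a => ((l <= a) && (a < n))%N : nat)).
elim: m n nm => [|m IH] n nm; first by rewrite big_geq //; lia.
rewrite big_nat_recr //=; case: (ltnP n m.+1) => nm'.
  by rewrite IH // andbF addn0.
have -> : n = m.+1 by apply/eqP; rewrite eqn_leq nm nm'.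
rewrite andbT big_nat_cond.
rewrite (eq_bigr (fun a => ((l <= a) && (a < m))%N : nat)) => [|a /andP[/andP[_ am] _]].
  by rewrite -big_nat_cond IH //; case: leqP => lm /=; lia.
by rewrite am (leqW am).
Qed.

Section Counting.
Variables (N : nat) (d : 'I_N.+1 -> nat) (v : nat -> nat).
Local Notation dl k := (dn d k).
Local Notation u k := (dl k - v k)%N.
Hypothesis vd : forall k, (k <= N)%N -> (v k <= dl k)%N.

Lemma dn_le_sum k : (k <= N)%N -> (dl k <= \sum_(k < N.+1) dl k)%N.
Proof. by move=> kN; rewrite (bigD1 (inord k)) //= inordK // leq_addr. Qed.

Lemma npar_count : (npar d v + \sum_(0 <= k < N) u k.+1 * v k =
  \sum_(0 <= k < N) dl k.+1 * dl k + \sum_(0 <= k < N.+1) u k * v k)%N.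
Proof.
pose D := (\sum_(k < N.+1) dl k).+1.
have DD k : (k <= N)%N -> (dl k <= D)%N by move=> kN; rewrite leqW // dn_le_sum.
have -> : npar d v = (\sum_(k < N.+1) \sum_(a < D) \sum_(b < D) @par N d v (true, k, a, b) +
    \sum_(k < N.+1) \sum_(a < D) \sum_(b < D) @par N d v (false, k, a, b))%N.
  rewrite -(big_bool _ (fun c => \sum_(k < N.+1) \sum_(a < D) \sum_(b < D) @par N d v (c, k, a, b)))%N.
  rewrite pair_bigA pair_bigA pair_bigA /npar -sum1_card big_mkcond; apply: eq_bigr.
  by move=> [[[c k] a] b] _; rewrite inE; case: (@par N d v _).
have -> : (\sum_(k < N.+1) \sum_(a < D) \sum_(b < D) @par N d v (true, k, a, b) =
    \sum_(0 <= k < N.+1) u k * v k)%N.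
  rewrite big_mkord; apply: eq_bigr => k _; have kN : (k <= N)%N by rewrite -ltnS.
  have -> : (u k * v k = (\sum_(a < D) ((v k <= a) && (a < dl k))) *
      (\sum_(b < D) ((0 <= b) && (b < v k))))%N.
    by rewrite (card_interval (v k) (DD k kN)) (card_interval 0 (leq_trans (vd kN) (DD k kN))) subn0.
  rewrite big_distrl; apply: eq_bigr => a _; rewrite big_distrr; apply: eq_bigr => b _ /=.
  by rewrite andbA -mulnb.
rewrite -addnA [RHS]addnC; congr (_ + _)%N; rewrite big_ord_recr /= [X in (_ + X + _)%N]big1 => [|a _]; last first.
  by apply: big1 => b _; rewrite ltnn.
rewrite addn0 !big_mkord -big_split /=; apply: eq_bigr => k _.
have [kN kN'] := (ltn_ord k, ltnW (ltn_ord k)).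
have -> : (dl k.+1 * dl k = (\sum_(a < D) ((0 <= a) && (a < dl k.+1))) *
    (\sum_(b < D) ((0 <= b) && (b < dl k))))%N.
  by rewrite (card_interval 0 (DD _ kN)) (card_interval 0 (DD _ kN')) !subn0.
have -> : (u k.+1 * v k = (\sum_(a < D) ((v k.+1 <= a) && (a < dl k.+1))) *
    (\sum_(b < D) ((0 <= b) && (b < v k))))%N.
  by rewrite (card_interval _ (DD _ kN)) (card_interval 0 (leq_trans (vd kN') (DD _ kN'))) subn0.
rewrite !big_distrl /= -big_split; apply: eq_bigr => a _ /=.
rewrite !big_distrr -big_split; apply: eq_bigr => b _ /=; rewrite kN /=.
have bv : (b < v k)%N -> (b < dl k)%N by move=> bv; exact: leq_trans bv (vd kN').
case: (ltnP b (v k)) bv => [_ /(_ isT) ->|_ _] /=.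
  by case: (v k.+1 <= a)%N; case: (a < dl k.+1)%N.
by rewrite andbF andbT muln0 addn0 mulnb.
Qed.

End Counting.

Lemma reduce_sum (J : finType) (P : pred J) (w : J -> nat) s :
  (s <= \sum_(i | P i) w i)%N ->
  exists w', (forall i, P i -> (w' i <= w i)%N) /\ (\sum_(i | P i) w' i = s)%N.
Proof.
move: {2}(\sum_(i | P i) w i - s)%N (erefl (\sum_(i | P i) w i - s)%N) => k.
elim: k w => [|k IH] w wk sw; first by exists w; split=> //; lia.
have [i Pi wi] : exists2 i, P i & (0 < w i)%N.
  apply/exists_inP; apply/contraT; rewrite negb_exists_in => /forall_inP w0.
  by move: wk; rewrite big1 // => i Pi; apply/eqP; rewrite -leqn0 leqNgt w0.
pose w1 j := if j == i then (w j).-1 else w j.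
have w1le j : (w1 j <= w j)%N by rewrite /w1; case: eqP => // _; exact: leq_pred.
have E : (\sum_(j | P j) w j = (\sum_(j | P j) w1 j).+1)%N.
  rewrite (bigD1 i) //= [in RHS](bigD1 i) //= {1}/w1 eqxx -addSn prednK //.
  by congr (_ + _)%N; apply: eq_bigr => j /andP[_ /negbTE ji]; rewrite /w1 ji.
have [||w' [w'le w's]] := IH w1; [by move: wk; rewrite E; lia | by move: wk; rewrite E; lia |].
by exists w'; split=> // j Pj; exact: leq_trans (w'le j Pj) (w1le j).
Qed.

(** * From strata to weights and back *)

Section WeightsOfStrata.
Variables (N : nat) (d : 'I_N.+1 -> nat) (p : 'I_N.+1) (r : nat).
Local Notation n := (d p).
Hypothesis rn : (r < n)%N.
Hypothesis dmin : forall i, (n <= d i)%N.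

Let dE (i : 'I_N.+1) : dn d i = d i. Proof. by rewrite /dn inord_val. Qed.

Lemma sum_wv v : admissible d p v -> (\sum_(i < N.+1) wv d p v i = n)%N.
Proof.
move=> adm; have pN : (p <= N)%N by rewrite -ltnS.
rewrite -(big_mkord xpredT (wv d p v)) (@big_cat_nat _ _ _ p) //=; last exact: leqW.
rewrite [X in (_ + X)%N]big_ltn //= {2}/wv ltnn eqxx big_add1 /=.
have L m : (m <= p)%N ->
    (\sum_(0 <= k < m) wv d p v k + (dn d 0 - v 0%N) = dn d m - v m)%N.
  elim: m => [|m IH] mp; first by rewrite big_geq.
  rewrite big_nat_recr //= addnAC IH ?(ltnW mp) // {1}/wv mp subnKC //.
  exact: (adm_incr adm).
have R m : (p <= m)%N -> (m <= N)%N -> (\sum_(p <= k < m) wv d p v k.+1 + v m = v p)%N.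
  elim: m => [|m IH] pm mN; first by rewrite big_geq //; move: pm; rewrite leqn0 => /eqP ->.
  move: pm; rewrite leq_eqVlt => /predU1P[E|pm]; first by rewrite big_geq ?E.
  rewrite ltnS in pm; rewrite big_nat_recr //= -addnA -(IH pm (ltnW mN)); congr (_ + _)%N.
  rewrite /wv ltnNge (leq_trans pm (leqnSn m)) /= gtn_eqF ?ltnS // subnK //.
  by apply: (adm_decr adm); rewrite pm.
have := R N pN (leqnn N); rewrite (adm_N adm) addn0 => ->.
by rewrite addnA L // -dE subnK // (adm_dl adm).
Qed.

Lemma wv_p v : wv d p v p = (dn d 0 - v 0%N)%N.
Proof. by rewrite /wv ltnn eqxx. Qed.

Lemma wcost_mono r1 r2 (w1 w2 : 'I_N.+1 -> nat) : (r2 <= r1)%N ->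
  (forall i, i != p -> (w1 i <= w2 i)%N) ->
  (exists2 i, i != p & (w1 i < w2 i)%N) -> (wcost d r1 p w1 < wcost d r2 p w2)%N.
Proof.
move=> r21 w12 [i ip lt]; rewrite /wcost -addnS leq_add ?leq_bin2l ?leq_sub2l //.
rewrite (bigD1 i) //= [X in (_ < X)%N](bigD1 i) //= -addSn leq_add //; last first.
  by apply: leq_sum => j /andP[jp _]; rewrite leq_add ?leq_mul ?leq_bin2l ?ltnS ?w12.
apply: leq_trans (_ : w1 i * (d i - n) + 'C((w1 i).+2, 2) <= _)%N.
  by rewrite -addnS leq_add // [X in (_ < X)%N]binS bin1; lia.
by rewrite leq_add ?leq_mul ?leq_bin2l ?ltnS // ltnW.
Qed.

Definition wof (f : 'I_N.+1 -> nat) : {ffun 'I_N.+1 -> 'I_n.+1} := [ffun i => inord (f i)].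

Lemma wofE f : (\sum_i f i = n)%N -> wnat (wof f) =1 f.
Proof.
move=> fn i; rewrite /wnat ffunE inordK // ltnS -fn (bigD1 i) //= leq_addr //.
Qed.

Lemma wof_weights f : (\sum_i f i = n)%N -> f p = r -> wof f \in weights d r p.
Proof.
move=> fn fp; rewrite inE; have E := wofE fn.
rewrite -[val (wof f p)]/(wnat _ p) E fp eqxx /=; apply/eqP; rewrite -[RHS]fn.
by apply: eq_bigr => i _; exact: E.
Qed.

Lemma eq_wcost r' (w w' : 'I_N.+1 -> nat) : w =1 w' -> wcost d r' p w = wcost d r' p w'.
Proof. by move=> ww; congr (wcost _ _ _ _); apply/funext. Qed.

(** A stratum with total rank r' < r carries weight n - r' away from [p]. Lowering this to n - r
    gives an element of [weights] of strictly smaller cost, so only strata with r' = r can attain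
    [C]. *)
Lemma wcost_strata_ge C v : (forall w, w \in weights d r p -> (C <= wcost d r p (wnat w))%N) ->
  admissible d p v -> (dn d 0 - v 0%N <= r)%N ->
  (C <= wcost d (dn d 0 - v 0%N) p (fun i => wv d p v i))%N /\
  (C = wcost d (dn d 0 - v 0%N) p (fun i => wv d p v i) -> dn d 0 - v 0%N = r)%N.
Proof.
move=> Cmin adm u0r; have sw := sum_wv adm; set r' := (dn d 0 - _)%N in u0r *.
have [r'r|r'r] := eqVneq r' r.
  split=> //; rewrite r'r -(eq_wcost _ (wofE sw)); apply: Cmin; apply: wof_weights => //.
  by rewrite /= wv_p -r'r.
have {r'r} ltr : (r' < r)%N by rewrite ltn_neqAle r'r u0r.
have : (C < wcost d r' p (fun i => wv d p v i))%N; last first.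
  by move=> lt; split; [exact: ltnW | move=> E; rewrite -E ltnn in lt].
have sw' : (\sum_(i < N.+1 | i != p) wv d p v i = n - r')%N.
  by rewrite -sw [in RHS](bigD1 p) //= wv_p addKn.
have [|w' [w'le w's]] := @reduce_sum _ (fun i => i != p) (fun i : 'I_N.+1 => wv d p v i) (n - r)%N.
  by rewrite sw'; lia.
pose f i := if i == p then r else w' i.
have fn : (\sum_i f i = n)%N.
  rewrite (bigD1 p) //= {1}/f eqxx (eq_bigr w') ?w's ?subnKC ?(ltnW rn) // => i /negbTE ip.
  by rewrite /f ip.
have fp : f p = r by rewrite /f eqxx.
apply: leq_ltn_trans (Cmin _ (wof_weights fn fp)) _; rewrite (eq_wcost _ (wofE fn)).
apply: wcost_mono => [|i ip|]; first exact: ltnW.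
  by rewrite /f (negbTE ip) w'le.
apply/exists_inP; apply/contraT; rewrite negb_exists_in => /forall_inP H.
have : (\sum_(i < N.+1 | i != p) wv d p v i <= \sum_(i | i != p) w' i)%N.
  by apply: leq_sum => i ip; have := H i ip; rewrite /f (negbTE ip) -leqNgt.
by rewrite sw' w's; lia.
Qed.

End WeightsOfStrata.

Section StratumOfWeights.
Variables (N : nat) (d : 'I_N.+1 -> nat) (p : 'I_N.+1) (f : nat -> nat).
Local Notation dl k := (dn d k).
Local Notation n := (dl p).
Hypothesis dmin : forall k, (k <= N)%N -> (n <= dl k)%N.
Hypothesis fn : (\sum_(0 <= k < N.+1) f k = n)%N.

Let pN : (p <= N)%N. Proof. by rewrite -ltnS. Qed.

(** Inverse of [wv]: the drops after [p] are summed down from 0 at [N], and the quotient dimensions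
    before [p] are summed up from [f p]. *)
Definition vof k : nat :=
  (if p <= k then \sum_(k.+1 <= j < N.+1) f j else dl k - (f p + \sum_(0 <= j < k) f j))%N.

Lemma sum_f_split k : (k <= N)%N ->
  (n = \sum_(0 <= j < k) f j + f k + \sum_(k.+1 <= j < N.+1) f j)%N.
Proof.
move=> kN; rewrite -fn (@big_cat_nat _ _ _ k) //=; last exact: leqW.
by rewrite [X in (_ + X)%N]big_ltn // addnA.
Qed.

Lemma vof_ge k : (p <= k)%N -> vof k = (\sum_(k.+1 <= j < N.+1) f j)%N.
Proof. by rewrite /vof => ->. Qed.

Lemma sub_vof k : (k <= p)%N -> (dl k - vof k = f p + \sum_(0 <= j < k) f j)%N.
Proof.
rewrite leq_eqVlt /vof => /predU1P[->|kp].
  by rewrite leqnn; have := sum_f_split pN; lia.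
rewrite (leqNgt p) kp /= subKn //; apply: leq_trans (dmin (ltnW (leq_trans kp pN))).
rewrite (sum_f_split pN) (@big_cat_nat _ _ _ k 0 p) //=; last exact: ltnW.
by lia.
Qed.

Lemma vof_admissible : admissible d p vof.
Proof.
split=> [k kN||k /andP[pk kN]|k kp].
- case: (leqP p k) => pk; last by rewrite /vof (leqNgt p) pk /= leq_subr.
  rewrite vof_ge //; apply: leq_trans (dmin kN); rewrite (sum_f_split kN).
  exact: leq_addl.
- by rewrite vof_ge // big_geq.
- by rewrite !vof_ge ?leqW // [X in (_ <= X)%N]big_ltn ?leq_addl.
by rewrite !sub_vof ?(ltnW kp) // big_nat_recr //= addnA leq_addr.
Qed.

Lemma wv_vof k : (k <= N)%N -> wv d p vof k = f k.
Proof.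
move=> kN; rewrite /wv; case: ltngtP => [kp|pk|->].
- by rewrite !sub_vof ?(ltnW kp) // big_nat_recr //= addnA addKn.
- case: k pk kN => // k pk kN.
  by rewrite !vof_ge ?leqW // [X in (X - _)%N]big_ltn ?addnK.
by rewrite sub_vof // big_geq ?addn0.
Qed.

End StratumOfWeights.

(** Recover [v] downwards from [v N = 0] as far as [p], and below [p] upwards from the quotient
    dimension at 0, which is [wv] at [p]. *)
Lemma wv_inj N (d : 'I_N.+1 -> nat) (p : 'I_N.+1) v v' :
  admissible d p v -> admissible d p v' ->
  (forall k, (k <= N)%N -> wv d p v k = wv d p v' k) ->
  forall k, (k <= N)%N -> v k = v' k.
Proof.
move=> adm adm' E k kN; have pN : (p <= N)%N by rewrite -ltnS.
case: (leqP p k) => pk.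
  have [m mE] : exists m, m = (N - k)%N by exists (N - k)%N.
  elim: m k kN pk mE => [|m IH] k kN pk mE.
    have -> : k = N by lia.
    by rewrite (adm_N adm) (adm_N adm').
  have kN' : (k < N)%N by lia.
  have := E k.+1 kN'; rewrite /wv ltnNge leqW //= gtn_eqF ?ltnS //=.
  have pkN : (p <= k < N)%N by rewrite pk.
  have := IH k.+1 kN' (leqW pk); have := adm_decr adm pkN; have := adm_decr adm' pkN.
  by lia.
have U m : (m <= p)%N -> (dn d m - v m = dn d m - v' m)%N.
  elim: m => [|m IH] mp.
    by have := E p pN; rewrite /wv ltnn eqxx.
  have := E m (ltnW (leq_trans mp pN)); rewrite /wv mp.
  have := IH (ltnW mp); have := adm_incr adm mp; have := adm_incr adm' mp.
  by lia.
have := U k (ltnW pk); have := adm_dl adm kN; have := adm_dl adm' kN; lia.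
Qed.

Section Dimensions.
Variables (K : fieldType) (T I : Type) (coord : I -> T -> K).

Lemma zchain_sub X Y m : zsubset X Y -> zchain coord X m -> zchain coord Y m.
Proof.
move=> XY [Z [H1 H2]]; exists Z; split=> // k kn; have [irr sub] := H1 k kn.
by split=> // x /sub/XY.
Qed.

Lemma zchain_le X m k : (k <= m)%N -> zchain coord X m -> zchain coord X k.
Proof.
move=> km [Z [H1 H2]]; exists Z.
by split=> j jk; [exact: H1 (leq_trans jk km) | exact: H2 (leq_trans jk km)].
Qed.

Lemma has_dim_ext X Y m : eqsetP X Y -> has_dim coord X m -> has_dim coord Y m.
Proof.
move=> XY [c1 c2]; split; first by apply: zchain_sub c1 => x /XY.
by move=> c3; apply: c2; apply: zchain_sub c3 => x /XY.
Qed.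

Lemma has_dim_uniq X m k : has_dim coord X m -> has_dim coord X k -> m = k.
Proof.
move=> [m1 m2] [k1 k2]; case: (ltngtP m k) => // lt.
  by case: m2; exact: zchain_le k1.
by case: k2; exact: zchain_le m1.
Qed.

Lemma zchain_proper X Y m : zsubset X Y -> ~ zsubset Y X -> zirreducible coord Y ->
  zchain coord X m -> zchain coord Y m.+1.
Proof.
move=> XY YX irrY [Z [H1 H2]]; exists (fun k => if (k <= m)%N then Z k else Y); split.
  move=> k; rewrite leq_eqVlt ltnS => /predU1P[->|km]; first by rewrite ltnn; split.
  by rewrite km; have [irr sub] := H1 k km; split=> // x /sub/XY.
move=> k; rewrite ltnS leq_eqVlt => /predU1P[->|km].
  rewrite eqxx ltnn /=; have [_ sub] := H1 m (leqnn m); split=> [x /sub/XY|YZ] //.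
  by apply: YX => x /YZ/sub.
by rewrite km orbT; exact: H2.
Qed.

End Dimensions.

Lemma has_dim_Rep (K : fieldType) N (d : 'I_N.+1 -> nat) :
  (forall s : seq K, exists x, x \notin s) ->
  has_dim (@repcoord K N d) (fun _ => True) (\sum_(0 <= k < N) dn d k.+1 * dn d k)%N.
Proof.
move=> Kinf; pose C := {i : 'I_N & ('I_(dn d i.+1) * 'I_(dn d i))%type}.
have -> : (\sum_(0 <= k < N) dn d k.+1 * dn d k)%N = #|{: C}|.
  rewrite big_mkord card_tagged sumnE big_map big_enum.
  by apply: eq_bigr => i _; rewrite card_prod !card_ord.
pose phi (t : 'I_#|{: C}| -> K) : Rep K d :=
  fun i => \matrix_(a, b) t (enum_rank (rcoord K a b : C)).
pose f (j : 'I_#|{: C}|) (A : Rep K d) : K := repcoord (enum_val j : RepCoord K d) A.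
have phiE t (c : C) : repcoord (c : RepCoord K d) (phi t) = t (enum_rank c).
  by case: c => i [a b]; rewrite /repcoord /phi /= mxE.
have := @has_dim_image K Kinf _ _ (@repcoord K N d) _ phi f.
move=> H; apply: has_dim_ext (H _ _ _) => [A|c|j|t].
- split=> // _ g gP /(_ A); apply; exists (fun j => f j A).
  by apply/functional_extensionality_dep => i; apply/matrixP => a b; rewrite mxE /f enum_rankK.
- by apply: polyfun_ext (pf_coord _ (enum_rank (c : C))) _ => t; rewrite /acoord phiE.
- exact: pf_coord.
exists (fun _ => 0) => s k; rewrite horner0 mulr0 addr0 /f phiE.
by rewrite enum_valK.
Qed.

Lemma num_infinite (K : numFieldType) (s : seq K) : exists x, x \notin s.
Proof.
apply/not_existsP => H; pose t := [seq k%:R : K | k <- iota 0 (size s).+1].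
have ut : uniq t by rewrite map_inj_uniq ?iota_uniq // => i j /eqP; rewrite eqr_nat => /eqP.
have ts : {subset t <= s} by move=> x _; apply/negPn/negP; exact: H.
by have := uniq_leq_size ut ts; rewrite size_map size_iota ltnn.
Qed.

(** * The rank locus *)

(** The two parameter spaces are different types, so the points are carried across by
    [mem_image]. *)
Lemma stratum_ext (K : fieldType) N (d : 'I_N.+1 -> nat) v v' :
  (forall k, (k <= N)%N -> v k = v' k) ->
  zsubset (@stratum K N d v) (@stratum K N d v').
Proof.
move=> vv'; apply: zclosure_min; first exact: zclosure_closed.
move=> _ [t ->]; apply: zclosure_sub; apply: (mem_image (H := fun k => tH t k)) => k kN.
  by rewrite -vv' // eH ?He.
have [HH1 HH0] := (HH t kN, HH t (ltnW kN)).
have inv H : H *m H = 0 -> (1%:M - H) *m (1%:M + H) = 1%:M :> 'M[K]_(_).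
  by move=> E; rewrite mulmxDr mulmx1 mulmxBl mul1mx E subr0 subrK.
rewrite arr_mkRep // -!vv' ?(ltnW kN) //.
have -> : (1%:M - tH t k.+1) *m ((1%:M + tH t k.+1) *m tB t k *m (1%:M - tH t k)) *m
    (1%:M + tH t k) = tB t k.
  by rewrite !mulmxA inv // mul1mx -mulmxA inv // mulmx1.
exact: eBe.
Qed.

Section MainGeometry.
Variables (K : fieldType) (N : nat) (d : 'I_N.+1 -> nat) (r : nat) (p : 'I_N.+1).
Hypothesis Kinf : forall s : seq K, exists x, x \notin s.
Hypothesis rn : (r < d p)%N.
Hypothesis dmin : forall i, (d p <= d i)%N.
Variable C : nat.
Local Notation W := (weights d r p).
Hypothesis Cmin : forall w, w \in W -> (C <= wcost d r p (wnat w))%N.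
Hypothesis Cex : exists2 w, w \in W & wcost d r p (wnat w) = C.
Local Notation Wm := [set w in W | wcost d r p (wnat w) == C].
Local Notation coord := (@repcoord K N d).
Local Notation dimRep := (\sum_(0 <= k < N) dn d k.+1 * dn d k)%N.
Local Notation Stratum := (@stratum K N d).
Local Notation Sg := (@Sigma K N d r).
Local Notation e := (dimRep - C)%N.

Let pN : (p <= N)%N. Proof. by rewrite -ltnS. Qed.
Let dE (i : 'I_N.+1) : dn d i = d i. Proof. by rewrite /dn inord_val. Qed.
Let dmin' k : (k <= N)%N -> (dn d p <= dn d k)%N. Proof. by move=> _; rewrite dE dmin. Qed.

Lemma npar_wcost v : admissible d p v ->
  (npar d v + wcost d (dn d 0 - v 0%N) p (fun i => wv d p v i) = dimRep)%N.
Proof.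
move=> adm; have := npar_count (adm_dl adm); have := sum_total dmin' adm; lia.
Qed.

Definition vw (w : {ffun 'I_N.+1 -> 'I_(d p).+1}) : nat -> nat :=
  vof d p (fun k => wnat w (inord k)).

Lemma sum_weights w : w \in W -> (\sum_(0 <= k < N.+1) wnat w (inord k) = dn d p)%N.
Proof.
rewrite inE big_mkord => /andP[_ /eqP E]; rewrite dE -E.
by apply: eq_bigr => i _; rewrite inord_val.
Qed.

Lemma vw_admissible w : w \in W -> admissible d p (vw w).
Proof. by move=> wW; apply: vof_admissible => //; exact: sum_weights. Qed.

Lemma wv_vw w (i : 'I_N.+1) : w \in W -> wv d p (vw w) i = wnat w i.
Proof.
move=> wW; rewrite /vw wv_vof ?inord_val //; first exact: sum_weights.
by rewrite -ltnS.
Qed.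

Lemma vw_0 w : w \in W -> (dn d 0 - vw w 0 = r)%N.
Proof. by move=> wW; rewrite -(wv_p d p (vw w)) wv_vw //; move: wW; rewrite inE => /andP[/eqP]. Qed.

Lemma npar_vw w : w \in Wm -> npar d (vw w) = e.
Proof.
rewrite inE => /andP[wW /eqP wC]; have := npar_wcost (vw_admissible wW).
rewrite vw_0 // (@eq_wcost _ _ _ _ _ (wnat w)) ?wC => [|i]; first by lia.
exact: wv_vw.
Qed.

Lemma npar_le v : admissible d p v -> (dn d 0 - v 0%N <= r)%N -> (npar d v <= e)%N.
Proof.
move=> adm u0; have [H _] := wcost_strata_ge rn Cmin adm u0.
by have := npar_wcost adm; lia.
Qed.

Lemma dimRep_ge : (C <= dimRep)%N.
Proof.
have [w wW wC] := Cex; have adm := vw_admissible wW.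
have [|H _] := wcost_strata_ge rn Cmin adm; first by rewrite vw_0.
by have := npar_wcost adm; lia.
Qed.

Lemma stratum_irreducible v : zirreducible coord (Stratum v).
Proof. by apply: zclosure_image_irreducible => //; exact: polymap_phi. Qed.

Definition bounded_rank_stratum (w : {ffun 'I_N.+1 -> 'I_(bnd d)}) : bool :=
  `[< admissible d p (vnat w) /\ (dn d 0 - vnat w 0 <= r)%N >].

Lemma Sigma_subU : zsubset Sg (fun A => exists w : {w | bounded_rank_stratum w},
  Stratum (vnat (val w)) A).
Proof.
move=> A /(Sigma_cover Kinf pN)[w [w1 w2 w3]].
have wP : bounded_rank_stratum w by apply/asboolP; split.
by exists (exist _ w wP).
Qed.

Lemma has_dim_Sigma : has_dim coord Sg e.
Proof.
split.
  have [w wW wC] := Cex; have wm : w \in Wm by rewrite inE wW wC /=.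
  have adm := vw_admissible wW.
  have [c _] := has_dim_stratum Kinf pN dmin' adm; rewrite npar_vw // in c.
  by apply: zchain_sub c; apply: stratum_Sigma adm _; rewrite vw_0.
pose J := {w | bounded_rank_stratum w}.
apply: (@zchain_cover K Kinf _ _ coord J (fun w => npar d (vnat (val w)))
  (fun w => @phi K N d (vnat (val w))) Sg e e.+1 _ Sigma_subU) => [w|w|].
- exact: polymap_phi.
- by have /asboolP[w1 w2] := valP w; exact: npar_le.
exact: leqnn.
Qed.

(** A strictly larger irreducible subset of [Sg] would prolong a chain of length [e] inside [Sg]. *)
Lemma stratum_maximal v Z : admissible d p v -> npar d v = e ->
  zirreducible coord Z -> zsubset Z Sg -> zsubset (Stratum v) Z -> zsubset Z (Stratum v).
Proof.
move=> adm ve irrZ ZS vZ; apply: contrapT => Zv; have [_] := has_dim_Sigma; apply.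
apply: zchain_sub ZS _; apply: zchain_proper vZ Zv irrZ _.
by rewrite -ve; have [] := has_dim_stratum Kinf pN dmin' adm.
Qed.

Lemma vw_component w : w \in Wm ->
  zcomponent coord Sg (Stratum (vw w)) /\ has_dim coord (Stratum (vw w)) e.
Proof.
move=> wm; have /setIdP[wW _] := wm; have adm := vw_admissible wW; split; last first.
  by rewrite -(npar_vw wm); exact: (has_dim_stratum Kinf pN dmin' adm).
split; first exact: stratum_irreducible.
  by apply: stratum_Sigma adm _; rewrite vw_0.
by move=> Z irrZ ZS; apply: stratum_maximal => //; exact: npar_vw.
Qed.

(** A component lies in some stratum of the cover, hence equals it; having dimension [e], that
    stratum has cost [C], so its weight belongs to [Wm]. *)
Lemma component_vw Z : zcomponent coord Sg Z -> has_dim coord Z e ->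
  exists2 w, w \in Wm & eqsetP Z (Stratum (vw w)).
Proof.
move=> [irrZ ZS Zmax] Ze.
pose J := {w | bounded_rank_stratum w}.
have [[w0 w0P] /= Zw] : exists w : J, zsubset Z (Stratum (vnat (val w))).
  apply: (zirreducible_subU irrZ) => [w|A /ZS/Sigma_subU //]; exact: zclosure_closed.
have /asboolP[adm u0] := w0P.
set v := vnat w0 in adm u0 Zw.
have wZ : zsubset (Stratum v) Z.
  by apply: Zmax => //; [exact: stratum_irreducible | exact: stratum_Sigma adm u0].
have vZ : eqsetP (Stratum v) Z by move=> A; split; [exact: wZ | exact: Zw].
have ve := has_dim_uniq (has_dim_ext vZ (has_dim_stratum Kinf pN dmin' adm)) Ze.
have vC : (C = wcost d (dn d 0 - v 0%N) p (fun i => wv d p v i))%N.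
  by have := npar_wcost adm; have := dimRep_ge; lia.
have [_ /(_ vC) ur] := wcost_strata_ge rn Cmin adm u0.
have sw := sum_wv adm; pose w := wof d p (fun i => wv d p v i).
have wW : w \in W by apply: wof_weights; rewrite ?wv_p.
exists w; first by rewrite inE wW (eq_wcost d p r (wofE sw)) vC ur /= eqxx.
have E k : (k <= N)%N -> v k = vw w k.
  apply: (wv_inj adm (vw_admissible wW)) => j jN.
  by have := wv_vw (Ordinal (jN : j < N.+1)%N) wW; rewrite wofE // => /= ->.
move=> A; split=> [/Zw|ZA]; first exact: stratum_ext.
by apply: wZ; apply: stratum_ext ZA => k kN; rewrite E.
Qed.

(** The largest rank of the composite from [s] to [t] on a stratum is [v t + (dn d s - v s)] when
    one end is [p]. The ends [p] and [N] determine [v p], and [p] with [k] then determines [v k]. *)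
Lemma stratum_inj v v' : admissible d p v -> admissible d p v' ->
  eqsetP (Stratum v) (Stratum v') -> forall k, (k <= N)%N -> v k = v' k.
Proof.
move=> adm adm' vv'.
have le v1 v2 s t : admissible d p v1 -> admissible d p v2 ->
    zsubset (Stratum v1) (Stratum v2) -> (s <= t)%N -> (t <= N)%N -> (s == p) || (t == p) ->
    (v1 t + (dn d s - v1 s) <= v2 t + (dn d s - v2 s))%N.
  move=> a1 a2 sub st tN stp; apply: leq_trans (rank_cmp_B0 K pN dmin' a1 st tN stp) _.
  exact: stratum_rank_le (adm_dl a2) st tN sub.
have eq s t : (s <= t)%N -> (t <= N)%N -> (s == p) || (t == p) ->
    (v t + (dn d s - v s) = v' t + (dn d s - v' s))%N.
  move=> st tN stp; apply/eqP; rewrite eqn_leq !le // => A; by case: (vv' A).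
have vp : v p = v' p.
  have := eq p N pN (leqnn N); rewrite eqxx (adm_N adm) (adm_N adm') => /(_ isT).
  by have := adm_dl adm pN; have := adm_dl adm' pN; lia.
move=> k kN; case: (leqP p k) => pk.
  by have := eq p k pk kN; rewrite eqxx vp => /(_ isT); lia.
have := eq k p (ltnW pk) pN; rewrite eqxx orbT vp => /(_ isT).
by have := adm_dl adm kN; have := adm_dl adm' kN; lia.
Qed.

Lemma vw_inj w w' : w \in W -> w' \in W ->
  eqsetP (Stratum (vw w)) (Stratum (vw w')) -> w = w'.
Proof.
move=> wW w'W /(stratum_inj (vw_admissible wW) (vw_admissible w'W)) E.
apply/ffunP => i; apply: val_inj; rewrite -[LHS](wv_vw i wW) -[RHS](wv_vw i w'W).
have iN : (i <= N)%N by rewrite -ltnS.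
rewrite /wv; case: ltngtP => [ip|pi|//].
- by rewrite !E // (leq_trans ip).
- by rewrite !E // (leq_trans (leq_pred _)).
by rewrite E.
Qed.

Lemma components_Sigma : exists Z : 'I_#|Wm| -> Rep K d -> Prop,
  [/\ forall k, zcomponent coord Sg (Z k) /\ has_dim coord (Z k) e,
      forall k l, eqsetP (Z k) (Z l) -> k = l &
      forall Z', zcomponent coord Sg Z' -> has_dim coord Z' e -> exists k, eqsetP Z' (Z k)].
Proof.
exists (fun k => Stratum (vw (enum_val k))); split=> [k|k l H|Z' Z'c Z'e].
- by apply: vw_component; exact: enum_valP.
- apply: enum_val_inj; apply: vw_inj H.
    by have /setIdP[] := enum_valP k.
  by have /setIdP[] := enum_valP l.
have [w wm H] := component_vw Z'c Z'e.
by exists (enum_rank_in wm w); rewrite enum_rankK_in.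
Qed.

End MainGeometry.

Theorem theoremA (R : realType) (N : nat) (d : 'I_N.+1 -> nat) (r : nat) :
  (0 < N)%N ->
  (forall i : 'I_N.+1, (r < d i)%N) ->
  exists (D e theta : nat),
    let coord := @repcoord R[i] N d in
    [/\ has_dim coord (fun _ => True) D,
        has_dim coord (@Sigma R[i] N d r) e,
        (* theta = number of irreducible components of codimension C = D - e *)
        (exists Z : 'I_theta -> Rep R[i] d -> Prop,
           [/\ forall k, zcomponent coord (@Sigma R[i] N d r) (Z k)
                         /\ has_dim coord (Z k) e,
               forall k l, eqsetP (Z k) (Z l) -> k = l &
               forall Z', zcomponent coord (@Sigma R[i] N d r) Z' ->
                 has_dim coord Z' e -> exists k, eqsetP Z' (Z k)]),
        (* the smallest degree c with (A^r_d)_c <> 0 is C *)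
        ((exists p : Rd d, inAc r (D - e) p /\ p <> 0) /\
         (forall c, (c < D - e)%N -> forall p : Rd d, inAc r c p -> p = 0)) &
        (* (A^r_d)_C is a free Z-module of rank theta *)
        free_Zmod_rank (@inAc N d r (D - e)) theta].
Proof.
move=> N0 rd; pose p := [arg min_(i < ord0 : 'I_N.+1) d i].
have dmin i : (d p <= d i)%N by rewrite /p; case: arg_minnP => // j _; apply.
have rn := rd p; have Kinf := @num_infinite R[i].
(* A second group to carry the weight [d p - r]; it exists because [0 < N], and shows that [weights]
   is nonempty. *)
pose q : 'I_N.+1 := if p == ord0 then ord_max else ord0.
have qp : q != p.
  by rewrite /q; case: (eqVneq p ord0) => [->|]; rewrite eq_sym // -val_eqE /= eq_sym -lt0n.
have W0 : exists w, w \in weights d r p.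
  pose f i := (if i == p then r else if i == q then d p - r else 0)%N.
  exists (wof d p f); apply: wof_weights; last by rewrite /f eqxx.
  rewrite (bigD1 p) //= (bigD1 q) //= {1 2}/f !eqxx (negbTE qp) big1.
    by rewrite addn0 subnKC // ltnW.
  by move=> i /andP[/negbTE ip /negbTE iq]; rewrite /f ip iq.
have [C [Cmin Cex]] : exists C,
    (forall w, w \in weights d r p -> (C <= wcost d r p (wnat w))%N) /\
    exists2 w, w \in weights d r p & wcost d r p (wnat w) = C.
  have [w0 w0W] := W0.
  case: (arg_minnP (fun w => wcost d r p (wnat w)) w0W) => w wW wmin.
  by exists (wcost d r p (wnat w)); split=> //; exists w.
have [A1 A2 A3] := algebra_side rn dmin Cmin Cex.
exists (\sum_(0 <= k < N) dn d k.+1 * dn d k)%N, (\sum_(0 <= k < N) dn d k.+1 * dn d k - C)%N,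
  #|[set w in weights d r p | wcost d r p (wnat w) == C]| => coord.
(* The truncated difference [D - e] is [C] because [C] does not exceed the dimension of the whole
   space. *)
rewrite (subKn (dimRep_ge rn dmin Cmin Cex)); split=> //.
- exact: has_dim_Rep.
- exact: has_dim_Sigma.
exact: components_Sigma.
Qed.
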